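(* Let $G$ be a countably infinite amenable group with identity $e$ and a Følner sequence $F=(F_N)_{N\in\mathbb{N}}$. For a set $H\subseteq G\setminus\{e\}$, the following are equivalent: 1. $H$ is an $F$-vdC set. 2. For all sequences $(z_g)_{g\in G}$ of complex numbers in the unit disk $\mathbb{D}$, $$\lim_{N\to\infty}\frac{1}{|F_N|}\sum_{g\in F_N}z_{hg}\overline{z_g}=0\text{ for all }h\in H\quad\text{implies}\quad\lim_{N\to\infty}\frac{1}{|F_N|}\sum_{g\in F_N}z_{g}=0.$$ 3. For all sequences $(z_g)_{g\in G}$ of complex numbers in $\mathbb{S}^1$, $$\lim_{N\to\infty}\frac{1}{|F_N|}\sum_{g\in F_N}z_{hg}\overline{z_g}=0\text{ for all }h\in H\quad\text{implies}\quad\lim_{N\to\infty}\frac{1}{|F_N|}\sum_{g\in F_N}z_{g}=0.$$ 4. $H$ is a vdC set in $G$: for all measure preserving systems $(X,\mathcal{A},\mu,(T_g)_{g\in G})$ and (complex valued) $f\in L^\infty(\mu)$, $$\int_{X}f(T_hx)\cdot\overline{f(x)}\,d\mu(x)=0\text{ for all }h\in H\quad\text{implies}\quad\int_{X}f\,d\mu=0.$$ 5. For every $\varepsilon>0$ there are $\delta>0$ and finite sets $A\subseteq G$ (nonempty) and $H_0\subseteq H$ such that for any $K\in\mathbb{N}$ and any sequences $(z_{a,k})_{a\in G}$ in $\mathbb{D}$, $k=1,\dots,K$, such that $$\left|\frac{1}{K|A|}\sum_{k=1}^K\sum_{a\in A}z_{ha,k}\overline{z_{a,k}}\right|<\delta\text{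 for all }h\in H_0,$$ we have $$\left|\frac{1}{K|A|}\sum_{k=1}^K\sum_{a\in A}z_{a,k}\right|<\varepsilon.$$
   Context: A (left) Følner sequence in a countable group $G$ is a sequence $F=(F_N)_{N\in\mathbb{N}}$ of (nonempty) finite subsets of $G$ such that $\lim_{N\to\infty}\frac{|gF_N\Delta F_N|}{|F_N|}=0$ for all $g\in G$; $G$ is (left) amenable if it has a Følner sequence. A measure preserving system is a probability space together with an action $(T_g)_{g\in G}$ of $G$ by measure preserving maps (so $T_g\circ T_h=T_{gh}$). $\mathbb{D}=\{z\in\mathbb{C}:|z|\leq1\}$, $\mathbb{S}^1=\{z\in\mathbb{C}:|z|=1\}$, $\mathbb{N}=\{1,2,\dots\}$. Let $\mathbb{T}=\mathbb{R}/\mathbb{Z}$ with Lebesgue (Haar) probability measure $m$. A sequence $(x_g)_{g\in G}$ in $\mathbb{T}$ is $F$-u.d. mod $1$ if for every continuous $\varphi:\mathbb{T}\to\mathbb{C}$ one has $\lim_{N\to\infty}\frac{1}{|F_N|}\sum_{g\in F_N}\varphi(x_g)=\int_{\mathbb{T}}\varphi\,dm$. A subset $H\subseteq G\setminus\{e\}$ is $F$-vdC if every sequence $(x_g)_{g\in G}$ in $\mathbb{T}$ such that $(x_{hg}-x_g)_{g\in G}$ is $F$-u.d. mod $1$ for all $h\in H$ is itself $F$-u.d. mod $1$. *)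

(* Defs.v *)
From HB Require Import structures.
From mathcomp Require Import all_boot all_order all_algebra.
From mathcomp Require Import ring_quotient complex finmap.
From mathcomp Require Import all_classical all_reals all_analysis.
From mathcomp Require Import measurable_realfun.

Set Implicit Arguments.
Unset Strict Implicit.
Unset Printing Implicit Defensive.

Import Order.TTheory GRing.Theory Num.Theory numFieldNormedType.Exports.

Local Open Scope classical_set_scope.
Local Open Scope ring_scope.

Section Circle.
Variable R : realType.

(* The additive quotient R/Z ([Num.int] is the predicate "is an integer"), with
   the quotient topology and the Borel sigma-algebra. *)
Definition circle : Type :=
  @Quotient.quot R (GRing.ZmodClosed.clone R (@Num.int_num_subdef R) _).

HB.instance Definition _ := GRing.Zmodule.on circle.
HB.instance Definition _ := Quotient.on circle.
HB.instance Definition _ := isPointed.Build circle 0.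

Definition circle_pi (x : R) : circle := \pi_circle%qT x.

Lemma circle_piB (x y : R) : circle_pi (x - y) = circle_pi x - circle_pi y.
Proof. by rewrite /circle_pi Quotient.pi_add Quotient.pi_opp. Qed.

Lemma circle_pi_eq (x y : R) :
  (circle_pi x == circle_pi y) = (x - y \is a Num.int).
Proof. by rewrite /circle_pi -Quotient.idealrBE. Qed.

Lemma circle_pi_surj (t : circle) : exists x : R, circle_pi x = t.
Proof. by exists (repr t); exact: reprK. Qed.

Definition circle_open (U : set circle) := open (circle_pi @^-1` U).

Lemma circle_openT : circle_open setT.
Proof. exact: openT. Qed.

Lemma circle_openI : setI_closed circle_open.
Proof. by move=> A B; exact: openI. Qed.

Lemma circle_open_bigU (I : Type) (f : I -> set circle) :
  (forall i, circle_open (f i)) -> circle_open (\bigcup_i f i).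
Proof. by move=> fo; apply: bigcup_open => i _; exact: fo. Qed.

HB.instance Definition _ := @isOpenTopological.Build circle circle_open
  circle_openT circle_openI circle_open_bigU.

HB.instance Definition _ :=
  Measurable.copy circle (g_sigma_algebraType (@open circle)).

(* [uniform_prob], like [lebesgue_measure], lives on [measurableTypeR R], whose
   display differs from that of the canonical measurable structure on [R]. *)
Local Notation mR := [the measurableType _ of measurableTypeR R].

Lemma measurable_circle_pi :
  measurable_fun [set: mR] (circle_pi : mR -> circle).
Proof.
apply: (measurability (@open circle)) => //.
by move=> _ [U oU <-]; rewrite setTI; exact: open_measurable.
Qed.

Definition circle_pi_mfun : {mfun mR >-> circle} :=
  MeasurableFun.Pack (MeasurableFun.Class
    (@isMeasurableFun.Build _ _ mR circle circle_pi measurable_circle_pi)).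

(* Lebesgue probability on R/Z: image of Lebesgue measure on [0, 1]. *)
Definition haar_circle : probability circle R :=
  distribution (uniform_prob (@ltr01 R)) circle_pi_mfun.

End Circle.

Section ComplexFunctions.
Context d (X : measurableType d) (R : realType).

Definition cintegral (mu : {measure set X -> \bar R}) (f : X -> R[i]) : R[i] :=
  Complex (\int[mu]_x complex.Re (f x)) (\int[mu]_x complex.Im (f x)).

(* [`|f x|] is the modulus as an element of [R[i]], hence [complex.Re]. *)
Definition cLinfty (mu : {measure set X -> \bar R}) (f : X -> R[i]) : Prop :=
  [/\ measurable_fun setT (fun x => complex.Re (f x)),
      measurable_fun setT (fun x => complex.Im (f x)) &
      finite_norm mu +oo%E (fun x => complex.Re `|f x|)].

End ComplexFunctions.

Section VanDerCorput.
Variables (R : realType) (G : groupType).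

Definition ltranslate (g : G) (A : {fset G}) : {fset G} :=
  [fset (g * a)%g | a in A]%fset.

Definition symdiff (A B : {fset G}) : {fset G} :=
  ((A `\` B) `|` (B `\` A))%fset.

Definition folner (F : nat -> {fset G}) : Prop :=
  (forall N, F N != fset0) /\
  forall g : G,
    (#|` symdiff (ltranslate g (F N)) (F N)|%:R / #|` F N|%:R : R)
      @[N --> \oo] --> (0 : R).

Definition average (A : {fset G}) (z : G -> R[i]) : R[i] :=
  #|` A|%:R^-1 * \sum_(g <- A) z g.

(* The topology of the complex numbers is that of the regular module [R[i]^o]
   of the [numFieldType] [R[i]]: the libraries put none on [R[i]] itself. *)
Definition average_cvg (F : nat -> {fset G}) (z : G -> R[i]) (l : R[i]) : Prop :=
  average (F N) z @[N --> \oo] --> (l : R[i]^o).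

Definition ud_mod1 (F : nat -> {fset G}) (x : G -> circle R) : Prop :=
  forall phi : circle R -> R[i]^o, continuous phi ->
    average_cvg F (fun g => phi (x g)) (cintegral (haar_circle R) phi).

Definition F_vdC (F : nat -> {fset G}) (H : set G) : Prop :=
  forall x : G -> circle R,
    (forall h, H h -> ud_mod1 F (fun g => x (h * g)%g - x g)) -> ud_mod1 F x.

Definition mp_action d (X : measurableType d) (mu : probability X R)
    (T : G -> X -> X) : Prop :=
  [/\ forall x, T 1%g x = x,
      forall g h x, T g (T h x) = T (g * h)%g x,
      forall g, measurable_fun setT (T g) &
      forall g A, measurable A -> mu (T g @^-1` A) = mu A].

Definition vdC (H : set G) : Prop :=
  forall d (X : measurableType d) (mu : probability X R) (T : G -> X -> X),
    mp_action mu T ->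
    forall f : X -> R[i], cLinfty mu f ->
      (forall h, H h -> cintegral mu (fun x => f (T h x) * (f x)^*) = 0) ->
      cintegral mu f = 0.

End VanDerCorput.

(* Main.v *)
Require Import Defs.
From HB Require Import structures.
From mathcomp Require Import all_boot all_order all_algebra.
From mathcomp Require Import ring_quotient complex finmap.
From mathcomp Require Import all_classical all_reals all_analysis.
From mathcomp Require Import measurable_realfun.
From mathcomp Require Import zify ring lra.

(* Write (1)-(5) for the conditions.  (2) => (3) is immediate and (3) => (1) is Weyl's
   criterion, applied to the powers of a character of R/Z.

   (1) => (2) and (2) => (5) replace deterministic data by random data.  For a bounded z,
   independent random roots of unity y_g of growing order can be chosen with E y_g = z_g / 2
   and E y_g^k = 0 for the following k, so that y_{hg} conj(y_g) has the right averages in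
   expectation.  If (5) fails, its finite counterexamples are placed at random: at each site
   of a region a random copy is activated with a small probability, and g receives a value
   only if exactly one site of its window is active; the correlations of the resulting
   sequence are those of the counterexamples up to a boundary term, while the mean keeps a
   fixed proportion.  In both cases one outcome has to be selected for which countably many
   averages along F are close to their expectations, although F may grow slowly.  The
   group is cut into large disjoint cells, the choices in a cell being made one by one so that
   the sum of squares of the deviations of all cells grows only linearly (conditional
   expectations), and a slowly varying level function on G lets the scale of the
   construction tend to infinity.

   (5) => (2) applies (5) to the translates of z by the elements of F_N.  (5) => (4) applies
   (5) along orbits of finitely many points whose empirical averages approximate the relevant
   integrals.  (4) => (2) is a correspondence principle: independent signs with means Re z_{bg}
   and Im z_{bg} (b in G), averaged over g in F_N and passed to an ultrafilter limit,
   define a G-invariant measure on a space of bit sequences; it is obtained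
   from Lebesgue measure by coding points of [0, 1[ with nested intervals. *)

Set Implicit Arguments.
Unset Strict Implicit.
Unset Printing Implicit Defensive.

Import Order.TTheory GRing.Theory Num.Theory numFieldNormedType.Exports.

Local Open Scope classical_set_scope.
Local Open Scope ring_scope.

(** * Complex numbers and averages over finite sets *)

(** Almost sure convergence cannot be used to select the random outcome: [F N] may grow arbitrarily
    slowly, so deviation probabilities along [F] need not be summable. The greedy choice replaces
    it. In a cell the squared deviation is at most a constant, fixed by the window size, times the
    number of points of the cell; hence the deviation is small against that number once the cell is
    large, and windows meeting cells that cross the boundary of [F N] are few by the Følner
    property. Abrupt changes of scale would let large windows meet cells designed for small ones; a
    level function that moves by at most one across a window keeps neighbouring scales comparable.
    Countably many averages are handled together by admitting the [i]-th one only at levels at least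
    [i], that is off a finite set. That [H] avoids the identity enters through independence: [h * g]
    and [g] must be distinct sites for the expectation of a product to factor. *)

Section ComplexParts.
Variable R : realType.
Implicit Types z w : R[i].

Lemma Re_real_mul (a : R) z : complex.Re (a%:C%C * z) = a * complex.Re z.
Proof. by case: z => x y /=; rewrite mul0r subr0. Qed.

Lemma Im_real_mul (a : R) z : complex.Im (a%:C%C * z) = a * complex.Im z.
Proof. by case: z => x y /=; rewrite mul0r addr0. Qed.

Lemma Re_sum I (r : seq I) (P : pred I) (f : I -> R[i]) :
  complex.Re (\sum_(i <- r | P i) f i) = \sum_(i <- r | P i) complex.Re (f i).
Proof. by apply: (big_morph (@complex.Re R)) => // -[a b] [c d]. Qed.

Lemma Im_sum I (r : seq I) (P : pred I) (f : I -> R[i]) :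
  complex.Im (\sum_(i <- r | P i) f i) = \sum_(i <- r | P i) complex.Im (f i).
Proof. by apply: (big_morph (@complex.Im R)) => // -[a b] [c d]. Qed.

Lemma natC (n : nat) : n%:R = (n%:R : R)%:C%C :> R[i].
Proof. by rewrite rmorph_nat. Qed.

Lemma natCV (n : nat) : n%:R^-1 = (n%:R^-1 : R)%:C%C :> R[i].
Proof. by rewrite natC -fmorphV. Qed.

Lemma Re_mul_conj z w : complex.Re (z * w^*) =
  complex.Re z * complex.Re w + complex.Im z * complex.Im w.
Proof. by case: z w => a b [c d] /=; rewrite mulrN opprK. Qed.

Lemma Im_mul_conj z w : complex.Im (z * w^*) =
  complex.Im z * complex.Re w - complex.Re z * complex.Im w.
Proof. by case: z w => a b [c d] /=; rewrite mulrN addrC. Qed.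

Lemma normC_le (e : R) z :
  (`|z| <= e%:C%C) = (Num.sqrt (complex.Re z ^+ 2 + complex.Im z ^+ 2) <= e).
Proof. by rewrite normc_def lecR. Qed.

Lemma normC_lt (e : R) z :
  (`|z| < e%:C%C) = (Num.sqrt (complex.Re z ^+ 2 + complex.Im z ^+ 2) < e).
Proof. by rewrite normc_def ltcR. Qed.

Lemma normC1_sqr z :
  (`|z| <= 1) = (complex.Re z ^+ 2 + complex.Im z ^+ 2 <= 1).
Proof.
rewrite (_ : 1 = (1 : R)%:C%C) // normC_le -[X in _ <= X]sqrtr1.
by rewrite ler_sqrt // addr_ge0 ?sqr_ge0.
Qed.

Lemma normC1_Re z : `|z| <= 1 -> `|complex.Re z| <= 1.
Proof. by rewrite normC1_sqr ler_norml => h; apply/andP; split; nra. Qed.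

Lemma normC1_Im z : `|z| <= 1 -> `|complex.Im z| <= 1.
Proof. by rewrite normC1_sqr ler_norml => h; apply/andP; split; nra. Qed.

Lemma normC_lt_parts (e : R) z :
  `|complex.Re z| < e / 2 -> `|complex.Im z| < e / 2 -> `|z| < e%:C%C.
Proof.
rewrite normC_lt !ltr_norml => /andP[h1 h2] /andP[h3 h4].
have e0 : 0 < e by lra.
rewrite -[X in _ < X]ger0_norm ?ltW// -sqrtr_sqr ltr_sqrt ?exprn_gt0//.
nra.
Qed.

Lemma parts_lt_normC (e : R) z :
  `|z| < e%:C%C -> `|complex.Re z| < e /\ `|complex.Im z| < e.
Proof.
rewrite normC_lt => h; split; apply: le_lt_trans h.
  by rewrite -sqrtr_sqr ler_sqrt ?lerDl ?addr_ge0 ?sqr_ge0.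
by rewrite -sqrtr_sqr ler_sqrt ?lerDr ?addr_ge0 ?sqr_ge0.
Qed.

Lemma cvgC_parts T (F : set_system T) {FF : Filter F} (f : T -> R[i]) (l : R[i]) :
  (f x @[x --> F] --> (l : R[i]^o)) <->
  (complex.Re (f x) @[x --> F] --> complex.Re l) /\
  (complex.Im (f x) @[x --> F] --> complex.Im l).
Proof.
split=> [/(@cvgrPdist_lt _ R[i]^o) cv|[/cvgrPdist_lt cr /cvgrPdist_lt ci]].
  split; apply/cvgrPdist_lt => e e0.
    have := cv (e%:C%C); rewrite ltcR => /(_ e0); apply: filterS => N.
    by move/parts_lt_normC => [+ _]; rewrite raddfB.
  have := cv (e%:C%C); rewrite ltcR => /(_ e0); apply: filterS => N.
  by move/parts_lt_normC => [_ +]; rewrite raddfB.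
apply/(@cvgrPdist_lt _ R[i]^o) => e e0.
have [d ed] : exists d : R, e = d%:C%C.
  by apply/complex_realP; rewrite realE (ltW e0).
move: e0; rewrite ed ltcR => d0.
have d20 : 0 < d / 2 by rewrite divr_gt0.
move: (cr _ d20) (ci _ d20); apply: filterS2 => N h1 h2.
by apply: normC_lt_parts; rewrite raddfB.
Qed.

End ComplexParts.

Section Averages.
Variables (R : realType) (G : groupType).
Implicit Types (A : {fset G}) (u v : G -> R) (z : G -> R[i]).

Definition ravg A u : R := #|` A|%:R^-1 * \sum_(g <- A) u g.

Lemma Re_average A z : complex.Re (average A z) = ravg A (fun g => complex.Re (z g)).
Proof. by rewrite /average natCV Re_real_mul Re_sum. Qed.

Lemma Im_average A z : complex.Im (average A z) = ravg A (fun g => complex.Im (z g)).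
Proof. by rewrite /average natCV Im_real_mul Im_sum. Qed.

Lemma average_cvgP (F : nat -> {fset G}) z (l : R[i]) : average_cvg F z l <->
  (ravg (F N) (fun g => complex.Re (z g)) @[N --> \oo] --> complex.Re l) /\
  (ravg (F N) (fun g => complex.Im (z g)) @[N --> \oo] --> complex.Im l).
Proof.
rewrite /average_cvg cvgC_parts.
rewrite (_ : (fun N => complex.Re _) = fun N => ravg (F N) (fun g => complex.Re (z g))).
  rewrite (_ : (fun N => complex.Im _) = fun N => ravg (F N) (fun g => complex.Im (z g)))//.
  by apply/funext => N; rewrite Im_average.
by apply/funext => N; rewrite Re_average.
Qed.

Lemma ravgD A u v : ravg A (fun g => u g + v g) = ravg A u + ravg A v.
Proof. by rewrite /ravg big_split mulrDr. Qed.

Lemma ravgB A u v : ravg A (fun g => u g - v g) = ravg A u - ravg A v.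
Proof. by rewrite /ravg big_split/= sumrN mulrBr. Qed.

Lemma ravgZ A (a : R) u : ravg A (fun g => a * u g) = a * ravg A u.
Proof. by rewrite /ravg -mulr_sumr mulrCA. Qed.

Lemma eq_ravg A u v : (forall g, g \in A -> u g = v g) -> ravg A u = ravg A v.
Proof. by move=> uv; rewrite /ravg; congr (_ * _); apply: eq_big_seq. Qed.

Lemma ravg_cst A (a : R) : A != fset0 -> ravg A (fun=> a) = a.
Proof.
move=> A0; rewrite /ravg big_const_seq count_predT iter_addr_0 -[a *+ _]mulr_natl mulrA.
by rewrite mulVf ?mul1r// pnatr_eq0 cardfs_eq0.
Qed.

Lemma ler_ravg A u v : (forall g, g \in A -> u g <= v g) -> ravg A u <= ravg A v.
Proof.
move=> uv; rewrite /ravg ler_wpM2l ?invr_ge0 ?ler0n//.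
by rewrite big_seq [X in _ <= X]big_seq; apply: ler_sum.
Qed.

Lemma ler_norm_ravg A u : `|ravg A u| <= ravg A (fun g => `|u g|).
Proof.
by rewrite /ravg normrM ger0_norm ?invr_ge0 ?ler0n// ler_wpM2l ?invr_ge0 ?ler0n// ler_norm_sum.
Qed.

End Averages.

(** * Følner sequences *)

Section FiniteSubsets.
Variable G : groupType.
Implicit Types (A B P Q : {fset G}).

Lemma countable_enum (Gc : countable [set: G]) (Gi : infinite_set [set: G]) :
  exists (site : nat -> G) (idx : G -> nat), cancel site idx /\ cancel idx site.
Proof.
have : ([set: nat] #= [set: G])%card.
  by rewrite card_eqPle; split => //; apply/infiniteP.
move/card_bijP => [f [g fK gK]].
pose u (n : nat) : [set: nat] := SigSub (mem_set (I : [set: nat] n)).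
pose v (x : G) : [set: G] := SigSub (mem_set (I : [set: G] x)).
exists (fun n => val (f (u n))), (fun x => val (g (v x))); split.
  move=> n; rewrite (_ : v _ = f (u n)); last exact: val_inj.
  by rewrite fK.
move=> x; rewrite (_ : u _ = g (v x)); last exact: val_inj.
by rewrite gK.
Qed.

Definition fprod P Q : {fset G} := [fset (p * q)%g | p in P, q in Q]%fset.
Definition finv A : {fset G} := [fset (a^-1)%g | a in A]%fset.

Lemma fprodP P Q x :
  reflect (exists p q, [/\ p \in P, q \in Q & x = (p * q)%g]) (x \in fprod P Q).
Proof.
apply: (iffP (imfset2P _ _ _ _ _)) => [[p pP [q qQ ->]]|[p [q [pP qQ ->]]]].
  by exists p, q.
by exists p => //; exists q.
Qed.

Lemma mem_fprod P Q p q : p \in P -> q \in Q -> (p * q)%g \in fprod P Q.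
Proof. by move=> pP qQ; apply/fprodP; exists p, q. Qed.

Lemma mem_finv A x : (x \in finv A) = ((x^-1)%g \in A).
Proof.
apply/imfsetP/idP => [[y yA ->]|xA]; first by rewrite invgK.
by exists (x^-1)%g; rewrite ?invgK.
Qed.

Lemma mem_ltranslate g A x : (x \in ltranslate g A) = ((g^-1 * x)%g \in A).
Proof.
apply/imfsetP/idP => [[y yA ->]|xA]; first by rewrite mulKg.
by exists (g^-1 * x)%g; rewrite ?mulVKg.
Qed.

Lemma sum_ltranslate (V : nmodType) g A (u : G -> V) :
  \sum_(x <- ltranslate g A) u x = \sum_(x <- A) u (g * x)%g.
Proof. by rewrite big_imfset //= => x y _ _; exact: mulgI. Qed.

Lemma card_fset_filter (p : pred G) A :
  #|` [fset g in A | p g]%fset| = (\sum_(g <- A) p g)%N.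
Proof.
by rewrite card_fset_sum1 big_fset/= big_mkcond; apply: eq_bigr => g _; case: (p g).
Qed.

Definition inner Q A : {fset G} := [fset g in A | all (fun q => (q * g)%g \in A) Q]%fset.

Lemma innerP Q A g :
  reflect (g \in A /\ forall q, q \in Q -> (q * g)%g \in A) (g \in inner Q A).
Proof. by rewrite !inE; apply: (iffP andP) => -[gA /allP]. Qed.

(** Union bound: a point of [A] outside [inner Q A] has some [q * g] outside [A], so it lies in [A]
    but not in the translate by [q^-1]. *)
Lemma card_outer Q A :
  (#|` (A `\` inner Q A)%fset| <= \sum_(q <- Q) #|` symdiff (ltranslate (q^-1)%g A) A|)%N.
Proof.
have -> : (A `\` inner Q A)%fset = [fset g in A | has (fun q => (q * g)%g \notin A) Q]%fset.
  apply/fsetP => g; rewrite !inE; case: (g \in A) => //=.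
  by rewrite andbT -has_predC; apply: eq_has.
rewrite card_fset_filter; apply: (@leq_trans (\sum_(g <- A) \sum_(q <- Q) ((q * g)%g \notin A))%N).
  apply: leq_sum => g _; elim: (Q : seq G) => [|q s ih]; rewrite ?big_nil ?big_cons //=.
  by case: (_ \in A) => //=; rewrite ?add1n ?add0n.
rewrite exchange_big /=; apply: leq_sum => q _.
rewrite -card_fset_filter; apply: fsubset_leq_card; apply/fsubsetP => g.
by rewrite !inE mem_ltranslate invgK => /andP[gA /negbTE ->]; rewrite gA.
Qed.

End FiniteSubsets.

Lemma eq_cvgn (R : realType) (u v : nat -> R) (l : R) :
  u =1 v -> u N @[N --> \oo] --> l -> v N @[N --> \oo] --> l.
Proof. by move=> /funext ->. Qed.

Lemma cvg_sum0 (R : realType) I (r : seq I) (f : I -> nat -> R) :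
  (forall i, f i N @[N --> \oo] --> (0 : R)) ->
  (\sum_(i <- r) f i N) @[N --> \oo] --> (0 : R).
Proof.
move=> f0; elim: r => [|i r ih].
  by under eq_fun do rewrite big_nil; exact: cvg_cst.
apply: (@eq_cvgn _ (fun N => f i N + \sum_(j <- r) f j N)) => [N|].
  by rewrite big_cons.
have /= := cvgD (f0 i) ih; rewrite addr0; exact.
Qed.

Section Folner.
Variables (R : realType) (G : groupType).
Variable F : nat -> {fset G}.
Hypothesis F_folner : folner R F.

Lemma folner_card_gt0 N : (0 < #|` F N|)%N.
Proof. by rewrite cardfs_gt0; case: F_folner. Qed.

Lemma folner_inner (Q : {fset G}) (m : nat) :
  \forall N \near \oo, (m * #|` (F N `\` inner Q (F N))%fset| <= #|` F N|)%N.
Proof.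
have cv : (\sum_(q <- Q) (#|` symdiff (ltranslate (q^-1)%g (F N)) (F N)|%:R / #|` F N|%:R : R))
    @[N --> \oo] --> (0 : R).
  by apply: cvg_sum0 => q; exact: F_folner.2.
have m0 : 0 < (m.+1%:R^-1 : R) by rewrite invr_gt0.
move/cvgrPdist_lt : cv => /(_ _ m0); apply: filterS => N.
rewrite sub0r normrN ger0_norm; last by apply: sumr_ge0 => q _; rewrite divr_ge0.
rewrite -mulr_suml -natr_sum ltr_pdivrMr ?ltr0n ?folner_card_gt0 //.
rewrite mulrC ltr_pdivlMr ?ltr0n // -natrM ltr_nat => h.
by have := card_outer Q (F N); nia.
Qed.

(** A nonempty [inner Q (F N)] puts a translate [Q * g] inside [F N], and [Q] can be taken as large
    as desired since [G] is infinite. *)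
Lemma folner_card (Gi : infinite_set [set: G]) (m : nat) :
  \forall N \near \oo, (m <= #|` F N|)%N.
Proof.
have [Q _ mQ] := infinite_set_fset m Gi.
have := folner_inner Q 2; apply: filterS => N h.
have [|gI] := fset_0Vmem (inner Q (F N)).
  by move=> e0; move: h; rewrite e0 fsetD0; have := folner_card_gt0 N; lia.
case: gI => g /innerP[_ gQ]; apply: (leq_trans mQ).
have <- : #|` [fset (y * g)%g | y in Q]%fset| = #|` Q|.
  by apply: card_imfset; exact: mulIg.
apply: fsubset_leq_card.
by apply/fsubsetP => x /imfsetP[y /= yQ ->]; exact: gQ.
Qed.

(** Only points of the symmetric difference of [F N] and its translate by [b] fail to cancel. *)
Lemma ravg_shift (b : G) (u : G -> R) : (forall g, `|u g| <= 1) ->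
  (ravg (F N) (fun g => u (b * g)%g) - ravg (F N) u) @[N --> \oo] --> (0 : R).
Proof.
move=> u1; apply/cvgrPdist_le => e e0.
have /cvgrPdist_le/(_ _ e0) := F_folner.2 b; apply: filterS => N.
rewrite !sub0r !normrN => h; rewrite (le_trans _ h) // [leRHS]ger0_norm ?divr_ge0//.
rewrite /ravg -mulrBr normrM ger0_norm ?invr_ge0// mulrC ler_wpM2r ?invr_ge0//.
rewrite -sum_ltranslate (big_fsetID _ (mem (F N))) /=.
rewrite [X in _ - X](big_fsetID _ (mem (ltranslate b (F N)))) /=.
rewrite (_ : [fset x in F N | x \in ltranslate b (F N)]%fset =
  [fset x in ltranslate b (F N) | x \in F N]%fset); last first.
  by apply/fsetP => x; rewrite !inE andbC.
rewrite opprD addrACA subrr add0r.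
have bnd (S : {fset G}) : `|\sum_(x <- S) u x| <= #|` S|%:R.
  rewrite (le_trans (ler_norm_sum _ _ _))// card_fset_sum1 natr_sum.
  exact: ler_sum.
rewrite (le_trans (ler_normB _ _))// (le_trans (lerD (bnd _) (bnd _)))//.
rewrite -natrD ler_nat /symdiff.
set X := [fset _ in _ | _]%fset; set Y := [fset _ in _ | _]%fset.
have dXY : [disjoint X & Y]%fset.
  by apply/fdisjointP => x; rewrite !inE => /andP[_ /negbTE ->].
rewrite -cardfsUI (eqP dXY) cardfs0 addn0; apply: fsubset_leq_card.
by apply/fsubsetP => x; rewrite !inE => /orP[/andP[-> ->]|/andP[-> ->]]; rewrite ?orbT.
Qed.

End Folner.

(** * Levels and cells *)

Lemma fset_homo_leq (T : choiceType) (Q : nat -> {fset T}) :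
  (forall j, (Q j `<=` Q j.+1)%fset) ->
  forall i j, (i <= j)%N -> (Q i `<=` Q j)%fset.
Proof.
move=> Qm i j /subnK <-; elim: (j - i)%N => [|n ih]; first by rewrite add0n.
exact: fsubset_trans ih (Qm _).
Qed.

Section Scale.
Variables (R : realType) (G : groupType).
Variable F : nat -> {fset G}.
Hypothesis F_folner : folner R F.
Hypothesis G_countable : countable [set: G].
Hypothesis G_infinite : infinite_set [set: G].

Fixpoint fpow (Q : {fset G}) n : {fset G} :=
  if n is n'.+1 then fprod Q (fpow Q n') else [fset 1%g]%fset.

(** The level of a point is the first stage of an exhaustion of [G] by finite sets that contains it;
    each conclusion is secured by what is adjoined from one stage to the next. *)
Lemma monotone_levels (Q : nat -> {fset G}) (n_ : nat -> nat) :
  (forall j, 1%g \in Q j) ->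
  (forall j x, x \in Q j -> (x^-1)%g \in Q j) ->
  (forall j, (Q j `<=` Q j.+1)%fset) ->
  exists lev : G -> nat,
  [/\ forall J, exists E : {fset G}, forall g, (lev g <= J)%N -> g \in E,
      forall g q, q \in Q (lev g) ->
        (lev (q * g)%g <= (lev g).+1)%N /\ (lev g <= (lev (q * g)%g).+1)%N,
      forall j, exists2 N, (j <= N)%N &
        (j.+1 * #|` [fset g in F N | lev g != j.+1]%fset| <= #|` F N|)%N &
      forall j N, (N < n_ j.+2)%N -> forall g, g \in F N -> (lev g <= j.+1)%N].
Proof.
move=> Q1 QV Qm.
have [site [idx [siteK idxK]]] := countable_enum G_countable G_infinite.
have Qm2 := fset_homo_leq Qm.
have /choice[pick pickP] : forall p : nat * {fset G}, exists N,
    (p.1 <= N)%N /\ (p.1.+1 * #|` p.2| <= #|` F N|)%N.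
  move=> [j E]; have /filter_ex[N] : \forall N \near \oo,
      (j <= N)%N /\ (j.+1 * #|` E| <= #|` F N|)%N.
    by near=> N; split; [near: N; exact: nbhs_infty_ge|near: N; exact: (folner_card F_folner)].
  by exists N.
(* The products with [Q j.+2] give slow variation; the sets [F N] with [N < n_ j.+2] keep early
   Følner sets at low levels; [F (pick (j, E))] is so large compared with [E] that most of it lands
   exactly on level [j.+1]; [site j] makes the stages exhaust [G]. *)
pose next (j : nat) (E : {fset G}) := (E `|` fprod (Q j.+2) E `|`
  (\bigcup_(N <- iota 0 (n_ j.+2)) F N) `|` F (pick (j, E)) `|` [fset site j])%fset.
pose E := fix E j := if j is j'.+1 then next j' (E j') else fset0.
have ES j : (E j `<=` E j.+1)%fset by rewrite /= /next -!fsetUA fsubsetUl.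
have Em := fset_homo_leq ES.
have Eex g : exists j, g \in E j.
  by exists (idx g).+1; rewrite /= /next !inE idxK eqxx !orbT.
pose lev g := ex_minn (Eex g).
have levE g : g \in E (lev g) by rewrite /lev; case: ex_minnP.
have lev_le g j : g \in E j -> (lev g <= j)%N by rewrite /lev; case: ex_minnP => m _; apply.
have le_lev g j : (lev g <= j)%N -> g \in E j.
  by move=> h; exact: (fsubsetP (Em _ _ h)).
have mulE j q g : q \in Q j.+2 -> g \in E j -> (q * g)%g \in E j.+1.
  by move=> qQ gE; rewrite /= /next !inE (mem_fprod qQ gE) !orbT.
exists lev; split.
- by move=> J; exists (E J) => g; exact: le_lev.
- move=> g q qQ; split.
    apply: lev_le; apply: mulE; last exact: levE.
    exact: (fsubsetP (Qm2 _ _ (leqW (leqnSn _)))).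
  (* If the level dropped by two or more, [q * g] would lie in stage [i] with [lev g = i.+2], and
     multiplying back by [q^-1] would put [g] in stage [i.+1]. *)
  rewrite leqNgt; apply/negP => h.
  have [i ei] : exists i, lev g = i.+2 by exists (lev g).-2; lia.
  have : g \in E i.+1.
    rewrite -(mulKg q g); apply: mulE; first by rewrite -ei; exact: QV.
    by apply: le_lev; move: h; rewrite ei !ltnS.
  by move/lev_le; rewrite ei ltnn.
- move=> j; have [/= jN cN] := pickP (j, E j).
  exists (pick (j, E j)) => //; apply: leq_trans cN; rewrite leq_mul2l /=.
  apply: fsubset_leq_card; apply/fsubsetP => g; rewrite !inE => /andP[gF].
  apply: contraR => gE; rewrite eqn_leq; apply/andP; split.
    by apply: lev_le; rewrite /= /next !inE gF !orbT.
  by rewrite ltnNge; apply: contra gE; exact: le_lev.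
- move=> j N Nn g gF; apply: lev_le; rewrite /= /next !inE; apply/orP; left.
  apply/orP; left; apply/orP; right; apply/bigfcupP; exists N => //.
  by rewrite mem_iota andbT.
Unshelve. all: by end_near.
Qed.

(* The cells are built around the centres of a maximal family of disjoint sets
   [W (lev c) * c]. *)
Lemma packing (lev : G -> nat) (W : nat -> {fset G}) :
  (forall j, 1%g \in W j) ->
  exists cell : G -> G,
    (forall c, cell (cell c) = cell c) /\
    (forall g, exists w w', [/\ w \in W (lev g), w' \in W (lev (cell g)) &
        (w * g)%g = (w' * cell g)%g]) /\
    (forall g w, w \in W (lev (cell g)) -> cell (w * cell g)%g = cell g).
Proof.
move=> W1.
pose core c : set G := [set (w * c)%g | w in [set` W (lev c)]].
have [C [_ dC mC]] := ex_maximal_disjoint_subcollection core [set: G].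
have core1 c : core c c by exists 1%g; rewrite /= ?W1 ?mul1g.
have meet g : exists c, C c /\ (core g `&` core c) !=set0.
  have [Cg|nCg] := pselect (C g); first by exists g; split => //; exists g.
  apply/not_existsP => h.
  have [] := mC (C `|` [set g]).
  - by split; [left|move=> /(_ g) h2; apply: nCg; apply: h2; right].
  - by [].
  - move=> i j [Ci|->] [Cj|->] //; first exact: dC.
      by rewrite setIC => ij; case: (h i).
    by move=> ij; case: (h j).
(* A point of some core is sent to the centre of that core; any other point goes to a centre whose
   core meets its own, which maximality provides. *)
have /choice[cell cellP] : forall g, exists c, [/\ C c, (core g `&` core c) !=set0 &
    (exists2 c', C c' & core c' g) -> core c g].
  move=> g; have [[c Cc cg]|n] := pselect (exists2 c', C c' & core c' g).
    by exists c; split => //; exists g.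
  by have [c [Cc cc]] := meet g; exists c; split.
have cell_core c g : C c -> core c g -> cell g = c.
  move=> Cc cg; have [Cc' _ /(_ (ex_intro2 _ _ c Cc cg)) c'g] := cellP g.
  by apply: dC => //; exists g.
exists cell; split; [|split].
- by move=> c; apply: cell_core => //; case: (cellP c).
- move=> g; have [_ [x [[w wW wx] [w' w'W w'x]]] _] := cellP g.
  by exists w, w'; split => //; rewrite wx w'x.
- move=> g w wW; apply: cell_core; first by case: (cellP g).
  by exists w.
Qed.

(* The last conclusion says that only few windows [B (lev g) * g] with [g] in [F N] meet
   a cell that also meets the window of a point outside [F N]. *)
Lemma scale_cells (B : nat -> {fset G}) (M : nat -> nat) :
  (forall j, (B j `<=` B j.+1)%fset) ->
  exists (lev : G -> nat) (cell : G -> G),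
  [/\ forall J, exists E : {fset G}, forall g, (lev g <= J)%N -> g \in E,
      forall g b, b \in B (lev g) ->
        (lev (b * g)%g <= (lev g).+1)%N /\ (lev g <= (lev (b * g)%g).+1)%N,
      forall j, exists2 N, (j <= N)%N &
        (j.+1 * #|` [fset g in F N | lev g != j.+1]%fset| <= #|` F N|)%N,
      forall c, exists2 P : {fset G}, (forall g, (g \in P) = (cell g == cell c)) &
        (M (lev c) <= #|` P|)%N &
      (ravg (F N) (fun g => if `[< forall b c b' g', b \in B (lev g) ->
            cell c = cell (b * g)%g -> b' \in B (lev g') -> c = (b' * g')%g ->
            g' \in F N >] then 0 else #|` B (lev g)|%:R)) @[N --> \oo] --> (0 : R)].
Proof.
move=> Bm.
(* The levels of a point and of its centre differ by at most two, so the core of a centre of level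
   [j] must be large enough for all levels up to [j.+2]. *)
have /choice[W0 W0P] : forall j, exists W : {fset G}, (\sum_(i < j.+3) M i <= #|` W|)%N.
  by move=> j; have [W _ ?] := infinite_set_fset (\sum_(i < j.+3) M i)%N G_infinite; exists W.
pose W j : {fset G} := (1%g |` W0 j)%fset.
have W1 j : 1%g \in W j by rewrite !inE eqxx.
have WM j i : (i <= j.+2)%N -> (M i <= #|` W j|)%N.
  move=> ij; apply: (@leq_trans #|` W0 j|); last first.
    by apply: fsubset_leq_card; rewrite fsubsetUr.
  apply: leq_trans (W0P j); rewrite -ltnS in ij.
  by rewrite (bigD1 (Ordinal ij)) //= leq_addr.
pose Q0 j := (B j `|` W j `|` finv (B j `|` W j))%fset.
pose Q j := (\bigcup_(i <- iota 0 j.+1) Q0 i)%fset.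
have QP j x : reflect (exists2 i, (i <= j)%N & x \in Q0 i) (x \in Q j).
  apply: (iffP (bigfcupP _ _ _ _)) => [ [i + xi]|[i ij xi]].
    by rewrite mem_iota /= add0n ltnS andbT => ij; exists i.
  by exists i => //; rewrite mem_iota /= add0n ltnS ij.
have Q1 j : 1%g \in Q j.
  by apply/QP; exists 0%N => //; rewrite /Q0 !inE eqxx ?orbT.
have QV j x : x \in Q j -> (x^-1)%g \in Q j.
  move=> /QP[i ij xi]; apply/QP; exists i => //; move: xi; rewrite /Q0.
  by rewrite in_fsetU mem_finv => xi; rewrite in_fsetU mem_finv invgK orbC.
have Qm j : (Q j `<=` Q j.+1)%fset.
  by apply/fsubsetP => x /QP[i ij xi]; apply/QP; exists i => //; exact: leqW.
have BQ j x : x \in B j -> x \in Q j.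
  by move=> xB; apply/QP; exists j => //; rewrite /Q0 !in_fsetU xB.
have WQ j x : x \in W j -> x \in Q j.
  by move=> xW; apply/QP; exists j => //; apply/fsetUP; left; apply/fsetUP; right.
have Qm2 := fset_homo_leq Qm.
(* Six is the length of the chain of neighbours followed in [goodP]. Each step raises the level by
   at most one, so a chain starting at level at most [j] uses multipliers from [Q (j + 6)]. *)
have /choice[n_ n_P] : forall j, exists n, forall N, (n <= N)%N ->
    (j.+1 * #|` B j| * #|` (F N `\` inner (fpow (Q (j + 6)%N) 6) (F N))%fset| <= #|` F N|)%N.
  by move=> j; have [n _ nP] := folner_inner F_folner (fpow (Q (j + 6)%N) 6) (j.+1 * #|` B j|); exists n.
have [lev [lev_fin lev_slow lev_conc lev_n]] := monotone_levels n_ Q1 QV Qm.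
have [cell [cellK [cell_meet cell_core]]] := packing lev W1.
pose adj (x y : G) : Prop := (exists2 q, q \in Q (lev x) & y = (q * x)%g) \/
  (exists2 q, q \in Q (lev y) & x = (q * y)%g).
have adj_lev x y : adj x y -> (lev y <= (lev x).+1)%N.
  by case=> -[q qQ ->]; have [] := lev_slow _ _ qQ.
have adj_step x y K : adj x y -> (lev x < K)%N -> exists2 q, q \in Q K & y = (q * x)%g.
  move=> xy xK; have yx := adj_lev _ _ xy; case: xy => -[q qQ e].
    by exists q => //; exact: (fsubsetP (Qm2 _ _ (ltnW xK))).
  exists (q^-1)%g; last by rewrite e mulKg.
  by apply: QV; apply: (fsubsetP (Qm2 _ _ _)) qQ; exact: leq_trans xK.
have adjC x y : adj x y -> adj y x by case; [right|left].
have adj_cell c : exists2 x, adj c x & adj x (cell c).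
  have [w [w' [wW w'W e]]] := cell_meet c; exists (w * c)%g.
    by left; exists w => //; exact: WQ.
  by right; exists w' => //; exact: WQ.
exists lev, cell; split => //.
- by move=> g b bB; apply: lev_slow; exact: BQ.
- move=> c; pose K := (lev (cell c)).+2.
  pose P := [fset g in [fset (q * cell c)%g | q in fpow (Q K) 2]%fset | cell g == cell c]%fset.
  exists P.
    move=> g; rewrite !inE /=; apply: andb_idl => /eqP gc.
    have [x /adjC gx /adjC xc] := adj_cell g; rewrite gc in xc.
    have [q qQ xe] := adj_step _ _ K xc (leqnSn _).
    have [q' q'Q ge] := adj_step _ _ K gx (adj_lev _ _ xc).
    apply/imfsetP; exists (q' * (q * 1))%g; rewrite /=.
      by apply: mem_fprod => //; apply: mem_fprod => //; rewrite inE.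
    by rewrite mulg1 ge xe mulgA.
  apply: (@leq_trans #|` W (lev (cell c))|).
    apply: WM; have [x cx xc] := adj_cell c.
    by have := adj_lev _ _ (adjC _ _ cx); have := adj_lev _ _ (adjC _ _ xc); lia.
  have <- : #|` [fset (w * cell c)%g | w in W (lev (cell c))]%fset| = #|` W (lev (cell c))|.
    by apply: card_imfset; exact: mulIg.
  apply: fsubset_leq_card; apply/fsubsetP => x /imfsetP[w /= wW ->].
  rewrite !inE /= cell_core // eqxx andbT; apply/imfsetP; exists (w * (1 * 1))%g; last by rewrite !mulg1.
  rewrite /=.
  apply: mem_fprod; last by apply: mem_fprod; rewrite ?inE.
  by apply: (fsubsetP (Qm2 _ _ (leqW (leqnSn _)))); exact: WQ.
(* The chain runs from [g] to [b * g], to the common centre, to [c] and to [g'], with one auxiliary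
   point on each side of the centre. If [g] is deep enough inside [F N], its end point is still in
   [F N]. *)
have goodP N J g : (forall x, x \in F N -> (lev x <= J)%N) ->
    g \in inner (fpow (Q (J + 6)%N) 6) (F N) ->
    forall b c b' g', b \in B (lev g) -> cell c = cell (b * g)%g ->
      b' \in B (lev g') -> c = (b' * g')%g -> g' \in F N.
  move=> NJ /innerP[gF gI] b c b' g' bB cc b'B ce.
  have [x a1 a2] := adj_cell (b * g)%g.
  have [y a3 a4] := adj_cell c.
  have b0 : adj g (b * g)%g by left; exists b => //; exact: BQ.
  have b3 : adj (cell (b * g)%g) y by rewrite -cc; exact: adjC.
  have b4 : adj y c by exact: adjC.
  have b5 : adj c g' by right; exists b' => //; exact: BQ.
  have l0 := NJ _ gF; have l1 := adj_lev _ _ b0; have l2 := adj_lev _ _ a1.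
  have l3 := adj_lev _ _ a2; have l4 := adj_lev _ _ b3; have l5 := adj_lev _ _ b4.
  have [q0 q0Q e0] := adj_step _ _ (J + 6)%N b0 ltac:(lia).
  have [q1 q1Q e1] := adj_step _ _ (J + 6)%N a1 ltac:(lia).
  have [q2 q2Q e2] := adj_step _ _ (J + 6)%N a2 ltac:(lia).
  have [q3 q3Q e3] := adj_step _ _ (J + 6)%N b3 ltac:(lia).
  have [q4 q4Q e4] := adj_step _ _ (J + 6)%N b4 ltac:(lia).
  have [q5 q5Q e5] := adj_step _ _ (J + 6)%N b5 ltac:(lia).
  rewrite e5 e4 e3 e2 e1 e0.
  rewrite (_ : (_ * _)%g = (q5 * (q4 * (q3 * (q2 * (q1 * (q0 * 1))))) * g)%g); last first.
    by rewrite mulg1 !mulgA.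
  by apply: gI; do 6 (apply: mem_fprod => //); rewrite inE.
apply/cvgrPdist_le => e e0.
have [J0 J0e] : exists J0 : nat, J0.+1%:R^-1 < e.
  by have /filter_ex[n] := near_infty_natSinv_lt (PosNum e0); exists n.
(* Once [F N] outgrows the finite set of levels at most [J0.+2], its top level [J] exceeds [J0.+2];
   moreover [n_ J <= N], because earlier Følner sets stay below level [J]. *)
have [E EP] := lev_fin J0.+2.
have := folner_card F_folner G_infinite #|` E|.+1; apply: filterS => N EN.
have [g0 g0F g0lev] : exists2 g, g \in F N & (J0.+2 < lev g)%N.
  apply: contrapT => /forall2NP h; move: EN; rewrite ltnNge => /negP; apply.
  apply: fsubset_leq_card; apply/fsubsetP => g gF; apply: EP.
  by have [/(_ gF)|/negP] := h g; rewrite // -leqNgt.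
pose J := (\max_(g <- F N) lev g)%N.
have NJ x : x \in F N -> (lev x <= J)%N by move=> xF; rewrite /J; exact: leq_bigmax_seq.
have J0J := leq_trans g0lev (NJ _ g0F).
have [i Ji] : exists i, J = i.+2 by exists J.-2; lia.
have nN : (n_ J <= N)%N.
  rewrite leqNgt; apply/negP; rewrite Ji => /lev_n h.
  have : (J <= i.+1)%N by apply/bigmax_leqP_seq => x xF _; exact: h.
  by rewrite Ji ltnn.
rewrite sub0r normrN ger0_norm; last first.
  by rewrite mulr_ge0 ?invr_ge0// sumr_ge0// => g _; case: ifP.
apply: (@le_trans _ _ (#|` F N|%:R^-1 * (#|` B J|%:R * #|` (F N `\` inner (fpow (Q (J + 6)%N) 6) (F N))%fset|%:R))).
  rewrite ler_wpM2l ?invr_ge0//.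
  rewrite (_ : (F N `\` _)%fset = [fset g in F N | g \notin inner (fpow (Q (J + 6)%N) 6) (F N)]%fset); last first.
    by apply/fsetP => g; rewrite !inE andbC.
  rewrite card_fset_filter natr_sum mulr_sumr big_seq [leRHS]big_seq.
  apply: ler_sum => g gF; case: ifPn => [_|/asboolPn bad]; first by rewrite mulr_ge0.
  rewrite (_ : g \notin _); last first.
    by apply/negP => gI; apply: bad; exact: (goodP N J g NJ gI).
  by rewrite mulr1 ler_nat; apply: fsubset_leq_card; apply: fset_homo_leq => //; exact: NJ.
have := n_P J N nN; rewrite -mulnA -(ler_nat R) natrM natrM => h.
rewrite ler_pdivrMl ?ltr0n ?(folner_card_gt0 F_folner)//.
apply: (@le_trans _ _ (#|` F N|%:R * J.+1%:R^-1)); first by rewrite ler_pdivlMr ?ltr0n// mulrC.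
rewrite ler_wpM2l// (le_trans _ (ltW J0e))// lef_pV2 ?posrE ?ltr0n// ler_nat; lia.
Qed.

End Scale.

(** * Finite product expectations *)

Definition upd (w : nat -> nat) n o : nat -> nat := fun m => if m == n then o else w m.

Section Expectation.
Variables (K : comNzRingType) (s : nat -> nat) (p : nat -> nat -> K).

(* Expectation of [f] when the coordinates [n], ..., [n + k - 1] of [w] are resampled
   independently, coordinate [i] having law [p i] on [0], ..., [s i - 1]. *)
Fixpoint Er k n (f : (nat -> nat) -> K) (w : nat -> nat) : K :=
  if k is k'.+1 then \sum_(o < s n) p n o * Er k' n.+1 f (upd w n o) else f w.

Definition depends_on (P : pred nat) (f : (nat -> nat) -> K) :=
  forall w w', (forall m, P m -> w m = w' m) -> f w = f w'.

Lemma eq_Er k n f g w : f =1 g -> Er k n f w = Er k n g w.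
Proof.
by move=> fg; elim: k n w => [|k ih] n w //=; apply: eq_bigr => o _; rewrite ih.
Qed.

Lemma Er_depends P f k n w w' : depends_on P f ->
  (forall m, P m -> ~~ (n <= m < n + k)%N -> w m = w' m) ->
  Er k n f w = Er k n f w'.
Proof.
move=> fP; elim: k n w w' => [|k ih] n w w' ww' /=.
  by apply: fP => m Pm; apply: ww' => //; rewrite addn0 ltnNge andbN.
apply: eq_bigr => o _; congr (_ * _); apply: ih => m Pm; rewrite /upd.
case: eqVneq => // mn; rewrite addSnnS => h; apply: ww' => //.
by apply: contra h => /andP[nm ->]; rewrite andbT ltn_neqAle eq_sym mn.
Qed.

Lemma Er_mull (c : (nat -> nat) -> K) f k n w :
  (forall m o w', (n <= m < n + k)%N -> c (upd w' m o) = c w') ->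
  Er k n (fun w => c w * f w) w = c w * Er k n f w.
Proof.
elim: k n w => [|k ih] n w cw //=; rewrite mulr_sumr; apply: eq_bigr => o _.
rewrite ih ?cw ?leqnn ?addnS ?ltnS ?leq_addr//; first by rewrite mulrCA.
by move=> m o' w' h; apply: cw; rewrite addnS -addSn; case/andP: h => /ltnW -> ->.
Qed.

Lemma Er_sum I (r : seq I) (f : I -> (nat -> nat) -> K) k n w :
  Er k n (fun w => \sum_(i <- r) f i w) w = \sum_(i <- r) Er k n (f i) w.
Proof.
elim: k n w => [|k ih] n w //=; rewrite exchange_big; apply: eq_bigr => o _ /=.
by rewrite ih mulr_sumr.
Qed.

Lemma Er_prod (phi : nat -> nat -> K) k n w :
  Er k n (fun w => \prod_(n <= m < n + k) phi m (w m)) w =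
  \prod_(n <= m < n + k) \sum_(o < s m) p m o * phi m o.
Proof.
elim: k n w => [|k ih] n w /=; first by rewrite addn0 !big_geq.
rewrite addnS -addSn [RHS]big_ltn ?addSn ?ltnS ?leq_addr// mulr_suml.
apply: eq_bigr => o _; rewrite -mulrA; congr (_ * _).
rewrite -addSn -(ih n.+1 (upd w n o)).
rewrite -[X in X * _](_ : phi n ((upd w n o) n) = _); last by rewrite /upd eqxx.
rewrite -(@Er_mull (fun w => phi n (w n))); last first.
  by move=> m o' w' /andP[nm _]; rewrite /upd; case: eqVneq => // e; rewrite e ltnn in nm.
by apply: eq_Er => w'; rewrite big_ltn// addSn ltnS leq_addr.
Qed.

Hypothesis p1 : forall n, \sum_(o < s n) p n o = 1.

Lemma Er_skip P f k n w : depends_on P f -> ~~ P n ->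
  Er k.+1 n f w = Er k n.+1 f w.
Proof.
move=> fP Pn /=; rewrite -[RHS]mul1r -(p1 n) mulr_suml; apply: eq_bigr => o _.
congr (_ * _); apply: (Er_depends fP) => m Pm _; rewrite /upd.
by case: eqVneq => // e; rewrite e (negbTE Pn) in Pm.
Qed.

Lemma Er_cst a k n w : Er k n (fun=> a) w = a.
Proof.
elim: k n w => [|k ih] n w //=; rewrite -[RHS]mul1r -(p1 n) mulr_suml.
by apply: eq_bigr => o _; rewrite ih.
Qed.

End Expectation.

Section RealExpectation.
Variables (R : realType) (s : nat -> nat) (p : nat -> nat -> R).
Hypothesis p0 : forall n o, (o < s n)%N -> 0 <= p n o.
Hypothesis p1 : forall n, \sum_(o < s n) p n o = 1.

Lemma ler_Er f g k n w : (forall w, f w <= g w) -> Er s p k n f w <= Er s p k n g w.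
Proof.
move=> fg; elim: k n w => [|k ih] n w //=; apply: ler_sum => o _.
by rewrite ler_wpM2l ?p0.
Qed.

Lemma Er_norm_le1 f k n w : (forall w, `|f w| <= 1) -> `|Er s p k n f w| <= 1.
Proof.
move=> f1; rewrite ler_norml -{1}(Er_cst p1 (-1) k n w) -{2}(Er_cst p1 1 k n w).
by apply/andP; split; apply: ler_Er => w'; have := f1 w'; rewrite ler_norml => /andP[].
Qed.

Lemma Re_Er (f : (nat -> nat) -> R[i]) k n w :
  complex.Re (Er s (fun n o => (p n o)%:C%C) k n f w) =
  Er s p k n (fun w => complex.Re (f w)) w.
Proof.
elim: k n w => [|k ih] n w //=; rewrite Re_sum; apply: eq_bigr => o _.
by rewrite Re_real_mul ih.
Qed.

Lemma Im_Er (f : (nat -> nat) -> R[i]) k n w :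
  complex.Im (Er s (fun n o => (p n o)%:C%C) k n f w) =
  Er s p k n (fun w => complex.Im (f w)) w.
Proof.
elim: k n w => [|k ih] n w //=; rewrite Im_sum; apply: eq_bigr => o _.
by rewrite Im_real_mul ih.
Qed.

End RealExpectation.

(** The finitely many exceptional points carry a bounded total, negligible because the cardinality
    of [F N] tends to infinity. *)
Lemma ravg_c0 (R : realType) (G : groupType) (F : nat -> {fset G}) (u : G -> R) :
  folner R F -> infinite_set [set: G] ->
  (exists C : R, forall g, `|u g| <= C) ->
  (forall e : R, 0 < e -> exists E : {fset G}, forall g, g \notin E -> `|u g| <= e) ->
  ravg (F N) u @[N --> \oo] --> (0 : R).
Proof.
move=> FF Gi [C uC] u0; apply/cvgrPdist_le => e e0.
have e20 : 0 < e / 2 by rewrite divr_gt0.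
have [E Ee] := u0 _ e20.
have C0 : 0 <= C by apply: le_trans (uC 1%g).
have [m mC] : exists m : nat, C * #|` E|%:R * 2 / e <= m%:R.
  by eexists; apply/ltW/archi_boundP; rewrite !mulr_ge0 ?invr_ge0// ltW.
have := folner_card FF Gi m; apply: filterS => N mN.
have FN0 : (0 : R) < #|` F N|%:R by rewrite ltr0n (folner_card_gt0 FF).
rewrite sub0r normrN (le_trans (ler_norm_ravg _ _))// /ravg ler_pdivrMl//.
apply: (@le_trans _ _ (\sum_(g <- F N) (C * (g \in E)%:R + e / 2))).
  apply: ler_sum => g _; have [gE|gE] := boolP (g \in E).
    by rewrite mulr1 (le_trans (uC g))// lerDl ltW.
  by rewrite mulr0 add0r Ee.
rewrite big_split/= -mulr_sumr -natr_sum -card_fset_filter.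
rewrite big_const_seq count_predT iter_addr_0 -[_ *+ size _]mulr_natr.
have h1 : C * #|` [fset g in F N | g \in E]%fset|%:R <= C * #|` E|%:R.
  rewrite ler_wpM2l// ler_nat; apply: fsubset_leq_card; apply/fsubsetP => g.
  by rewrite !inE => /andP[].
have h2 : C * #|` E|%:R * 2 / e <= #|` F N|%:R by apply: le_trans mC _; rewrite ler_nat.
rewrite ler_pdivrMr// in h2; lra.
Qed.

(** * Derandomization *)

(** At a site of level [j] at most [j.+2] tests are active, each changing by at most twice the size
    of [B j.+1]. The factor [j.+1 ^ 2] turns the resulting bound on the squared deviation into a
    relative deviation of at most [1 / j.+1]. *)
Definition cell_size (G : groupType) (B : nat -> {fset G}) (j : nat) : nat :=
  (j.+1 ^ 2 * (j.+2 * (2 * #|` B j.+1|) ^ 2))%N.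

Lemma cvgn0D (R : realType) (u v : nat -> R) : u N @[N --> \oo] --> (0 : R) ->
  v N @[N --> \oo] --> (0 : R) -> (u N + v N) @[N --> \oo] --> (0 : R).
Proof. by move=> u0 v0; have := cvgD u0 v0; rewrite addr0; exact. Qed.

Lemma cvgn0Z (R : realType) (c : R) (u : nat -> R) : u N @[N --> \oo] --> (0 : R) ->
  (c * u N) @[N --> \oo] --> (0 : R).
Proof.
move=> u0; have := cvgM (cvg_cst c : c @[_ --> \oo] --> c) u0.
by rewrite mulr0; exact.
Qed.

Section Derandomization.
Variables (R : realType) (G : groupType) (F : nat -> {fset G}).
Hypothesis F_folner : folner R F.
Hypothesis G_infinite : infinite_set [set: G].
Variables (site : nat -> G) (idx : G -> nat).
Hypotheses (siteK : cancel site idx) (idxK : cancel idx site).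
Variables (B : nat -> {fset G}) (lev : G -> nat) (cell : G -> G).
Hypothesis B1 : forall j, 1%g \in B j.
Hypothesis Bm : forall j, (B j `<=` B j.+1)%fset.
Hypothesis lev_fin : forall J, exists E : {fset G}, forall g, (lev g <= J)%N -> g \in E.
Hypothesis lev_slow : forall g b, b \in B (lev g) ->
  (lev (b * g)%g <= (lev g).+1)%N /\ (lev g <= (lev (b * g)%g).+1)%N.
Hypothesis cell_big : forall c, exists2 P : {fset G},
  (forall g, (g \in P) = (cell g == cell c)) & (cell_size B (lev c) <= #|` P|)%N.
Hypothesis bad_small : (ravg (F N) (fun g => if `[< forall b c b' g', b \in B (lev g) ->
            cell c = cell (b * g)%g -> b' \in B (lev g') -> c = (b' * g')%g ->
            g' \in F N >] then 0 else #|` B (lev g)|%:R)) @[N --> \oo] --> (0 : R).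
Variables (s : nat -> nat) (p : nat -> nat -> R).
Hypothesis p0 : forall n o, (o < s n)%N -> 0 <= p n o.
Hypothesis p1 : forall n, \sum_(o < s n) p n o = 1.
Variables (w : nat -> G -> (nat -> nat) -> R) (m : G -> nat).

Let sup g : pred nat := fun n => has (fun b => n == idx (b * g)%g) (B (lev g)).

Hypothesis w_le1 : forall i g om, `|w i g om| <= 1.
Hypothesis w_local : forall i g, (i <= lev g)%N -> depends_on (sup g) (w i g).
Hypothesis m_bound : forall g b, b \in B (lev g) -> (idx (b * g)%g < m g)%N.

(** Conditional expectation of the test [w i g] given the bits before [n]: a martingale in [n]. *)
Let e n i g om := Er s p (m g - n) n (w i g) om.
(** The points that see [c] have level at most [(lev c).+1], so the candidates [b^-1 * c] with [b]
    in [B (lev c).+1] miss none of them. *)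
Let D c : {fset G} :=
  [fset g in [fset (b^-1 * c)%g | b in B (lev c).+1]%fset | sup g (idx c)]%fset.

Let supP g n : reflect (exists2 b, b \in B (lev g) & site n = (b * g)%g) (sup g n).
Proof.
apply: (iffP hasP) => -[b bB]; first by move/eqP ->; exists b; rewrite ?idxK.
by move=> bg; exists b; rewrite // -bg siteK.
Qed.

Let sup_lt g n : sup g n -> (n < m g)%N.
Proof. by move/hasP => [b bB /eqP ->]; exact: m_bound. Qed.

Let mem_D c g : (g \in D c) = sup g (idx c).
Proof.
rewrite !inE /=; apply: andb_idl => /supP[b bB]; rewrite idxK => ce.
apply/imfsetP; exists b; rewrite /= ?ce ?mulKg//.
by have [_ gl] := lev_slow bB; apply: (fsubsetP (fset_homo_leq Bm gl)).
Qed.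

Let card_D c : (#|` D c| <= #|` B (lev c).+1|)%N.
Proof.
apply: (@leq_trans #|` [fset (b^-1 * c)%g | b in B (lev c).+1]%fset|); last exact: leq_imfset_card.
apply: fsubset_leq_card.
by apply/fsubsetP => g; rewrite !inE /= => /andP[].
Qed.

Let lev_D c g : g \in D c -> (lev g <= (lev c).+1)%N.
Proof.
by rewrite mem_D => /supP[b bB]; rewrite idxK => ->; have [] := lev_slow bB.
Qed.

Let e_stop n i g om : (m g <= n)%N -> e n i g om = w i g om.
Proof. by rewrite /e -subn_eq0 => /eqP ->. Qed.

Let e_step n i g om : (n < m g)%N ->
  e n i g om = \sum_(o < s n) p n o * e n.+1 i g (upd om n o).
Proof. by move=> nm; rewrite /e (_ : m g - n = (m g - n.+1).+1)%N // subnSK. Qed.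

Let e_local n i g om om' : (i <= lev g)%N ->
  (forall k, (k < n)%N -> om k = om' k) -> e n i g om = e n i g om'.
Proof.
move=> ig h; rewrite /e; apply: (@Er_depends _ s p _ _ _ _ _ _ (w_local ig)) => k /sup_lt km.
by rewrite negb_and -ltnNge => /orP[/h//|]; lia.
Qed.

Let e_skip n i g om : (i <= lev g)%N -> ~~ sup g n -> e n.+1 i g om = e n i g om.
Proof.
move=> ig gn; have [nm|mn] := ltnP n (m g); last by rewrite !e_stop// leqW.
rewrite /e (_ : m g - n = (m g - n.+1).+1)%N; last by rewrite subnSK.
by rewrite (Er_skip p1 _ _ (w_local ig)).
Qed.

Let e_le1 n i g om : `|e n i g om| <= 1.
Proof. exact: Er_norm_le1. Qed.

(** Martingale increment caused by revealing bit [n], summed over all points that see this site; [T]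
    accumulates it within one cell. *)
Let psi n i om : R := \sum_(g <- D (site n) | (i <= lev g)%N) (e n.+1 i g om - e n i g om).
Let T n i c om : R := \sum_(0 <= n' < n | cell (site n') == cell c) psi n' i om.

Let psi_local n i om om' : (forall k, (k <= n)%N -> om k = om' k) ->
  psi n i om = psi n i om'.
Proof.
move=> h; apply: eq_bigr => g ig; congr (_ - _); apply: e_local => // k kn; apply: h => //.
exact: ltnW.
Qed.

Let T_local n i c om om' : (forall k, (k < n)%N -> om k = om' k) ->
  T n i c om = T n i c om'.
Proof.
move=> h; rewrite /T big_nat_cond [RHS]big_nat_cond; apply: eq_bigr => k /andP[/andP[_ kn] _].
by apply: psi_local => j jk; apply: h; exact: leq_ltn_trans kn.
Qed.

Let psi_big n i om : ((lev (site n)).+2 <= i)%N -> psi n i om = 0.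
Proof.
move=> h; rewrite /psi big_seq_cond big_pred0// => g; apply/negP => /andP[/lev_D gl ig].
by lia.
Qed.

Let psi_le n i om : `|psi n i om| <= (2 * #|` B (lev (site n)).+1|)%:R.
Proof.
apply: (@le_trans _ _ (2 * #|` D (site n)|)%:R); last by rewrite ler_nat leq_mul2l card_D.
rewrite (le_trans (ler_norm_sum _ _ _))// mulnC natrM card_fset_sum1 natr_sum mulr_suml.
rewrite big_mkcond /=; apply: ler_sum => g _; case: ifP => _; last by rewrite mul1r.
by rewrite (le_trans (ler_normB _ _))// mul1r -[2]/(1 + 1) lerD ?e_le1.
Qed.

Let psi_mean n i om : \sum_(o < s n) p n o * psi n i (upd om n o) = 0.
Proof.
under eq_bigr do rewrite mulr_sumr.
rewrite exchange_big /= big_seq_cond big1// => g /andP[]; rewrite mem_D siteK => gn ig.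
under eq_bigr do rewrite mulrBr.
rewrite big_split/= sumrN -e_step; last exact: sup_lt.
rewrite (eq_bigr (fun o : 'I_(s n) => p n o * e n i g om)) => [|o _].
  by rewrite -mulr_suml p1 mul1r subrr.
by congr (_ * _); apply: e_local => // k kn; rewrite /upd ltn_eqF.
Qed.

(* The chosen value does not increase the expected sum of squares of the
   running deviations of the cell, to first order. *)
Let step n om : exists o, (o < s n)%N /\
  \sum_(i < (lev (site n)).+2) T n i (site n) om * psi n i (upd om n o) <= 0.
Proof.
apply: contrapT => /forallNP h.
have pos (o : 'I_(s n)) : 0 < \sum_(i < (lev (site n)).+2) T n i (site n) om * psi n i (upd om n o).
  by rewrite ltNge; apply/negP => le0; apply: (h o).
have : \sum_(o < s n) p n o * (\sum_(i < (lev (site n)).+2)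
    T n i (site n) om * psi n i (upd om n o)) = 0.
  under eq_bigr do rewrite mulr_sumr.
  rewrite exchange_big big1 //= => i _.
  under eq_bigr do rewrite mulrCA.
  by rewrite -mulr_sumr psi_mean mulr0.
move/eqP; rewrite psumr_eq0 => [/allP z|o _]; last by rewrite mulr_ge0 ?p0// ltW.
have : \sum_(o < s n) p n o = 0.
  rewrite big1// => o _; have /implyP/(_ isT) := z o (mem_index_enum o).
  by rewrite mulf_eq0 (gt_eqF (pos o)) orbF => /eqP.
by rewrite p1 => /eqP; rewrite oner_eq0.
Qed.

Let greedy : exists om, forall n, (om n < s n)%N /\
  \sum_(i < (lev (site n)).+2) T n i (site n) om * psi n i om <= 0.
Proof.
have /choice[pick pickP] : forall q : nat * (nat -> nat), exists o, (o < s q.1)%N /\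
  \sum_(i < (lev (site q.1)).+2) T q.1 i (site q.1) q.2 * psi q.1 i (upd q.2 q.1 o) <= 0.
  by move=> [n om]; exact: step.
(* Bits not yet chosen are set to 0; by [T_local] and [psi_local] they do not affect the inequality
   at the current site. *)
pose hist := fix hist n := if n is n'.+1 then upd (hist n') n' (pick (n', hist n')) else fun=> 0%N.
have histP n k : (k < n)%N -> hist n k = hist k.+1 k.
  elim: n => // n ih; rewrite ltnS leq_eqVlt => /predU1P[->//|kn].
  by rewrite /= {1}/upd ltn_eqF// ih.
pose om n := hist n.+1 n.
have om_pick n : om n = pick (n, hist n) by rewrite /om /= /upd eqxx.
exists om => n; rewrite om_pick.
have [/= p_lt p_le] := pickP (n, hist n).
split=> //; apply: le_trans p_le; rewrite le_eqVlt; apply/orP; left; apply/eqP.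
apply: eq_bigr => i _; congr (_ * _).
  by apply: T_local => k kn; rewrite /om (histP n).
by apply: psi_local => k kn; rewrite -[RHS]/(hist n.+1 k) /om (histP n.+1).
Qed.

Let reindex_sum (P : {fset G}) N (h : nat -> R) : (forall c, c \in P -> (idx c < N)%N) ->
  \sum_(0 <= n < N | site n \in P) h n = \sum_(c <- P) h (idx c).
Proof.
move=> PN; rewrite -big_filter -(big_map idx predT); apply: perm_big; apply: uniq_perm.
- by rewrite filter_uniq// iota_uniq.
- by rewrite map_inj_uniq ?fset_uniq//; exact: can_inj idxK.
move=> n; rewrite mem_filter mem_index_iota /=; apply/andP/mapP => [[nP _]|[c cP ->]].
  by exists (site n).
by rewrite idxK cP PN.
Qed.

(** When the square is expanded site by site, the cross terms summed over the tests are at most zero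
    by the greedy choice, so only the squared increments accumulate. *)
Let cell_bound om c i (P : {fset G}) :
  (forall n, \sum_(i < (lev (site n)).+2) T n i (site n) om * psi n i om <= 0) ->
  (forall g, (g \in P) = (cell g == cell c)) ->
  (\sum_(c <- P) psi (idx c) i om) ^+ 2 <=
    (\sum_(c <- P) ((lev c).+2 * (2 * #|` B (lev c).+1|) ^ 2)%N)%:R.
Proof.
move=> omP PP.
pose N := (\max_(c <- P) (idx c).+1)%N.
have PN c' : c' \in P -> (idx c' < N)%N by move=> c'P; rewrite /N; exact: leq_bigmax_seq.
pose h n := ((lev (site n)).+2 * (2 * #|` B (lev (site n)).+1|) ^ 2)%N.
(* [L] exceeds [i] and the index of every test active at these sites, so summing over [j < L] loses
   nothing. *)
pose L := (i.+1 + \max_(0 <= n < N) (lev (site n)).+2)%N.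
have LN n : (n < N)%N -> ((lev (site n)).+2 <= L)%N.
  move=> nN; rewrite /L; apply: leq_trans (leq_addl _ _).
  by apply: (@leq_bigmax_seq _ _ _ (fun n => (lev (site n)).+2)); rewrite ?mem_index_iota.
have key k : (k <= N)%N -> \sum_(i < L) (T k i c om) ^+ 2 <=
    \sum_(0 <= n < k | site n \in P) (h n)%:R.
  elim: k => [|k ih] kN.
    by rewrite big_geq// big1// => j _; rewrite /T big_geq// expr0n.
  rewrite [leRHS]big_mkcond big_nat_recr//= -big_mkcond /= PP.
  have TS j : T k.+1 j c om = T k j c om + (if cell (site k) == cell c then psi k j om else 0).
    by rewrite /T big_mkcond big_nat_recr//= -big_mkcond.
  under eq_bigr do rewrite TS.
  case: eqP => [ck|_]; last first.
    under eq_bigr do rewrite addr0.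
    by rewrite addr0 ih// ltnW.
  under eq_bigr do rewrite sqrrD.
  rewrite 2!big_split/= -addrA lerD ?ih ?(ltnW kN)//.
  have Tc j : T k j c om = T k j (site k) om by rewrite /T; apply: eq_bigl => n; rewrite ck.
  have cut (f : nat -> R) : (forall j, ((lev (site k)).+2 <= j)%N -> f j = 0) ->
      \sum_(j < L) f j = \sum_(j < (lev (site k)).+2) f j.
    move=> f0; rewrite -!(big_mkord xpredT f) (big_cat_nat (n := (lev (site k)).+2)) ?LN//=.
    by rewrite [X in _ + X]big_nat [X in _ + X]big1 ?addr0// => j /andP[/f0].
  rewrite (_ : h k = (h k + 0)%N) ?addn0// -[leRHS]add0r lerD//.
    rewrite sumrMnl -mulr_natr -[leRHS](mul0r 2) ler_wpM2r// (cut (fun j => T k j c om * psi k j om)).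
      by apply: le_trans (omP k); apply: ler_sum => j _; rewrite Tc.
    by move=> j /psi_big ->; rewrite mulr0.
  rewrite (cut (fun j => psi k j om ^+ 2)); last by move=> j /psi_big ->; rewrite expr0n.
  have -> : (h k)%:R = \sum_(j < (lev (site k)).+2) ((2 * #|` B (lev (site k)).+1|)%:R ^+ 2 : R).
    by rewrite sumr_const card_ord /h natrM natrX mulr_natl.
  apply: ler_sum => j _.
  by rewrite -[psi _ _ _ ^+ 2]real_normK ?num_real// lerXn2r ?nnegrE// psi_le.
have := key N (leqnn N); rewrite (reindex_sum (fun n => (h n)%:R))//.
have -> : \sum_(c <- P) psi (idx c) i om = T N i c om.
  by rewrite -(reindex_sum (fun n => psi n i om) PN); apply: eq_bigl => n; rewrite PP.
have -> : \sum_(c <- P) (h (idx c))%:R =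
    (\sum_(c <- P) ((lev c).+2 * (2 * #|` B (lev c).+1|) ^ 2)%N)%:R :> R.
  by rewrite natr_sum; apply: eq_bigr => c' _; rewrite /h idxK.
have iL : (i < L)%N by rewrite /L ltn_addr.
apply: le_trans; rewrite (bigD1 (Ordinal iL))//= lerDl sumr_ge0// => j _.
by rewrite sqr_ge0.
Qed.

(** [cell_big] is applied at a point of maximal level in the cell, where its lower bound on the size
    of the cell is strongest. *)
Let cell_small om c i (P : {fset G}) :
  (forall n, \sum_(i < (lev (site n)).+2) T n i (site n) om * psi n i om <= 0) ->
  (forall g, (g \in P) = (cell g == cell c)) ->
  `|\sum_(c <- P) psi (idx c) i om| <= \sum_(c <- P) (lev c).+1%:R^-1.
Proof.
move=> omP PP; pose f j := (j.+2 * (2 * #|` B j.+1|) ^ 2)%N.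
have fm j k : (j <= k)%N -> (f j <= f k)%N.
  move=> jk; rewrite leq_mul// leq_exp2r// leq_mul2l/=.
  by apply: fsubset_leq_card; apply: fset_homo_leq.
have cP : c \in P by rewrite PP.
have [c' c'P c'max] : exists2 c', c' \in P & forall x, x \in P -> (lev x <= lev c')%N.
  pose J := (\max_(x <- P) lev x)%N.
  have Jmax x : x \in P -> (lev x <= J)%N by move=> xP; rewrite /J; exact: leq_bigmax_seq.
  have [c' c'P c'J] : exists2 c', c' \in P & lev c' = J.
    apply: contrapT => /forall2NP h.
    have ltJ x : x \in P -> (lev x < J)%N.
      by move=> xP; rewrite ltn_neqAle Jmax// andbT; apply/eqP; have [/(_ xP)|] := h x.
    have : (J <= J.-1)%N.
      by apply/bigmax_leqP_seq => x xP _; have := ltJ x xP; case: (J).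
    by have := ltJ c cP; lia.
  by exists c' => // x xP; rewrite c'J Jmax.
have [P' PP' P'big] := cell_big c'.
have eP : P' = P.
  by apply/fsetP => x; rewrite PP PP'; move: c'P; rewrite PP => /eqP ->.
rewrite eP /cell_size -/(f (lev c')) in P'big.
have h1 := cell_bound i omP PP.
have h2 : (\sum_(c <- P) f (lev c) <= #|` P| * f (lev c'))%N.
  rewrite card_fset_sum1 big_distrl /= big_seq [X in (_ <= X)%N]big_seq.
  by apply: leq_sum => x xP; rewrite mul1n fm// c'max.
apply: (@le_trans _ _ (#|` P|%:R / (lev c').+1%:R)).
  rewrite -[leRHS]ger0_norm ?divr_ge0// -ler_sqr ?nnegrE// !real_normK ?num_real//.
  apply: le_trans h1 _; rewrite expr_div_n ler_pdivlMr ?exprn_gt0 ?ltr0n//.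
  by rewrite -!natrX -natrM ler_nat; move: h2 P'big; rewrite /f; nia.
rewrite card_fset_sum1 natr_sum mulr_suml big_seq [leRHS]big_seq; apply: ler_sum => x xP.
by rewrite mul1r lef_pV2 ?posrE ?ltr0n// ler_nat ltnS c'max.
Qed.

(** Every point that sees the cell of [c] lies in [A], so the increments of the whole cell occur in
    the sum over [A]. *)
Let goodc (A : {fset G}) c := `[< forall c' b' g', cell c' = cell c ->
  b' \in B (lev g') -> c' = (b' * g')%g -> g' \in A >].

Let good_mem A c : goodc A c -> c \in A.
Proof. by move/asboolP/(_ c 1%g c erefl (B1 _)); apply; rewrite mul1g. Qed.

Let good_sum om i (A : {fset G}) N :
  (forall n, \sum_(i < (lev (site n)).+2) T n i (site n) om * psi n i om <= 0) ->
  (forall c, c \in A -> (idx c < N)%N) ->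
  `|\sum_(0 <= n < N | goodc A (site n)) psi n i om| <= \sum_(c <- A) (lev c).+1%:R^-1.
Proof.
move=> omP AN; pose A' := [fset c in A | goodc A c]%fset.
have A'E c : (c \in A') = goodc A c.
  by rewrite !inE; apply: andb_idl; exact: good_mem.
rewrite (eq_bigl (fun n => site n \in A')); last by move=> n; rewrite A'E.
rewrite (reindex_sum (fun n => psi n i om)); last first.
  by move=> c; rewrite !inE => /andP[/AN].
apply: (@le_trans _ _ (\sum_(c <- A') (lev c).+1%:R^-1)); last first.
  rewrite big_fset/= big_mkcond /=; apply: ler_sum => c _.
  by case: ifP; rewrite // invr_ge0.
rewrite (partition_big_imfset _ cell)/= [leRHS](partition_big_imfset _ cell)/=.
rewrite (le_trans (ler_norm_sum _ _ _))// big_seq [leRHS]big_seq.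
apply: ler_sum => k /imfsetP[c /= cA' ->].
rewrite [X in `|X|]big_fset_condE [leRHS]big_fset_condE; apply: cell_small => // g.
rewrite !inE /=.
apply: andb_idl => /eqP gc; have : goodc A g by move: cA'; rewrite A'E /goodc gc.
by move=> gg; rewrite gg good_mem.
Qed.

(** Increments vanish at sites outside the window of [g], so no more of them survive than the window
    has elements, each of size at most 2. *)
Let bad_sum om i (A : {fset G}) N g : (i <= lev g)%N ->
  `|\sum_(0 <= n < N | ~~ goodc A (site n)) (e n.+1 i g om - e n i g om)| <=
  2 * (if `[< forall b c b' g', b \in B (lev g) -> cell c = cell (b * g)%g ->
     b' \in B (lev g') -> c = (b' * g')%g -> g' \in A >] then 0 else #|` B (lev g)|%:R).
Proof.
move=> ig; case: asboolP => [good|_].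
  rewrite mulr0 big1 ?normr0// => n ngood.
  rewrite e_skip// ?subrr//; apply: contra ngood => /supP[b bB ->].
  by apply/asboolP => c' b' g' cc b'B ce; exact: (good b c' b' g').
rewrite (le_trans (ler_norm_sum _ _ _))//.
apply: (@le_trans _ _ (\sum_(0 <= n < N) \sum_(b <- B (lev g)) 2 * (n == idx (b * g)%g)%:R)).
  rewrite big_mkcond; apply: ler_sum => n _.
  have S0 : 0 <= \sum_(b <- B (lev g)) 2 * (n == idx (b * g)%g)%:R :> R.
    by apply: sumr_ge0 => b _; rewrite mulr_ge0.
  case: ifP => // _; have [/hasP[b bB nb]|gn] := boolP (sup g n); last first.
    by rewrite e_skip// subrr normr0.
  rewrite (big_fsetD1 b)//= nb mulr1 (@le_trans _ _ 2)//.
    by rewrite (le_trans (ler_normB _ _))// -[2]/(1 + 1) lerD.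
  by rewrite lerDl sumr_ge0// => x _; rewrite mulr_ge0.
rewrite exchange_big /= card_fset_sum1 natr_sum mulr_sumr; apply: ler_sum => b _.
rewrite -mulr_sumr ler_wpM2l// -natr_sum ler_nat big_mkord.
rewrite -big_mkcond /= sum1_card; set q := idx _.
have [qN|Nq] := ltnP q N.
  rewrite -(card1 (Ordinal qN)); apply/eq_leq/eq_card => n.
  by rewrite !inE -val_eqE.
rewrite eq_card0// => n; rewrite !inE; apply/negbTE; apply: contraL Nq => /eqP <-.
by rewrite -ltnNge.
Qed.

Lemma derandomize : exists om : nat -> nat, (forall n, (om n < s n)%N) /\
  forall i, (ravg (F N) (fun g => w i g om - Er s p (m g) 0 (w i g) (fun=> 0%N)))
    @[N --> \oo] --> (0 : R).
Proof.
have [om omP] := greedy; exists om; split=> [n|i]; first by case: (omP n).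
have {}omP n := (omP n).2.
(* Three errors: [u1] bounds the deviations of complete cells, [u2] pays for the finitely many
   points where test [i] is not yet local, and [bad_small] controls the cells crossing the boundary
   of [F N]. *)
pose u1 g : R := (lev g).+1%:R^-1.
pose u2 g : R := 2 * (lev g < i)%N%:R.
have lim1 : ravg (F N) u1 @[N --> \oo] --> (0 : R).
  apply: ravg_c0 => //.
    by exists 1 => g; rewrite ger0_norm ?invr_ge0// invf_le1 ?ler1n ?ltr0n.
  move=> e0 e0_gt0.
  have /filter_ex[n nP] := near_infty_natSinv_lt (PosNum e0_gt0).
  have [E EP] := lev_fin n; exists E => g gE.
  rewrite ger0_norm ?invr_ge0// (le_trans _ (ltW nP))// lef_pV2 ?posrE ?ltr0n//.
  by rewrite ler_nat ltnS ltnW// ltnNge; apply: contra gE; exact: EP.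
have lim2 : ravg (F N) u2 @[N --> \oo] --> (0 : R).
  apply: ravg_c0 => //.
    exists 2 => g; rewrite ger0_norm ?mulr_ge0// -[leRHS]mulr1 ler_wpM2l//.
    by case: (_ < _)%N.
  move=> e0 e0_gt0; have [E EP] := lev_fin i; exists E => g gE.
  rewrite /u2 (_ : (lev g < i)%N = false) ?mulr0 ?normr0 ?ltW//.
  by apply: contraNF gE => /ltnW; exact: EP.
have lim3 := cvgn0D (cvgn0D lim1 lim2) (cvgn0Z 2 bad_small).
apply/cvgrPdist_le => ep ep0; move/cvgrPdist_le: lim3 => /(_ ep ep0).
apply: filterS => N; rewrite !sub0r !normrN => /(le_trans (ler_norm _)); apply: le_trans.
rewrite /= -ravgZ -!ravgD; set A := F N.
have FN0 : 0 <= #|` A|%:R^-1 :> R by rewrite invr_ge0.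
rewrite {1}/ravg normrM ger0_norm// /ravg ler_wpM2l//.
rewrite [leRHS]big_split [X in _ <= X + _]big_split/=.
rewrite (bigID (fun g => (i <= lev g)%N))/= (le_trans (ler_normD _ _))//.
rewrite [leRHS]addrAC; apply: lerD; last first.
  rewrite (le_trans (ler_norm_sum _ _ _))// big_mkcond /=; apply: ler_sum => g _.
  rewrite /u2 -ltnNge; case: ifP => _; last by rewrite mulr0.
  rewrite mulr1 (le_trans (ler_normB _ _))// -[2]/(1 + 1) lerD//.
  exact: Er_norm_le1.
pose L := (\max_(g <- A) maxn (m g) (idx g).+1)%N.
have AL g : g \in A -> (maxn (m g) (idx g).+1 <= L)%N.
  by move=> gA; rewrite /L; apply: (@leq_bigmax_seq _ _ _ (fun g => maxn (m g) (idx g).+1)).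
have tel g : g \in A -> (i <= lev g)%N -> w i g om - Er s p (m g) 0 (w i g) (fun=> 0%N) =
    \sum_(0 <= n < L) (e n.+1 i g om - e n i g om).
  move=> gA ig; rewrite telescope_sumr// e_stop; last first.
    by apply: leq_trans (AL g gA); rewrite leq_maxl.
  by congr (_ - _); rewrite (@e_local 0 i g om (fun=> 0%N))// /e subn0.
rewrite (_ : \sum_(g <- A | (i <= lev g)%N) _ =
  \sum_(g <- A | (i <= lev g)%N) \sum_(0 <= n < L) (e n.+1 i g om - e n i g om)); last first.
  by rewrite big_seq_cond [RHS]big_seq_cond; apply: eq_bigr => g /andP[/tel].
rewrite (eq_bigr (fun g => \sum_(0 <= n < L | goodc A (site n)) (e n.+1 i g om - e n i g om) +
  \sum_(0 <= n < L | ~~ goodc A (site n)) (e n.+1 i g om - e n i g om))); last first.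
  by move=> g _; rewrite (bigID (fun n => goodc A (site n))).
rewrite big_split/= (le_trans (ler_normD _ _))//; apply: lerD.
  rewrite exchange_big /= (eq_bigr (fun n => psi n i om)).
    by apply: good_sum => // c cA; apply: leq_trans (AL c cA); rewrite leq_maxr.
  move=> n ng; rewrite /psi big_mkcond [RHS]big_mkcond /=; apply/esym/big_fset_incl.
    apply/fsubsetP => g; rewrite mem_D siteK => /supP[b bB gb].
    by move/asboolP: ng; apply; [reflexivity|exact: bB|exact: gb].
  move=> g _; rewrite mem_D siteK => gn; case: ifP => // ig.
  by rewrite e_skip// subrr.
rewrite (le_trans (ler_norm_sum _ _ _))// big_mkcond /=; apply: ler_sum => g _.
case: ifPn => [ig|_]; first exact: bad_sum.
by rewrite mulr_ge0//; case: asboolP.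
Qed.

End Derandomization.

(** The laws and tests are quantified after the level function, so they may be built from it; this
    is how the scale is made to vary over the group. *)
Lemma derandomization (R : realType) (G : groupType) (F : nat -> {fset G})
    (site : nat -> G) (idx : G -> nat) (B : nat -> {fset G}) :
  folner R F -> countable [set: G] -> infinite_set [set: G] ->
  cancel site idx -> cancel idx site ->
  (forall j, 1%g \in B j) -> (forall j, (B j `<=` B j.+1)%fset) ->
  exists lev : G -> nat,
  [/\ forall J, exists E : {fset G}, forall g, (lev g <= J)%N -> g \in E,
      forall g b, b \in B (lev g) ->
        (lev (b * g)%g <= (lev g).+1)%N /\ (lev g <= (lev (b * g)%g).+1)%N,
      forall j, exists2 N, (j <= N)%N &
        (j.+1 * #|` [fset g in F N | lev g != j.+1]%fset| <= #|` F N|)%N &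
      forall (s : nat -> nat) (p : nat -> nat -> R)
        (w : nat -> G -> (nat -> nat) -> R) (m : G -> nat),
        (forall n o, (o < s n)%N -> 0 <= p n o) ->
        (forall n, \sum_(o < s n) p n o = 1) ->
        (forall i g om, `|w i g om| <= 1) ->
        (forall i g, (i <= lev g)%N ->
           depends_on (fun n => has (fun b => n == idx (b * g)%g) (B (lev g))) (w i g)) ->
        (forall g b, b \in B (lev g) -> (idx (b * g)%g < m g)%N) ->
        exists om : nat -> nat, (forall n, (om n < s n)%N) /\
        forall i, (ravg (F N) (fun g => w i g om - Er s p (m g) 0 (w i g) (fun=> 0%N)))
          @[N --> \oo] --> (0 : R)].
Proof.
move=> FF Gc Gi siteK idxK B1 Bm.
have [lev [cell [lfin lslow lconc cbig bad]]] := scale_cells FF Gc Gi (cell_size B) Bm.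
exists lev; split => // s p w m p0 p1 w1 wl mb.
exact: (derandomize FF Gi siteK idxK B1 Bm lfin lslow cbig bad p0 p1 w1 wl mb).
Qed.

(** * Weyl's criterion on the circle *)

Lemma integrable_bounded d (T : measurableType d) (R : realType) (P : probability T R)
    (f : T -> R) (C : R) : measurable_fun setT f -> (forall x, `|f x| <= C) ->
  P.-integrable setT (EFin \o f).
Proof.
move=> mf fC; apply: measurable_bounded_integrable => //.
  by apply: le_lt_trans (probability_le1 P measurableT) _; rewrite ltry.
by exists C; split; rewrite ?num_real// => M CM x _; rewrite /= (le_trans (fC x))// ltW.
Qed.

Lemma integral_cst_prob d (T : measurableType d) (R : realType) (P : probability T R) (a : R) :
  (\int[P]_x a%:E = a%:E)%E.
Proof.
rewrite (integral_cst P measurableT); transitivity (a%:E * 1)%E; last by rewrite mule1.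
by congr (_ * _)%E; exact: probability_setT.
Qed.

Lemma normC_eq1 (R : realType) (z : R[i]) :
  `|z| = 1 -> complex.Re z ^+ 2 + complex.Im z ^+ 2 = 1.
Proof. by move=> z1; apply/complexI; rewrite add_Re2_Im2 z1 expr1n. Qed.

Section Circle.
Variable R : realType.
Implicit Types (x y : R) (s t : circle R).

Definition cis x : R[i] := (cos (x * (pi *+ 2)) +i* sin (x * (pi *+ 2)))%C.

Lemma cis0 : cis 0 = 1.
Proof. by rewrite /cis mul0r cos0 sin0. Qed.

Lemma cisD x y : cis (x + y) = cis x * cis y.
Proof. by rewrite /cis mulrDl cosD sinD /=; congr Complex; rewrite addrC. Qed.

Lemma cisN x : cis (- x) = (cis x)^*.
Proof. by rewrite /cis mulNr cosN sinN. Qed.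

Lemma cisMn n x : cis (n%:R * x) = cis x ^+ n.
Proof.
elim: n => [|n ih]; first by rewrite mul0r cis0 expr0.
by rewrite -natr1 mulrDl mul1r cisD ih exprSr.
Qed.

Lemma norm_cis x : `|cis x| = 1.
Proof. by rewrite normc_def /= cos2Dsin2 sqrtr1. Qed.

Lemma cis_conj x : cis x * (cis x)^* = 1.
Proof. by rewrite -cisN -cisD subrr cis0. Qed.

Lemma cis1 : cis 1 = 1.
Proof. by rewrite /cis mul1r cos2pi sin2pi. Qed.

Lemma cis_int x : x \is a Num.int -> cis x = 1.
Proof.
have nat1 n : cis n%:R = 1 by rewrite -[n%:R]mulr1 cisMn cis1 expr1n.
move=> /intrP[[n|n] ->]; first exact: nat1.
by rewrite NegzE mulrNz cisN -pmulrn nat1 rmorph1.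
Qed.

Lemma cis_eq1 x : cis x = 1 -> x \is a Num.int.
Proof.
move=> x1; pose y := x - (Num.floor x)%:~R.
have y1 : cis y = 1 by rewrite /y cisD x1 mul1r cisN cis_int ?rmorph1 ?intr_int.
have y_ge0 : 0 <= y by rewrite subr_ge0 floor_le_tmp.
have y_lt1 : y < 1 by rewrite ltrBlDl -[1]/(1%:~R) -intrD floorD1_gt.
have [y0|yn0] := eqVneq y 0.
  by move/eqP: y0; rewrite subr_eq0 => /eqP ->; exact: intr_int.
have y_gt0 : 0 < y by rewrite lt_neqAle eq_sym yn0.
have s0 : 0 < sin (y * pi) by rewrite sin_gt0_pi// mulr_gt0 ?pi_gt0//= -[ltRHS]mul1r ltr_pM2r ?pi_gt0.
have : cos (y * (pi *+ 2)) = 1 by have /(congr1 (@complex.Re R)) := y1.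
rewrite mulrnAr cos_mulr2n cos2sin2 => h; exfalso.
have : 0 < sin (y * pi) ^+ 2 by rewrite exprn_gt0.
by rewrite mulr2n in h; lra.
Qed.

Lemma cis_eq x y : (cis x == cis y) = (x - y \is a Num.int).
Proof.
apply/eqP/idP => [e|/cis_int].
  by apply: cis_eq1; rewrite cisD cisN e cis_conj.
rewrite cisD cisN => /(congr1 (fun z => z * cis y)).
by rewrite -mulrA mul1r [_^* * _]mulrC cis_conj mulr1.
Qed.

Definition chi t : R[i] := cis (repr t).

Lemma chi_pi x : chi (circle_pi x) = cis x.
Proof.
apply/eqP; rewrite /chi cis_eq -circle_pi_eq; apply/eqP.
by rewrite {1}/circle_pi reprK.
Qed.

Lemma chiB s t : chi (s - t) = chi s * (chi t)^*.
Proof.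
have [x <-] := circle_pi_surj s; have [y <-] := circle_pi_surj t.
by rewrite -circle_piB !chi_pi cisD cisN.
Qed.

Lemma chiBJ s t : (chi (s - t))^* = chi t * (chi s)^*.
Proof.
have [x <-] := circle_pi_surj s; have [y <-] := circle_pi_surj t.
by rewrite -circle_piB !chi_pi -!cisN opprB cisD.
Qed.

Lemma norm_chi t : `|chi t| = 1. Proof. exact: norm_cis. Qed.

Lemma chi_inj : injective chi.
Proof.
move=> s t; have [x <-] := circle_pi_surj s; have [y <-] := circle_pi_surj t.
by rewrite !chi_pi => /eqP; rewrite cis_eq -circle_pi_eq => /eqP.
Qed.

Lemma continuous_circle_pi : continuous (@circle_pi R).
Proof. by apply/continuousP => U oU; exact: oU. Qed.

Lemma continuous_circle (T : topologicalType) (phi : circle R -> T) :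
  continuous (fun x => phi (circle_pi x)) -> continuous phi.
Proof.
by move=> /continuousP cphi; apply/continuousP => U oU; exact: (cphi U oU).
Qed.

Lemma compact_circle : compact [set: circle R].
Proof.
have -> : [set: circle R] = @circle_pi R @` `[(0 : R), 1].
  rewrite eqEsubset; split => // t _; have [x <-] := circle_pi_surj t.
  exists (x - (Num.floor x)%:~R).
    rewrite /= in_itv /= subr_ge0 floor_le_tmp /= lerBlDl -[1]/(1%:~R) -intrD.
    exact/ltW/floorD1_gt.
  by apply/eqP; rewrite circle_pi_eq addrAC subrr sub0r rpredN intr_int.
apply: continuous_compact; last exact: segment_compact.
exact/continuous_subspaceT/continuous_circle_pi.
Qed.

(** A wave of frequency [a - b]; two natural exponents replace a signed one and match the expansion
    of the Fejér kernel. *)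
Definition trig (c : R[i]) (a b : nat) t : R := complex.Re (c * chi t ^+ a * (chi t)^* ^+ b).

Lemma trig_pi c a b x : trig c a b (circle_pi x) =
  complex.Re (c * cis ((a%:R - b%:R) * x)).
Proof.
by rewrite /trig chi_pi -cisN -!cisMn -mulrA -cisD mulrBl mulrN.
Qed.

Lemma continuous_Re_cis c (d : R) : continuous (fun x => complex.Re (c * cis (d * x))).
Proof.
rewrite (_ : (fun x => _) = (fun x => complex.Re c * cos (d * x * (pi *+ 2)) -
    complex.Im c * sin (d * x * (pi *+ 2)))); last by apply/funext => x; case: c.
move=> x; have lin : {for x, continuous (fun x => d * x * (pi *+ 2))}.
  by apply: cvgM; [apply: cvgM; [exact: cvg_cst|exact: cvg_id]|exact: cvg_cst].
apply: cvgB; apply: cvgM; try exact: cvg_cst.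
  exact: (continuous_comp lin (@continuous_cos _ _)).
exact: (continuous_comp lin (@continuous_sin _ _)).
Qed.

Lemma continuous_trig c a b : continuous (trig c a b).
Proof.
apply: continuous_circle; rewrite (_ : (fun x => _) =
  (fun x => complex.Re (c * cis ((a%:R - b%:R) * x)))).
  exact: continuous_Re_cis.
by apply/funext => x; rewrite trig_pi.
Qed.

Lemma measurable_continuous_circle (phi : circle R -> R) :
  continuous phi -> measurable_fun setT phi.
Proof.
move=> /continuousP cphi; apply: (measurability _ (RGenOpens.measurableE R)).
move=> _ [_ [a [b ->] <-]]; rewrite setTI; apply: sub_sigma_algebra.
exact/cphi/interval_open.
Qed.

Lemma bounded_continuous_circle (phi : circle R -> R) : continuous phi ->
  exists2 C : R, 0 <= C & forall t, `|phi t| <= C.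
Proof.
move=> cphi.
have cn : continuous (fun t => `|phi t|).
  by move=> t; apply: (continuous_comp (cphi t)); exact: norm_continuous.
have ne : [set: circle R] !=set0 by exists 0.
have [c _ cmax] := compact_EVT_max ne compact_circle (continuous_subspaceT cn).
by exists `|phi c| => // t; apply: cmax; rewrite inE.
Qed.

Local Notation mu := (haar_circle R).

Lemma integrable_continuous_circle (phi : circle R -> R) : continuous phi ->
  mu.-integrable setT (EFin \o phi).
Proof.
move=> cphi; have [C _ phiC] := bounded_continuous_circle cphi.
exact: (integrable_bounded _ (measurable_continuous_circle cphi) phiC).
Qed.

(** The constant [C] makes the integrand nonnegative, as the integration formula for the uniform law
    requires. *)
Lemma haar_circleE (phi : circle R -> R) (C : R) : continuous phi ->
  (forall t, `|phi t| <= C) ->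
  ((\int[mu]_t phi t + C)%R%:E =
   \int[lebesgue_measure]_(x in `[0%R, 1%R]) (phi (circle_pi x) + C)%:E)%E.
Proof.
move=> cphi phiC; have iphi := integrable_continuous_circle cphi.
have mphi := measurable_continuous_circle cphi.
have mphipi : measurable_fun setT (phi \o circle_pi_mfun R).
  exact: (measurableT_comp mphi).
have ipi := integrable_bounded (uniform_prob (@ltr01 R)) mphipi (fun x => phiC (circle_pi x)).
have iC := integrable_bounded (uniform_prob (@ltr01 R)) (measurable_cst C) (fun=> lexx `|C|).
rewrite /Rintegral /haar_circle integral_distribution//; last exact/measurable_EFinP.
rewrite -[LHS](_ : \int[uniform_prob (@ltr01 R)]_x (phi (circle_pi x) + C)%:E = _)%E; last first.
  rewrite (integralD_EFin measurableT ipi iC) /= EFinD fineK ?integrable_fin_num//.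
  by congr (_ + _)%E; exact: integral_cst_prob.
rewrite integral_uniform ?subr0 ?invr1 ?mul1e//.
  by apply/measurable_EFinP/measurable_funD.
by move=> x; rewrite lee_fin -lerBlDr sub0r; have := phiC (circle_pi x); rewrite ler_norml => /andP[].
Qed.

Lemma haar_trig c (a b : nat) : a != b -> \int[mu]_t trig c a b t = 0.
Proof.
move=> ab; pose d : R := a%:R - b%:R.
have d0 : d != 0 by rewrite subr_eq0 eqr_nat.
have dint : d \is a Num.int by rewrite rpredB ?natr_int.
have [C C0 tC] := bounded_continuous_circle (@continuous_trig c a b).
have := haar_circleE (@continuous_trig c a b) tC.
pose w : R := d * (pi *+ 2).
have w0 : w != 0 by rewrite mulf_neq0// mulrn_eq0 /= gt_eqF ?pi_gt0.
pose f x : R := trig c a b (circle_pi x) + C.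
(* An antiderivative of [f]; since the frequency [d] is an integer, its trigonometric part agrees at
   0 and 1. *)
pose FF x : R := w^-1 * (complex.Re c * sin (w * x) + complex.Im c * cos (w * x)) + C * x.
have fE x : f x = complex.Re c * cos (w * x) - complex.Im c * sin (w * x) + C.
  rewrite /f trig_pi -/d /cis (_ : w * x = d * x * (pi *+ 2)); last by rewrite /w mulrAC.
  by case: (c).
have dFF x : is_derive x 1 FF (f x).
  rewrite fE; apply: is_derive_eq; rewrite /GRing.scale /= !mulr1; field.
  exact: w0.
have cF : continuous FF.
  move=> x; apply: differentiable_continuous; apply/derivable1_diffP.
  exact: ex_derive.
have cf : continuous f.
  rewrite (_ : f = fun x => complex.Re (c * cis (d * x)) + C).
    by move=> x; apply: cvgD; [exact: continuous_Re_cis|exact: cvg_cst].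
  by apply/funext => x; rewrite /f trig_pi.
rewrite (@continuous_FTC2 _ f FF)//; last 3 first.
- exact: continuous_subspaceT.
- split.
  + by move=> x _; exact: ex_derive.
  + exact/cvg_at_right_filter/cF.
  + exact/cvg_at_left_filter/cF.
- by move=> x _; rewrite derive1E derive_val.
rewrite -EFinB => -[]; have /eqP := cis_int dint; rewrite eq_complex /= => /andP[/eqP c1 /eqP s1].
rewrite /FF !mulr0 !mulr1 -/w in c1 s1 *; rewrite c1 s1 sin0 cos0 !mulr0 !add0r => e.
by move: e; lra.
Qed.

(** The pairs with oscillation at least [e] form a compact set avoiding the diagonal, on which the
    nonnegative function [1 - Re] has a positive minimum. As in Korovkin's theorem, this reduces
    approximation by a positive kernel to its mass and first moment. *)
Lemma chi_modulus_continuity (phi : circle R -> R) (e : R) : continuous phi -> 0 < e ->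
  exists2 C : R, 0 <= C & forall s t,
    `|phi t - phi s| <= e + C * (1 - complex.Re (chi t * (chi s)^*)).
Proof.
move=> cphi e0; have [M M0 phiM] := bounded_continuous_circle cphi.
pose h (q : circle R * circle R) := `|phi q.1 - phi q.2|.
pose d (q : circle R * circle R) := 1 - complex.Re (chi q.1 * (chi q.2)^*).
have cRe : continuous (fun t : circle R => complex.Re (chi t)).
  have -> : (fun t : circle R => complex.Re (chi t)) = trig 1 1 0.
    by apply/funext => t; rewrite /trig mul1r expr1 expr0 mulr1.
  exact: continuous_trig.
have cIm : continuous (fun t : circle R => complex.Im (chi t)).
  have -> : (fun t : circle R => complex.Im (chi t)) = trig (- 'i%C) 1 0.
    apply/funext => t; rewrite /trig expr1 expr0 mulr1 mulNr.
    by case: (chi t) => x y /=; rewrite mul0r sub0r opprK mul1r.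
  exact: continuous_trig.
have c1 (f : circle R -> R) : continuous f -> continuous (fun q : circle R * circle R => f q.1).
  by move=> cf q; apply: continuous_comp; [exact: cvg_fst|exact: cf].
have c2 (f : circle R -> R) : continuous f -> continuous (fun q : circle R * circle R => f q.2).
  by move=> cf q; apply: continuous_comp; [exact: cvg_snd|exact: cf].
have ch : continuous h.
  move=> q; apply: (@continuous_comp _ _ _ (fun q => phi q.1 - phi q.2) Num.Def.normr).
    by apply: cvgB; [exact: c1|exact: c2].
  exact: norm_continuous.
have cd : continuous d.
  rewrite (_ : d = fun q => 1 - (complex.Re (chi q.1) * complex.Re (chi q.2) +
     complex.Im (chi q.1) * complex.Im (chi q.2))).
    move=> q; apply: cvgB; first exact: cvg_cst.
    by apply: cvgD; apply: cvgM; do ?[exact: (c1 _ cRe)|exact: (c1 _ cIm)|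
      exact: (c2 _ cRe)|exact: (c2 _ cIm)].
  by apply/funext => q; rewrite /d Re_mul_conj.
pose A := [set q | e <= h q].
have cA : compact A.
  apply: (@subclosed_compact _ _ [set: circle R * circle R]%type) => //.
    by apply: (@preimage_closed _ _ h [set x | e <= x]) => //; exact: closed_ge.
  by rewrite -setXTT; apply: compact_setX; exact: compact_circle.
have d_ge0 q : 0 <= d q.
  rewrite subr_ge0 (le_trans (ler_norm _))// normC1_Re//.
  by rewrite normrM norm_conjC !norm_chi mulr1.
have [A0|/set0P A0] := eqVneq A set0.
  exists 0 => // s t; rewrite mul0r addr0 leNgt; apply/negP => /ltW.
  by apply/negP; rewrite -/(h (t, s)); apply/negP => hA; have : A (t, s) by []; rewrite A0.
have [c cA' cmin] := compact_EVT_min A0 cA (continuous_subspaceT cd).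
have dc : 0 < d c.
  rewrite lt_neqAle d_ge0 andbT eq_sym; apply/negP => /eqP d0.
  have cc : chi c.1 = chi c.2.
    have n1 := normC_eq1 (norm_chi c.1); have n2 := normC_eq1 (norm_chi c.2).
    move: d0; rewrite /d Re_mul_conj => d0.
    apply/eqP; rewrite eq_complex -subr_eq0 -[X in _ && X]subr_eq0.
    rewrite -sqrf_eq0 -[X in _ && X]sqrf_eq0.
    rewrite -(paddr_eq0 (sqr_ge0 _) (sqr_ge0 _)); apply/eqP.
    by rewrite !sqrrB; lra.
  move: cA'; rewrite inE /A /= /h (chi_inj cc) subrr normr0 leNgt.
  by rewrite e0.
exists (2 * M / d c) => [|s t]; first by rewrite divr_ge0 ?mulr_ge0// ltW.
have [hA|] := leP e (h (t, s)); last first.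
  by move=> /ltW h1; rewrite (le_trans h1)// lerDl mulr_ge0 ?(d_ge0 (t, s))// divr_ge0 ?mulr_ge0// ltW.
have dd : d c <= d (t, s) by apply: cmin; rewrite inE.
apply: (@le_trans _ _ (2 * M)).
  by rewrite (le_trans (ler_normB _ _))// mulr_natl mulr2n lerD.
apply: (@le_trans _ _ (2 * M / d c * d (t, s))); last by rewrite lerDr ltW.
by rewrite mulrAC ler_pdivlMr// ler_wpM2l// mulr_ge0.
Qed.

(* [n] times the Fejér kernel. *)
Definition fejer (n : nat) t : R[i] := \sum_(a < n) \sum_(b < n) chi t ^+ a * (chi t)^* ^+ b.

Lemma fejer_real n t : exists2 x : R, 0 <= x & fejer n t = x%:C%C.
Proof.
have -> : fejer n t = `|\sum_(a < n) chi t ^+ a| ^+ 2.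
  rewrite normCK rmorph_sum mulr_suml; apply: eq_bigr => a _; rewrite mulr_sumr.
  by apply: eq_bigr => b _; rewrite rmorphXn.
rewrite normc_def; exists (Num.sqrt (complex.Re (\sum_(a < n) chi t ^+ a) ^+ 2 +
  complex.Im (\sum_(a < n) chi t ^+ a) ^+ 2) ^+ 2); first exact: sqr_ge0.
by rewrite rmorphXn.
Qed.

Definition node (M : nat) (j : nat) : circle R := circle_pi (j%:R / M%:R).

Lemma chi_node M j : chi (node M j) = cis M%:R^-1 ^+ j.
Proof. by rewrite chi_pi cisMn. Qed.

Lemma node_orthogonality (M a b : nat) t : (a < M)%N -> (b < M)%N ->
  \sum_(j < M) chi (t - node M j) ^+ a * (chi (t - node M j))^* ^+ b =
  if a == b then M%:R else 0.
Proof.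
move=> aM bM; have M0 : (M%:R : R) != 0 by rewrite pnatr_eq0; case: M aM bM.
case: eqVneq => [->|ab].
  rewrite (eq_bigr (fun=> 1)) ?sumr_const ?card_ord// => j _.
  by rewrite -exprMn -[chi _]/(cis _) cis_conj expr1n.
pose z : R[i] := cis M%:R^-1; pose q := z^* ^+ a * z ^+ b.
have qE : q = cis ((b%:R - a%:R) / M%:R).
  by rewrite /q /z -cisN -!cisMn -cisD; congr cis; rewrite mulrBl mulrN addrC.
rewrite (eq_bigr (fun j : 'I_M => chi t ^+ a * (chi t)^* ^+ b * q ^+ j)); last first.
  move=> j _; rewrite chiBJ chiB chi_node rmorphXn /= -/z /q.
  by rewrite !exprMn -!exprM [(j * a)%N]mulnC [(j * b)%N]mulnC; ring.
rewrite -mulr_sumr; have q1 : q - 1 != 0.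
  rewrite subr_eq0 qE; apply/negP => /eqP/cis_eq1 qint.
  have : (b%:R - a%:R) / M%:R != 0 :> R.
    by rewrite mulf_neq0 ?invr_eq0// subr_eq0 eqr_nat eq_sym.
  move/(norm_intr_ge1 qint); apply/negP; rewrite -ltNge normrM normfV [ `|M%:R|]ger0_norm//.
  rewrite ltr_pdivrMr ?ltr0n ?(leq_ltn_trans _ aM)// mul1r ltr_norml.
  have : (a%:R : R) < M%:R by rewrite ltr_nat.
  have : (b%:R : R) < M%:R by rewrite ltr_nat.
  have : (0 : R) <= a%:R by []. have : (0 : R) <= b%:R by [].
  by move=> *; apply/andP; split; lra.
have : q ^+ M - 1 = 0 by rewrite qE -cisMn mulrC divfK// cis_int ?subrr// rpredB ?natr_int.
by rewrite subrX1 => /eqP; rewrite mulf_eq0 (negbTE q1) /= => /eqP ->; rewrite mulr0.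
Qed.

Lemma sum_fejer n t : \sum_(j < n.+1) fejer n (t - node n.+1 j) = (n * n.+1)%:R.
Proof.
rewrite exchange_big /=; under eq_bigr do rewrite exchange_big /=.
have o (a b : 'I_n) := node_orthogonality t (leqW (ltn_ord a)) (leqW (ltn_ord b)).
rewrite (eq_bigr (fun=> n.+1%:R)) => [|a _].
  by rewrite sumr_const card_ord natrM mulr_natl.
rewrite (bigD1 a)//= o eqxx big1 ?addr0// => b ba.
by rewrite o ifN// eq_sym.
Qed.

(** Multiplication by [chi] raises the exponent [a] to [a.+1], which can reach [n]; [n.+1] nodes
    still separate the exponents up to [n], and [n.-1] pairs satisfy [a.+1 = b]. *)
Lemma sum_fejer_chi n t : \sum_(j < n.+1)
  fejer n (t - node n.+1 j) * chi (t - node n.+1 j) = (n.-1 * n.+1)%:R.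
Proof.
have -> : \sum_(j < n.+1) fejer n (t - node n.+1 j) * chi (t - node n.+1 j) =
  \sum_(a < n) \sum_(b < n) (if a.+1 == b then n.+1%:R else 0).
  under eq_bigr do rewrite mulr_suml; rewrite exchange_big /=; apply: eq_bigr => a _.
  under eq_bigr do rewrite mulr_suml; rewrite exchange_big /=; apply: eq_bigr => b _.
  rewrite -(@node_orthogonality n.+1 a.+1 b t (ltn_ord a) (leqW (ltn_ord b))).
  by apply: eq_bigr => j _; rewrite mulrAC -exprSr.
case: n => [|n]; first by rewrite big_ord0 mul0n.
rewrite big_ord_recr /= [X in _ + X]big1 ?addr0; last first.
  by move=> b _; rewrite eqn_leq [(_ <= b)%N]leqNgt ltn_ord.
rewrite (eq_bigr (fun=> n.+2%:R)) => [|a _].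
  by rewrite sumr_const card_ord natrM mulr_natl.
have a1 : (a.+1 < n.+1)%N by rewrite ltnS.
rewrite (bigD1 (Ordinal a1))//= eqxx big1 ?addr0// => b ba.
by case: eqP => // e; case/eqP: ba; apply/val_inj.
Qed.

(** The normalized kernel, discretized at [n.+1] nodes, is nonnegative of mass 1 and gives [1 - Re]
    the mean [1 / n], so the error is at most [e / 2 + C / n]. *)
Lemma trig_approx (phi : circle R -> R) (e : R) : continuous phi -> 0 < e ->
  exists n (cf : nat -> nat -> R[i]), forall t,
    `|phi t - \sum_(a < n) \sum_(b < n) trig (cf a b) a b t| <= e.
Proof.
move=> cphi e0; have e20 : 0 < e / 2 by rewrite divr_gt0.
have [C C0 phiC] := chi_modulus_continuity cphi e20.
have [m mP] : exists m : nat, C * 2 / e <= m%:R.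
  by eexists; apply/ltW/archi_boundP; rewrite !mulr_ge0 ?invr_ge0// ltW.
pose n := m.+1; pose M := n.+1; pose c : R := (n * M)%:R^-1.
have nM0 : (0 : R) < (n * M)%:R by rewrite ltr0n muln_gt0.
have c0 : 0 <= c by rewrite invr_ge0 ltW.
pose cf a b := \sum_(j < M) (c * phi (node M j))%:C%C *
  (chi (node M j))^* ^+ a * chi (node M j) ^+ b.
exists n, cf => t.
have /choice[K KP] : forall j : 'I_M, exists x : R, 0 <= x /\ fejer n (t - node M j) = x%:C%C.
  by move=> j; have [x x0 xE] := fejer_real n (t - node M j); exists x.
have PE : \sum_(a < n) \sum_(b < n) trig (cf a b) a b t = \sum_(j < M) c * phi (node M j) * K j.
  rewrite -[RHS]/(complex.Re (\sum_(j < M) c * phi (node M j) * K j)%:C%C) rmorph_sum /=.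
  under eq_bigr do rewrite -Re_sum; rewrite -Re_sum; congr complex.Re.
  under [RHS]eq_bigr => j _ do rewrite rmorphM /= -(KP j).2 mulr_sumr.
  rewrite [RHS]exchange_big /=; apply: eq_bigr => a _.
  under [RHS]eq_bigr do rewrite mulr_sumr.
  rewrite [RHS]exchange_big /=; apply: eq_bigr => b _.
  rewrite /cf !mulr_suml; apply: eq_bigr => j _.
  by rewrite chiBJ chiB !exprMn; ring.
have K1 : \sum_(j < M) K j = (n * M)%:R.
  apply/complexI; rewrite rmorph_sum rmorph_nat -(sum_fejer n t).
  by apply: eq_bigr => j _; rewrite (KP j).2.
have K2 : \sum_(j < M) K j * complex.Re (chi t * (chi (node M j))^*) = (n.-1 * M)%:R.
  have := congr1 (@complex.Re R) (sum_fejer_chi n t).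
  rewrite [in RHS]natC /= => <-; rewrite Re_sum; apply: eq_bigr => j _.
  by rewrite (KP j).2 Re_real_mul chiB.
rewrite PE.
have -> : phi t = \sum_(j < M) c * phi t * K j.
  by rewrite -mulr_sumr K1 mulrAC mulVf ?mul1r// gt_eqF.
rewrite -sumrB (le_trans (ler_norm_sum _ _ _))//.
apply: (@le_trans _ _ (\sum_(j < M) c * ((e / 2 + C) * K j -
    C * (K j * complex.Re (chi t * (chi (node M j))^*))))).
  apply: ler_sum => j _; have Kj := (KP j).1.
  rewrite -mulrBl -mulrBr !normrM [ `|c|]ger0_norm// [ `|K j|]ger0_norm// -mulrA.
  rewrite ler_wpM2l//; have := ler_wpM2r Kj (phiC (node M j) t).
  by move/le_trans; apply; rewrite le_eqVlt; apply/orP; left; apply/eqP; ring.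
rewrite -mulr_sumr sumrB -!mulr_sumr K1 K2 ler_pdivrMl//.
have nR : (0 : R) < n%:R by [].
have h2 : C * 2 <= e * n%:R.
  rewrite -ler_pdivrMl// mulrC (le_trans mP)// ler_nat; exact: leqnSn.
have nm : n%:R = m%:R + 1 :> R by rewrite natr1.
have h3 : 0 <= M%:R * (e * n%:R - C * 2) by rewrite mulr_ge0// subr_ge0.
rewrite !natrM -[n.-1]/m; move: h2 h3; rewrite nm; set u : R := m%:R; set v : R := M%:R.
by move=> h2 h3; nra.
Qed.

End Circle.

Section Weyl.
Variables (R : realType) (G : groupType) (F : nat -> {fset G}).
Hypothesis F_folner : folner R F.
Variable x : G -> circle R.

Let dev (psi : circle R -> R) N := ravg (F N) (fun g => psi (x g)) - \int[haar_circle R]_t psi t.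

Let devD psi1 psi2 N : continuous psi1 -> continuous psi2 ->
  dev (fun t => psi1 t + psi2 t) N = dev psi1 N + dev psi2 N.
Proof.
move=> c1 c2; rewrite /dev ravgD RintegralD//; try exact: integrable_continuous_circle.
by ring.
Qed.

(** The deviation [dev] is additive and at most twice the sup norm, so an approximation by waves
    within [e / 4] costs [e / 2]. *)
Lemma weyl : (forall k, (0 < k)%N -> average_cvg F (fun g => chi (x g) ^+ k) 0) ->
  ud_mod1 F x.
Proof.
move=> Fx.
have dev_trig c a b : dev (trig c a b) N @[N --> \oo] --> (0 : R).
  have dev_neq (k : nat) (c' : R[i]) (psi : circle R -> R) : (0 < k)%N -> (forall t, psi t = complex.Re (c' * chi t ^+ k)) ->
     ravg (F N) (fun g => psi (x g)) @[N --> \oo] --> (0 : R).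
    move=> k0 psiE; have /average_cvgP[/= h1 h2] := Fx k k0.
    have := cvgn0D (cvgn0Z (complex.Re c') h1) (cvgn0Z (- complex.Im c') h2).
    apply: eq_cvgn => N; rewrite -!ravgZ -ravgD; apply: eq_ravg => g _.
    by rewrite psiE; case: (c') (chi _ ^+ k) => p q [u v] /=; rewrite mulNr.
  have [->|ab] := eqVneq a b.
    have e t : trig c b b t = complex.Re c.
      by rewrite /trig -mulrA -exprMn -[chi t]/(cis _) cis_conj expr1n mulr1.
    apply: (@eq_cvgn _ (fun=> 0)); last exact: cvg_cst.
    move=> N; rewrite /dev (_ : trig c b b = cst (complex.Re c)); last exact/funext.
    rewrite ravg_cst; last by case: F_folner.
    by rewrite /Rintegral integral_cst_prob subrr.
  rewrite /dev haar_trig//; apply: (@eq_cvgn _ (fun N => ravg (F N) (fun g => trig c a b (x g)))).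
    by move=> N; rewrite subr0.
  have cc (t : circle R) n : chi t ^+ n * (chi t)^* ^+ n = 1.
    by rewrite -exprMn -[chi t]/(cis _) cis_conj expr1n.
  case: (ltngtP a b) ab => // ab _.
    (* A negative frequency becomes positive by conjugating under the real part. *)
    apply: (dev_neq (b - a)%N c^*); first by rewrite subn_gt0.
    move=> t; rewrite /trig -{1}(subnKC (ltnW ab)) exprD.
    rewrite (_ : c * _ * _ = c * (chi t)^* ^+ (b - a) * (chi t ^+ a * (chi t)^* ^+ a)); last by ring.
    rewrite cc mulr1 -rmorphXn.
    by case: (c) (chi t ^+ _) => p q [u v] /=; ring.
  apply: (dev_neq (a - b)%N c); first by rewrite subn_gt0.
  move=> t; rewrite /trig -{1}(subnKC (ltnW ab)) exprD.
  rewrite (_ : c * _ * _ = c * chi t ^+ (a - b) * (chi t ^+ b * (chi t)^* ^+ b)); last by ring.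
  by rewrite cc mulr1.
have dev_sum I (r : seq I) (f : I -> circle R -> R) : (forall i, continuous (f i)) ->
    continuous (fun t => \sum_(i <- r) f i t) /\
    forall N, dev (fun t => \sum_(i <- r) f i t) N = \sum_(i <- r) dev (f i) N.
  move=> cf; elim: r => [|i r [ihc ih]].
    rewrite (_ : (fun t => _) = cst 0); last by apply/funext => t; rewrite big_nil.
    split=> [t|N]; first exact: cst_continuous.
    rewrite big_nil /dev ravg_cst; last by case: F_folner.
    by rewrite /Rintegral integral_cst_prob subrr.
  rewrite (_ : (fun t => _) = (fun t => f i t + \sum_(i <- r) f i t)); last first.
    by apply/funext => t; rewrite big_cons.
  split=> [t|N]; first exact: cvgD (cf i t) (ihc t).
  by rewrite devD// ih big_cons.
have dev0 psi : continuous psi -> dev psi N @[N --> \oo] --> (0 : R).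
  move=> cpsi; apply/cvgrPdist_le => e e0.
  have e40 : 0 < e / 4 by rewrite divr_gt0.
  have [n [cf cfP]] := trig_approx cpsi e40.
  pose P t := \sum_(a < n) \sum_(b < n) trig (cf a b) a b t.
  have Pb (a : 'I_n) := dev_sum _ (index_enum 'I_n) (fun b : 'I_n => trig (cf a b) a b)
    (fun b => @continuous_trig R _ _ _).
  have [cP devP] := dev_sum _ (index_enum 'I_n) _ (fun a : 'I_n => (Pb a).1).
  have P0 : dev P N @[N --> \oo] --> (0 : R).
    apply: (@eq_cvgn _ (fun N => \sum_(a < n) \sum_(b < n) dev (trig (cf a b) a b) N)).
      by move=> N; rewrite /P devP; apply: eq_bigr => a _; rewrite (Pb a).2.
    by apply: cvg_sum0 => a; apply: cvg_sum0 => b; exact: dev_trig.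
  have e20 : 0 < e / 2 by rewrite divr_gt0.
  move/cvgrPdist_le: P0 => /(_ _ e20); apply: filterS => N; rewrite !sub0r !normrN => PN.
  pose rho t := psi t - P t.
  have crho : continuous rho by move=> t; exact: cvgB (cpsi t) (cP t).
  have -> : dev psi N = dev rho N + dev P N.
    by rewrite -devD//; congr dev; apply/funext => t; rewrite /rho subrK.
  rewrite (le_trans (ler_normD _ _))// [leRHS](_ : e = e / 2 + e / 2); last by field.
  rewrite lerD// /dev (le_trans (ler_normB _ _))//.
  rewrite (_ : e / 2 = e / 4 + e / 4); last by field.
  apply: lerD.
    rewrite (le_trans (ler_norm_ravg _ _))//.
    rewrite -[leRHS](@ravg_cst R G (F N)); last by case: F_folner.
    by apply: ler_ravg => g _; exact: cfP.
  have irho := integrable_continuous_circle crho.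
  rewrite (le_trans (le_normr_Rintegral _ irho))//.
  have cn : continuous (fun t => `|rho t|).
    by move=> t; apply: (continuous_comp (crho t)); exact: norm_continuous.
  rewrite -[leRHS](_ : \int[haar_circle R]_t (e / 4) = _); last by rewrite /Rintegral integral_cst_prob.
  apply: le_Rintegral => //.
  - exact: integrable_continuous_circle.
  - exact: (integrable_bounded _ (measurable_cst _) (fun=> lexx `|e / 4|)).
  - by move=> t _; exact: cfP.
have dev_cvg psi : continuous psi ->
    ravg (F N) (fun g => psi (x g)) @[N --> \oo] --> \int[haar_circle R]_t psi t.
  move=> /dev0 h; apply/cvgrPdist_le => e e0; move/cvgrPdist_le: h => /(_ e e0).
  by apply: filterS => N; rewrite sub0r normrN distrC.
move=> phi cphi; apply/average_cvgP; split; apply: dev_cvg => t.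
  by have /cvgC_parts[] := cphi t.
by have /cvgC_parts[] := cphi t.
Qed.

Lemma ud_chi : ud_mod1 F x -> forall k, (0 < k)%N -> average_cvg F (fun g => chi (x g) ^+ k) 0.
Proof.
move=> xud k k0.
have t1 (t : circle R) : complex.Re (chi t ^+ k) = trig 1 k 0 t.
  by rewrite /trig mul1r expr0 mulr1.
have t2 (t : circle R) : complex.Im (chi t ^+ k) = trig (- 'i%C) k 0 t.
  rewrite /trig expr0 mulr1 mulNr.
  by case: (chi t ^+ k) => p q /=; rewrite mul0r sub0r opprK mul1r.
have c1 : continuous (fun t : circle R => complex.Re (chi t ^+ k)).
  by rewrite (funext t1 : (fun t => _) = _); exact: continuous_trig.
have c2 : continuous (fun t : circle R => complex.Im (chi t ^+ k)).
  by rewrite (funext t2 : (fun t => _) = _); exact: continuous_trig.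
have ck : continuous (fun t : circle R => chi t ^+ k : R[i]^o).
  move=> t; apply: (cvgC_parts (F := nbhs t) (fun t => chi t ^+ k) (chi t ^+ k)).2; split.
    exact: c1.
  exact: c2.
have i1 : \int[haar_circle R]_t complex.Re (chi t ^+ k) = 0.
  by rewrite (funext t1 : (fun t => _) = _) haar_trig// -lt0n.
have i2 : \int[haar_circle R]_t complex.Im (chi t ^+ k) = 0.
  by rewrite (funext t2 : (fun t => _) = _) haar_trig// -lt0n.
by have := xud _ ck; rewrite /cintegral i1 i2.
Qed.

End Weyl.

(** * From uniform distribution to the disk *)

Lemma Er_prod_seq (K : comNzRingType) (s : nat -> nat) (p : nat -> nat -> K)
    (phi : nat -> nat -> K) (r : seq nat) k w :
  (forall n, \sum_(o < s n) p n o = 1) -> uniq r -> {in r, forall n, (n < k)%N} ->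
  Er s p k 0 (fun w => \prod_(n <- r) phi n (w n)) w =
  \prod_(n <- r) \sum_(o < s n) p n o * phi n o.
Proof.
move=> p1 ur rk.
have ext (f : nat -> K) : \prod_(n <- r) f n = \prod_(0 <= n < 0 + k) (if n \in r then f n else 1).
  rewrite -big_mkcond -[RHS]big_filter /=; apply: perm_big; apply: uniq_perm => //.
    by rewrite filter_uniq// iota_uniq.
  by move=> n; rewrite mem_filter mem_index_iota add0n /=; apply/idP/andP => [nr|[]//]; rewrite nr rk.
rewrite (@eq_Er _ s p k 0 _ (fun w => \prod_(0 <= n < 0 + k) (if n \in r then phi n (w n) else 1))) => [|w']; last exact: ext.
rewrite (@Er_prod _ s p (fun n o => if n \in r then phi n o else 1)) ext.
apply: eq_bigr => n _; case: ifP => // _.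
by rewrite -[RHS](p1 n); apply: eq_bigr => o _; rewrite mulr1.
Qed.

Lemma sum_complex_law (R : realType) (s : nat -> nat) (p : nat -> nat -> R) :
  (forall n, \sum_(o < s n) p n o = 1) ->
  forall n, \sum_(o < s n) (p n o)%:C%C = 1 :> R[i].
Proof. by move=> p1 n; rewrite -rmorph_sum p1. Qed.

Lemma norm1_conj (R : realType) (z : R[i]) : `|z| = 1 -> z * z^* = 1.
Proof. by rewrite -normCK => ->; rewrite expr1n. Qed.

Lemma sum_roots (R : realType) (M k : nat) : (k < M)%N ->
  \sum_(j < M) chi (node R M j) ^+ k = if k == 0%N then M%:R else 0.
Proof.
move=> kM; have M0 : (0 < M)%N by apply: leq_ltn_trans kM.
have := node_orthogonality (0 : circle R) M0 kM; rewrite eq_sym => <-.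
apply: eq_bigr => j _; rewrite expr0 mul1r chiBJ.
suff -> : chi (0 : circle R) = 1 by rewrite rmorph1 mulr1.
by rewrite -[X in chi X](subrr (0 : circle R)) chiB norm1_conj ?norm_chi.
Qed.

(** * Random roots of unity with prescribed mean *)

Section TiltedRoots.
Variables (R : realType) (M : nat) (z : R[i]).
Hypothesis M3 : (2 < M)%N.
Hypothesis z1 : `|z| <= 1.

(** A Riesz product factor taken as density with respect to the uniform law on the [M]-th roots of
    unity. *)
Definition tilted o : R := M%:R^-1 * (1 + complex.Re (z^* * chi (node R M o))).

Let M0 : (M%:R : R) != 0.
Proof. by rewrite pnatr_eq0 -lt0n (ltn_trans _ M3). Qed.

Lemma tilted_ge0 o : 0 <= tilted o.
Proof.
rewrite mulr_ge0 ?invr_ge0//.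
have : `|z^* * chi (node R M o)| <= 1 by rewrite normrM norm_conjC norm_chi mulr1.
by move/normC1_Re; rewrite ler_norml => /andP[]; lra.
Qed.

(** The real part splits into two halves that shift the exponent by one up and one down. Among
    [k - 1], [k] and [k + 1], all below [M], only the first can vanish; the half is the origin of
    [z / 2]. *)
Lemma tilted_moment k : (0 < k)%N -> (k.+1 < M)%N ->
  \sum_(o < M) (tilted o)%:C%C * chi (node R M o) ^+ k = if k == 1%N then z / 2 else 0.
Proof.
move=> k0 kM.
have tE o : (tilted o)%:C%C * chi (node R M o) ^+ k =
    M%:R^-1 * (chi (node R M o) ^+ k + z^* / 2 * chi (node R M o) ^+ k.+1 +
      z / 2 * chi (node R M o) ^+ k.-1).
  have -> : chi (node R M o) ^+ k.-1 = (chi (node R M o))^* * chi (node R M o) ^+ k.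
    by rewrite -{2}(prednK k0) exprS mulrA [_^* * _]mulrC norm1_conj ?norm_chi// mul1r.
  rewrite /tilted rmorphM rmorphD rmorph1 /= -natCV ReJ_add -[conjc _]/(_^*).
  have -> : (z^* * chi (node R M o))^* = z * (chi (node R M o))^*.
    by rewrite [LHS]rmorphM; congr (_ * _); exact: conjCK.
  by rewrite exprS; ring.
under eq_bigr do rewrite tE; rewrite -mulr_sumr !big_split/= -!mulr_sumr.
have kM1 := ltnW kM; have kM2 : (k.-1 < M)%N by apply: leq_ltn_trans kM1; exact: leq_pred.
rewrite (sum_roots R kM1) (sum_roots R kM) (sum_roots R kM2).
have MC : M%:R != 0 :> R[i] by rewrite pnatr_eq0 -lt0n (ltn_trans _ M3).
rewrite /= (gtn_eqF k0) mulr0 !add0r; case: k k0 {kM kM1 kM2 tE} => [|[|k]]//= _.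
  by rewrite mulrC mulfK.
by rewrite mulr0 mulr0.
Qed.

Lemma tilted_sum : \sum_(o < M) tilted o = 1.
Proof.
rewrite -mulr_sumr big_split/= sumr_const card_ord -Re_sum -mulr_sumr.
have := @sum_roots R M 1 (ltn_trans (ltnSn 1) M3).
under eq_bigr do rewrite expr1.
by move=> ->; rewrite mulr0 addr0 mulVf.
Qed.

End TiltedRoots.

Section Shifts.
Variables (G : groupType) (h : nat -> G).

(** [h i] is present from level [i] on, which makes a test of index [i] with shift [h i] local
    wherever the level is at least [i]. *)
Definition shifts j : {fset G} := [fset x in 1%g :: map h (iota 0 j.+1)]%fset.

Lemma shifts1 j : 1%g \in shifts j.
Proof. by rewrite !inE eqxx. Qed.

Lemma mem_shifts i j : (i <= j)%N -> h i \in shifts j.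
Proof.
move=> ij; have : h i \in map h (iota 0 j.+1) by rewrite map_f// mem_iota add0n ltnS.
by rewrite !inE => ->; rewrite orbT.
Qed.

Lemma shiftsS j : (shifts j `<=` shifts j.+1)%fset.
Proof.
have memE k x : (x \in shifts k) = (x == 1%g) || (x \in map h (iota 0 k.+1)) by rewrite !inE.
apply/fsubsetP => x; rewrite !memE => /orP[->//|/mapP[i + ->]].
rewrite mem_iota add0n ltnS => ij; apply/orP; right.
by rewrite map_f// mem_iota add0n ltnS leqW.
Qed.

End Shifts.

Section RandomRotation.
Variables (R : realType) (G : groupType) (F : nat -> {fset G}) (H : set G).
Hypothesis G_countable : countable [set: G].
Hypothesis G_infinite : infinite_set [set: G].
Hypothesis F_folner : folner R F.
Hypothesis H_ne1 : H `<=` [set~ 1%g].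

Lemma Re_mean_zero (v : G -> (nat -> nat) -> R[i]) (E : G -> R[i]) om :
  ravg (F N) (fun g => complex.Re (v g om) - complex.Re (E g)) @[N --> \oo] --> (0 : R) ->
  ravg (F N) (fun g => complex.Im (v g om) - complex.Im (E g)) @[N --> \oo] --> (0 : R) ->
  average_cvg F (fun g => v g om) 0 <-> average_cvg F E 0.
Proof.
move=> h1 h2; rewrite !average_cvgP /=; split=> -[e1 e2]; split.
- have := cvgn0D e1 (cvgn0Z (-1) h1); apply: eq_cvgn => N.
  by rewrite -ravgZ -ravgD; apply: eq_ravg => g _; ring.
- have := cvgn0D e2 (cvgn0Z (-1) h2); apply: eq_cvgn => N.
  by rewrite -ravgZ -ravgD; apply: eq_ravg => g _; ring.
- have := cvgn0D e1 h1; apply: eq_cvgn => N.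
  by rewrite -ravgD; apply: eq_ravg => g _; ring.
- have := cvgn0D e2 h2; apply: eq_cvgn => N.
  by rewrite -ravgD; apply: eq_ravg => g _; ring.
Qed.

Lemma average_c0 (u : G -> R[i]) : (exists C : R, forall g, `|u g| <= C%:C%C) ->
  (forall e : R, 0 < e -> exists E : {fset G}, forall g, g \notin E -> `|u g| <= e%:C%C) ->
  average_cvg F u 0.
Proof.
have part z (e : R) : `|z : R[i]| <= e%:C%C -> `|complex.Re z| <= e /\ `|complex.Im z| <= e.
  rewrite normC_le => ze; split; apply: le_trans ze.
    by rewrite -sqrtr_sqr ler_sqrt ?lerDl ?addr_ge0 ?sqr_ge0.
  by rewrite -sqrtr_sqr ler_sqrt ?lerDr ?addr_ge0 ?sqr_ge0.
move=> [C uC] u0; apply/average_cvgP; split; apply: ravg_c0 => //.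
- by exists C => g; case: (part _ _ (uC g)).
- by move=> e /u0[E EP]; exists E => g /EP/part[].
- by exists C => g; case: (part _ _ (uC g)).
- by move=> e /u0[E EP]; exists E => g /EP/part[].
Qed.

Lemma average_cvg_eventually (u v : G -> R[i]) :
  (exists E : {fset G}, forall g, g \notin E -> u g = v g) ->
  average_cvg F u 0 -> average_cvg F v 0.
Proof.
move=> [E uv]; have fin0 (f : G -> R) : (forall g, g \notin E -> f g = 0) ->
    ravg (F N) f @[N --> \oo] --> (0 : R).
  move=> f0; apply: ravg_c0 => //; last first.
    by move=> e e0; exists E => g /f0 ->; rewrite normr0 ltW.
  exists (\sum_(x <- E) `|f x|) => g; have [gE|gE] := boolP (g \in E).
    by rewrite (big_fsetD1 g)//= lerDl sumr_ge0.
  by rewrite f0// normr0 sumr_ge0.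
rewrite !average_cvgP /= => -[u1 u2]; split.
  have f0 : ravg (F N) (fun g => complex.Re (v g) - complex.Re (u g)) @[N --> \oo] --> (0 : R).
    by apply: fin0 => g /uv ->; rewrite subrr.
  have := cvgn0D u1 f0; apply: eq_cvgn => N.
  by rewrite -ravgD; apply: eq_ravg => g _; ring.
have f0 : ravg (F N) (fun g => complex.Im (v g) - complex.Im (u g)) @[N --> \oo] --> (0 : R).
  by apply: fin0 => g /uv ->; rewrite subrr.
have := cvgn0D u2 f0; apply: eq_cvgn => N.
by rewrite -ravgD; apply: eq_ravg => g _; ring.
Qed.

Lemma average_cvgZ (u : G -> R[i]) (c : R) : average_cvg F u 0 ->
  average_cvg F (fun g => c%:C%C * u g) 0.
Proof.
rewrite !average_cvgP /= => -[u1 u2]; split.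
  by apply: eq_cvgn (cvgn0Z c u1) => N; rewrite -ravgZ; apply: eq_ravg => g _; rewrite Re_real_mul.
by apply: eq_cvgn (cvgn0Z c u2) => N; rewrite -ravgZ; apply: eq_ravg => g _; rewrite Im_real_mul.
Qed.

Lemma F_vdC_disk : F_vdC R F H -> forall z : G -> R[i], (forall g, `|z g| <= 1) ->
  (forall h, H h -> average_cvg F (fun g => z (h * g)%g * (z g)^*) 0) ->
  average_cvg F z 0.
Proof.
move=> FH z z1 zH.
have [site [idx [siteK idxK]]] := countable_enum G_countable G_infinite.
(* The orders exceed 2 and tend to infinity along the enumeration, so each fixed power beyond the
   first has mean zero off finitely many sites. *)
pose s n := n.+3.
pose p n o := tilted n.+3 (z (site n)) o.
pose y n o : R[i] := chi (node R n.+3 o).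
have y1 n o : `|y n o| = 1 by exact: norm_chi.
pose dec i : G := if (choice.unpickle i : option (nat * nat * bool * bool)%type) is Some (n, _, _, _)
  then site n else 1%g.
pose B := shifts dec.
have [lev [lev_fin _ _ der]] := derandomization F_folner G_countable G_infinite siteK idxK
  (shifts1 dec) (shiftsS dec).
(* Tests: the [k]-th power at [g], or its correlation along the shift [site n]. They are numbered
   together with a flag for the real or imaginary part, and [dec] recovers the shift from the
   number. *)
pose v (q : nat * nat * bool) g (om : nat -> nat) : R[i] :=
  let: (n, k, two) := q in
  if two then y (idx (site n * g)%g) (om (idx (site n * g)%g)) ^+ k *
     (y (idx g) (om (idx g)) ^+ k)^* else y (idx g) (om (idx g)) ^+ k.
pose w i g om : R := if (choice.unpickle i : option (nat * nat * bool * bool)%type) is Some (q, re) then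
   if re then complex.Re (v q g om) else complex.Im (v q g om) else 0.
pose m g : nat := (\max_(b <- B (lev g)) (idx (b * g)%g).+1)%N.
have v1 q g om : `|v q g om| <= 1.
  case: q => -[n k] two; rewrite /v; case: two.
    by rewrite normrM norm_conjC !normrX !y1 !expr1n mulr1.
  by rewrite normrX y1 expr1n.
have mB g b : b \in B (lev g) -> (idx (b * g)%g < m g)%N.
  by move=> bB; rewrite /m; apply: (@leq_bigmax_seq _ _ _ (fun b => (idx (b * g)%g).+1)).
have [||||//|om [om_lt omP]] := der s p w m.
- by move=> n o _; exact: tilted_ge0.
- by move=> n; exact: tilted_sum.
- move=> i g om; rewrite /w; case: (choice.unpickle i) => [[q []]|].
  + exact: normC1_Re. + exact: normC1_Im. + by rewrite normr0.
- move=> i g ig om om' e.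
  have e1 : om (idx g) = om' (idx g).
    by apply: e; apply/hasP; exists 1%g; rewrite ?shifts1// mul1g.
  have e2 : om (idx (dec i * g)%g) = om' (idx (dec i * g)%g).
    by apply: e; apply/hasP; exists (dec i); rewrite ?mem_shifts.
  rewrite /w /v; move: e2; rewrite /dec; case: (choice.unpickle i) => // -[[[n k] []] re] /= e2.
    by rewrite e1 e2.
  by rewrite e1.
pose E q g : R[i] := Er s (fun n o => (p n o)%:C%C) (m g) 0 (v q g) (fun=> 0%N).
have vE q : average_cvg F (fun g => v q g om) 0 <-> average_cvg F (E q) 0.
  apply: Re_mean_zero.
    have := omP (choice.pickle (q, true)); apply: eq_cvgn => N; apply: eq_ravg => g _.
    by rewrite /w choice.pickleK /E Re_Er.
  have := omP (choice.pickle (q, false)); apply: eq_cvgn => N; apply: eq_ravg => g _.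
  by rewrite /w choice.pickleK /E Im_Er.
have pC : forall n, \sum_(o < s n) (p n o)%:C%C = 1 :> R[i].
  by apply: sum_complex_law => n; exact: tilted_sum.
pose mom n k : R[i] := \sum_(o < s n) (p n o)%:C%C * y n o ^+ k.
have mom1 g : mom (idx g) 1%N = z g / 2.
  by rewrite /mom tilted_moment// idxK.
have mom_big k : (1 < k)%N -> exists E : {fset G}, forall g, g \notin E -> mom (idx g) k = 0.
  move=> k1; exists [fset x in map site (iota 0 k)]%fset => g gE.
  have kg : (k <= idx g)%N.
    rewrite leqNgt; apply: contra gE => gk; rewrite inE; apply/mapP.
    by exists (idx g); rewrite ?idxK// mem_iota add0n.
  rewrite /mom tilted_moment ?(ltnW k1)//; first by rewrite gtn_eqF.
  by rewrite /s !ltnS (leq_trans kg) ?leqnSn// ltnW.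
have E_single k g : E (0%N, k, false) g = mom (idx g) k.
  have := @Er_prod_seq _ s (fun n o => (p n o)%:C%C) (fun n o => y n o ^+ k) [:: idx g] (m g) (fun=> 0%N) pC.
  rewrite big_seq1 -/(mom (idx g) k) => <- //.
    by apply: eq_Er => om'; rewrite /v big_seq1.
  by move=> n; rewrite inE => /eqP ->; rewrite -[g in idx g]mul1g mB ?shifts1.
have E_pair h k : h != 1%g -> exists E' : {fset G}, forall g, g \notin E' ->
    E (idx h, k, true) g = mom (idx (h * g)%g) k * (mom (idx g) k)^*.
  move=> h1; pose i := choice.pickle (idx h, k, true, true).
  have [E' E'P] := lev_fin i; exists E' => g gE'.
  have ig : (i <= lev g)%N by rewrite leqNgt; apply: contra gE' => /ltnW; exact: E'P.
  have hB : h \in B (lev g).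
    by have := mem_shifts dec ig; rewrite /dec /i choice.pickleK idxK.
  (* Distinct coordinates are independent, so the expectation of the product factors. *)
  have neq : idx (h * g)%g != idx g.
    rewrite (inj_eq (can_inj idxK)); apply: contra h1 => /eqP e.
    by rewrite -(mulgK g h) e mulgV.
  pose phi n o := if n == idx g then (y n o ^+ k)^* else y n o ^+ k.
  have e1 : (mom (idx g) k)^* = \sum_(o < s (idx g)) (p (idx g) o)%:C%C * phi (idx g) o.
    rewrite /mom rmorph_sum; apply: eq_bigr => o _; rewrite /phi eqxx [LHS]rmorphM.
    by congr (_ * _); exact: conjc_real.
  have e2 : mom (idx (h * g)%g) k =
      \sum_(o < s (idx (h * g)%g)) (p (idx (h * g)%g) o)%:C%C * phi (idx (h * g)%g) o.
    by rewrite /mom /phi (negbTE neq).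
  rewrite e1 e2 /E.
  have := @Er_prod_seq _ s (fun n o => (p n o)%:C%C) phi [:: idx (h * g)%g; idx g] (m g) (fun=> 0%N) pC.
  rewrite !big_cons big_nil mulr1 => <-.
  - apply: eq_Er => om'; rewrite /v !big_cons big_nil mulr1 /phi eqxx idxK.
    by rewrite (negbTE neq).
  - by rewrite /= inE neq.
  - move=> n; rewrite !inE => /orP[]/eqP ->; first exact: mB.
    by rewrite -[g in idx g]mul1g mB ?shifts1.
pose x g := circle_pi ((om (idx g))%:R / (idx g).+3%:R) : circle R.
have chix g : chi (x g) = y (idx g) (om (idx g)) by [].
have xH h : H h -> ud_mod1 F (fun g => x (h * g)%g - x g).
  move=> Hh; have h1 : h != 1%g by apply/eqP; exact: H_ne1.
  apply: weyl => // k k0.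
  have : average_cvg F (fun g => v (idx h, k, true) g om) 0.
    apply/vE; have [E' E'P] := E_pair h k h1.
    apply: (@average_cvg_eventually (fun g => mom (idx (h * g)%g) k * (mom (idx g) k)^*)).
      by exists E' => g /E'P ->.
    (* For [k = 1] the expectation is a quarter of the correlation of [z]; for larger [k] it
       vanishes off a finite set. *)
    have [->|k_n1] := eqVneq k 1%N.
      apply: (@average_cvg_eventually (fun g => (4^-1 : R)%:C%C * (z (h * g)%g * (z g)^*))).
        exists fset0 => g _; rewrite !mom1 fmorphV rmorph_nat.
        have -> : (z g / 2)^* = (z g)^* / 2.
          by rewrite [LHS]rmorphM fmorphV; congr (_ / _); exact: conjc_nat.
        by rewrite (_ : 4 = 2 * 2) ?invfM//; [ring|rewrite -natrM].
      exact/average_cvgZ/zH.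
    have k1 : (1 < k)%N by rewrite ltn_neqAle eq_sym k_n1.
    apply: (@average_cvg_eventually (fun=> 0)).
      have [E1 E1P] := mom_big k k1; exists E1 => g /E1P ->.
      by rewrite [_^*]rmorph0 mulr0.
    apply: average_c0 => [|e e0]; last by exists fset0 => g _; rewrite normr0 ler0c ltW.
    by exists 0 => g; rewrite normr0.
  apply: average_cvg_eventually; exists fset0 => g _.
  by rewrite /v chiB !chix idxK exprMn rmorphXn.
have /ud_chi/(_ 1%N isT) xavg := FH x xH.
have {}xavg : average_cvg F (fun g => v (0%N, 1%N, false) g om) 0.
  by apply: average_cvg_eventually xavg; exists fset0 => g _; rewrite chix.
move/vE : xavg => /(@average_cvgZ _ 2); apply: average_cvg_eventually; exists fset0 => g _.
by rewrite E_single mom1 rmorph_nat mulrC divfK// pnatr_eq0.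
Qed.

End RandomRotation.

Lemma circle_vdC (R : realType) (G : groupType) (F : nat -> {fset G}) (H : set G) :
  folner R F ->
  (forall z : G -> R[i], (forall g, `|z g| = 1) ->
    (forall h, H h -> average_cvg F (fun g => z (h * g)%g * (z g)^*) 0) ->
    average_cvg F z 0) ->
  F_vdC R F H.
Proof.
move=> FF zH x xH; apply: weyl => // k k0; apply: zH => [g|h Hh].
  by rewrite normrX norm_chi expr1n.
have := ud_chi (xH h Hh) k0; rewrite (_ : (fun g => chi _ ^+ k) =
  fun g => chi (x (h * g)%g) ^+ k * (chi (x g) ^+ k)^*)//.
by apply/funext => g; rewrite chiB exprMn rmorphXn.
Qed.

(** * From the disk to the finitary condition *)

Lemma ler_norm_Er (K : numDomainType) (s : nat -> nat) (p : nat -> nat -> K)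
    (f u : (nat -> nat) -> K) k n w :
  (forall n o, (o < s n)%N -> 0 <= p n o) -> (forall w, `|f w| <= u w) ->
  `|Er s p k n f w| <= Er s p k n u w.
Proof.
move=> p0 fu; elim: k n w => [|k ih] n w //=.
rewrite (le_trans (ler_norm_sum _ _ _))//; apply: ler_sum => o _.
by rewrite normrM ger0_norm ?p0// ler_wpM2l ?p0.
Qed.

Lemma bernoulli_ge (R : realFieldType) (q : R) n : 0 <= q <= 1 -> 1 - n%:R * q <= (1 - q) ^+ n.
Proof.
move=> /andP[q0 q1]; elim: n => [|n ih]; first by rewrite mul0r subr0 expr0.
rewrite exprS (le_trans _ (ler_wpM2l _ ih)) ?subr_ge0//.
rewrite -natr1; have := mulr_ge0 (ler0n R n) (sqr_ge0 q); nra.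
Qed.

Lemma increasing_hull (T : choiceType) (X : nat -> {fset T}) :
  exists B : nat -> {fset T},
    (forall j, (B j `<=` B j.+1)%fset) /\ forall j, (X j `<=` B j)%fset.
Proof.
exists (fix B j := if j is i.+1 then (B i `|` X j)%fset else X 0%N); split => [j|[|j]] //=.
- exact: fsubsetUl.
- exact: fsubsetUr.
Qed.

(** Levels are grouped in blocks of three; from the middle of a block a move by at most one level
    stays in the block. *)
Lemma divn3_middle (a b : nat) :
  (a %% 3 == 1)%N -> (b <= a.+1)%N -> (a <= b.+1)%N -> (b %/ 3 = a %/ 3)%N.
Proof. by move=> a1 ba ab; rewrite (divn_eq a 3) (divn_eq b 3) in a1 ba ab *; lia. Qed.

(** * Patterns placed at random sites *)

Section SoleActiveSite.
Variables (R : realType) (G : groupType) (idx : G -> nat) (m : nat).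
Variables (s : nat -> nat) (p : nat -> nat -> R).
Hypothesis idx_inj : injective idx.
Hypothesis p_ge0 : forall n o, (o < s n)%N -> 0 <= p n o.
Hypothesis p_sum : forall n, \sum_(o < s n) p n o = 1.

Local Notation Ex f := (Er s (fun n o => (p n o)%:C%C) m 0 f (fun=> 0%N)).

(* Bit value [0] means inactive; [k.+1] means active with pattern [k]. *)
Definition sole (S : {fset G}) c (om : nat -> nat) : bool :=
  (om (idx c) != 0%N) && all (fun d => om (idx d) == 0%N) (S `\ c)%fset.

Lemma prod_bool (K : pzSemiRingType) I (r : seq I) (b : pred I) :
  \prod_(i <- r) (b i)%:R = (all b r)%:R :> K.
Proof.
by elim: r => [|i r ih]; rewrite ?big_nil ?big_cons//= ih -natrM mulnb.
Qed.

Lemma sole_notin S c d om : d \in S -> d != c -> sole S c om -> om (idx d) = 0%N.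
Proof.
move=> dS dc /andP[_ /allP/(_ d)]; rewrite !inE dc => /(_ dS).
by move/eqP.
Qed.

Lemma Ex_sole (S : {fset G}) c (psi : nat -> R[i]) : c \in S ->
  (forall d, d \in S -> (idx d < m)%N) -> (forall d, d \in S -> (0 < s (idx d))%N) ->
  Ex (fun om => (sole S c om)%:R * psi (om (idx c))) =
  (\sum_(o < s (idx c)) (p (idx c) o)%:C%C * ((o != 0%N :> nat)%:R * psi o)) *
  \prod_(d <- (S `\ c)%fset) (p (idx d) 0%N)%:C%C.
Proof.
move=> cS Sm Ss; pose phi n o : R[i] := if n == idx c then (o != 0%N)%:R * psi o else (o == 0%N)%:R.
have phiD d o : d \in (S `\ c)%fset -> phi (idx d) o = (o == 0%N)%:R.
  by rewrite !inE /phi (inj_eq idx_inj) => /andP[/negbTE ->].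
rewrite (@eq_Er _ _ _ _ _ _ (fun om => \prod_(n <- map idx S) phi n (om n))) => [|om]; last first.
  rewrite big_map (big_fsetD1 c)//= {1}/phi eqxx mulrAC; congr (_ * _).
  rewrite /sole -mulnb natrM; congr (_ * _).
  by rewrite -prod_bool; apply: eq_big_seq => d /phiD <-.
rewrite Er_prod_seq; last 3 first.
- exact: sum_complex_law.
- by rewrite map_inj_uniq// fset_uniq.
- by move=> _ /mapP[d dS ->]; exact: Sm.
rewrite big_map (big_fsetD1 c)//= /phi eqxx; congr (_ * _).
apply: eq_big_seq => d dS; have := dS; rewrite !inE => /andP[dc dS'].
have := Ss d dS'; case E : (s (idx d)) => [//|k] _; rewrite big_ord_recl.
rewrite (inj_eq idx_inj) (negbTE dc)/= mulr1 big1 ?addr0// => o _.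
by rewrite mulr0.
Qed.

Section Stage.
Variables (A : {fset G}) (K : nat) (z : nat -> G -> R[i]) (q : R).
Hypothesis z_le1 : forall k a, `|z k a| <= 1.
Hypothesis q01 : 0 <= q <= 1.

(** These are the sites [c] with [g] in [A * c]: a copy of pattern [k] based at [c = a^-1 * g]
    prescribes the value [z k a] at [g]. *)
Definition window g : {fset G} := [fset (a^-1 * g)%g | a in A]%fset.

(** At most one term is nonzero, that of the only active site of the window; with no active site or
    several the value is 0. The predecessor undoes the shift in the numbering of patterns. *)
Definition sampled g om : R[i] :=
  \sum_(a <- A) (sole (window g) (a^-1 * g)%g om)%:R * z (om (idx (a^-1 * g)%g)).-1 a.

Lemma mem_window g a : a \in A -> (a^-1 * g)%g \in window g.
Proof. by move=> aA; apply/imfsetP; exists a. Qed.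

Lemma card_window g : #|` window g| = #|` A|.
Proof. by apply: card_imfset => a b /= /mulIg /invg_inj. Qed.

Lemma sampled_sole g a om : a \in A -> sole (window g) (a^-1 * g)%g om ->
  sampled g om = z (om (idx (a^-1 * g)%g)).-1 a.
Proof.
move=> aA sa; rewrite /sampled (big_fsetD1 a)//= sa mul1r big_seq big1 ?addr0// => b.
rewrite !inE => /andP[ba bA]; rewrite /sole (sole_notin _ _ sa) ?mul0r ?mem_window//.
by apply: contra ba => /eqP/mulIg/invg_inj ->.
Qed.

Lemma norm_sampled g om : `|sampled g om| <= 1.
Proof.
have [/hasP[a aA sa]|/hasPn h] := boolP (has (fun a => sole (window g) (a^-1 * g)%g om) A).
  by rewrite (sampled_sole aA sa).
rewrite /sampled big_seq big1 ?normr0// => a aA.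
by rewrite (negbTE (h a aA)) mul0r.
Qed.

Definition stage_law c := s (idx c) = K.+1 /\
  forall o, p (idx c) o = if o == 0%N then 1 - q else q / K%:R.

Lemma Ex_stage_sole (S : {fset G}) c (psi : nat -> R[i]) : c \in S ->
  (forall d, d \in S -> (idx d < m)%N) -> (forall d, d \in S -> stage_law d) ->
  Ex (fun om => (sole S c om)%:R * psi (om (idx c)).-1) =
  (q / K%:R * (1 - q) ^+ #|` S|.-1)%:C%C * \sum_(k < K) psi k.
Proof.
move=> cS Sm Sl; rewrite (@Ex_sole S c (fun o => psi o.-1))//; last by move=> d /Sl[->].
have [-> pc] := Sl c cS; rewrite big_ord_recl/= mul0r mulr0 add0r.
under eq_bigr do rewrite pc /= mul1r.
have -> : \prod_(d <- (S `\ c)%fset) (p (idx d) 0%N)%:C%C = ((1 - q) ^+ #|` S|.-1)%:C%C.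
  rewrite (cardfsD1 c S) cS/= (eq_big_seq (fun=> (1 - q)%:C%C)) => [|d]; last first.
    by rewrite !inE => /andP[_ /Sl[_ ->]].
  by rewrite big_const_seq count_predT iter_mulr_1 rmorphXn.
by rewrite -mulr_sumr mulrAC [in RHS]rmorphM.
Qed.

Lemma Ex_sampled g : A != fset0 -> (forall d, d \in window g -> (idx d < m)%N) ->
  (forall d, d \in window g -> stage_law d) ->
  Ex (sampled g) = (q * #|` A|%:R * (1 - q) ^+ #|` A|.-1)%:C%C *
    ((K%:R * #|` A|%:R)^-1 * \sum_(k < K) \sum_(a <- A) z k a).
Proof.
move=> A0 gm gl; rewrite /sampled Er_sum.
under eq_big_seq => a aA do
  rewrite (@Ex_stage_sole _ _ (fun k => z k a) (mem_window g aA) gm gl) card_window.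
rewrite -mulr_sumr exchange_big /= mulrA; congr (_ * _).
have {}A0 : #|` A|%:R != 0 :> R by rewrite pnatr_eq0 cardfs_eq0.
rewrite natC natC -rmorphM -fmorphV -rmorphM; congr (_%:C%C).
by rewrite [RHS]mulrAC [K%:R * _]mulrC invfM mulrA -[q * _ / _]mulrA divff// mulr1 mulrAC.
Qed.

Lemma Ex_active c : (0 < K)%N -> (idx c < m)%N -> stage_law c ->
  Ex (fun om => (om (idx c) != 0%N)%:R) = q%:C%C.
Proof.
move=> K0 cm cl; have := @Ex_stage_sole [fset c]%fset c (fun=> 1) (fset11 c).
rewrite cardfs1 expr0 mulr1 sumr_const card_ord natC -rmorphM divfK ?pnatr_eq0 -?lt0n// => <-.
- apply: eq_Er => om; rewrite mulr1 /sole; have -> : ([fset c] `\ c = fset0)%fset.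
    by apply/fsetP => x; rewrite !inE andNb.
  by rewrite andbT.
- by move=> d; rewrite inE => /eqP ->.
- by move=> d; rewrite inE => /eqP ->.
Qed.

(* Besides the diagonal terms, a term can only survive when [a^-1 * g] lies outside
   [window (h * g)], i.e. when [h * a] lies outside [A]. *)
Lemma Ex_sampled_corr (Q : {fset G}) h g : (0 < K)%N -> h \in Q ->
  (forall d, d \in (window (h * g) `|` window g)%fset -> (idx d < m)%N) ->
  (forall d, d \in (window (h * g) `|` window g)%fset -> stage_law d) ->
  `|Ex (fun om => sampled (h * g) om * (sampled g om)^*)| <=
  q%:C%C * (`|K%:R^-1 * \sum_(k < K) \sum_(a <- A) z k (h * a)%g * (z k a)^*| +
    2 * #|` (A `\` inner Q A)%fset|%:R).
Proof.
set S := (_ `|` _)%fset => K0 hQ Sm Sl.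
have gS a : a \in A -> (a^-1 * g)%g \in S by move=> aA; rewrite inE mem_window ?orbT.
(* The second factor is split according to its sole active site [a^-1 * g]. *)
pose f a om := sampled (h * g) om *
   ((sole (window g) (a^-1 * g)%g om)%:R * (z (om (idx (a^-1 * g)%g)).-1 a)^*).
have fE om : sampled (h * g) om * (sampled g om)^* = \sum_(a <- A) f a om.
  rewrite /f -mulr_sumr {2}/sampled rmorph_sum; congr (_ * _); apply: eq_bigr => a _.
  by rewrite [LHS]rmorphM; congr (_ * _); exact: conjc_nat.
have innerA a : a \in inner Q A -> a \in A /\ (h * a)%g \in A.
  by move=> /innerP[aA /(_ h hQ)].
(* When [h * a] lies in [A], the site [a^-1 * g] belongs to both windows. The product survives only
   if it is the sole active site of their union, and then both values come from the same copy. *)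
have diag a om : a \in inner Q A ->
  f a om = (sole S (a^-1 * g)%g om)%:R *
    (z (om (idx (a^-1 * g)%g)).-1 (h * a)%g * (z (om (idx (a^-1 * g)%g)).-1 a)^*).
  move=> /innerA[aA haA].
  have ce : (a^-1 * g = (h * a)^-1 * (h * g))%g by rewrite invgM -mulgA mulKg.
  have SE : sole S (a^-1 * g)%g om =
      sole (window (h * g)) (a^-1 * g)%g om && sole (window g) (a^-1 * g)%g om.
    rewrite /sole; case: (om _ != 0%N) => //=; rewrite fsetDUl.
    apply/allP/andP => [h0|[/allP h1 /allP h2] d]; last by rewrite inE => /orP[/h1|/h2].
    by split; apply/allP => d dd; apply: h0; rewrite inE dd ?orbT.
  rewrite /f SE; case s1 : (sole (window g) _ om); last by rewrite andbF mul0r mulr0 mul0r.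
  case s2 : (sole (window (h * g)) _ om); last first.
    rewrite mul0r; have -> : sampled (h * g) om = 0; last by rewrite mul0r.
    rewrite /sampled big_seq big1// => b bA.
    have [sb|] := boolP (sole _ _ _); last by rewrite mul0r.
    have [e|bc] := eqVneq (a^-1 * g)%g (b^-1 * (h * g))%g; first by rewrite -e s2 in sb.
    have := sole_notin _ bc sb; rewrite {1}ce mem_window// => /(_ isT).
    by move/andP: s1 => [/eqP].
  by rewrite (@sampled_sole (h * g)%g (h * a)%g) -?ce// !mul1r.
have off a om : `|f a om| <= (om (idx (a^-1 * g)%g) != 0%N)%:R.
  rewrite /f normrM (le_trans (ler_wpM2r _ (norm_sampled _ _)))// mul1r.
  rewrite normrM norm_conjC (le_trans (ler_wpM2l _ (z_le1 _ _)))// mulr1 normr_nat ler_nat.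
  by rewrite /sole; case: (om _ != 0%N); rewrite ?leq_b1.
have q0 : 0 <= q%:C%C :> R[i] by rewrite ler0c; case/andP: q01.
pose r : R := (1 - q) ^+ #|` S|.-1.
have r01 : 0 <= (r%:C%C : R[i]) <= 1.
  rewrite ler0c lecR; case/andP: q01 => q00 q1.
  by rewrite exprn_ge0 ?exprn_ile1 ?subr_ge0// lerBlDr lerDl.
have Z k a : `|z k (h * a)%g * (z k a)^*| <= 1.
  by rewrite normrM norm_conjC mulr_ile1.
under eq_Er do rewrite fE.
rewrite Er_sum (big_fsetID _ (mem (inner Q A)))/=.
have -> : [fset x in A | x \in inner Q A]%fset = inner Q A.
  by apply/fsetP => a; rewrite !inE; case: (a \in A).
have -> : [fset x in A | x \notin inner Q A]%fset = (A `\` inner Q A)%fset.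
  by apply/fsetP => a; rewrite !inE andbC.
have offE : \sum_(a <- (A `\` inner Q A)%fset) q%:C%C =
    q%:C%C * #|` (A `\` inner Q A)%fset|%:R :> R[i].
  by rewrite big_const_seq count_predT iter_addr_0 mulr_natr.
(* One boundary term bounds the indices outside [inner Q A]; the other pays for extending the
   diagonal sum from [inner Q A] to [A]. *)
rewrite (le_trans (ler_normD _ _))// mulr2n !mulrDl !mul1r addrA mulrDr lerD//; last first.
  rewrite -offE (le_trans (ler_norm_sum _ _ _))// big_seq [leRHS]big_seq; apply: ler_sum => a.
  rewrite inE => /andP[_ aA]; rewrite -(Ex_active K0 (Sm _ (gS a aA)) (Sl _ (gS a aA))).
  by apply: ler_norm_Er => // n o on; rewrite ler0c p_ge0.
have -> : \sum_(a <- inner Q A) Ex (f a) = r%:C%C * (q%:C%C *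
    (K%:R^-1 * \sum_(k < K) \sum_(a <- A) z k (h * a)%g * (z k a)^* -
     K%:R^-1 * \sum_(k < K) \sum_(a <- (A `\` inner Q A)%fset) z k (h * a)%g * (z k a)^*)).
  transitivity (\sum_(a <- inner Q A) (q / K%:R * r)%:C%C *
      \sum_(k < K) z k (h * a)%g * (z k a)^*).
    apply: eq_big_seq => a aI; rewrite (eq_Er _ _ _ _ _ (diag a^~ aI)).
    by rewrite (Ex_stage_sole (fun k => z k (h * a)%g * (z k a)^*)) ?gS//; case/innerA: aI.
  rewrite -mulr_sumr -mulrBr -sumrB natCV.
  have -> : (q / K%:R * r)%:C%C = r%:C%C * (q%:C%C * K%:R^-1%:C%C) :> R[i].
    by rewrite mulrC -!rmorphM.
  rewrite -!mulrA exchange_big/=; congr (_ * (_ * (_ * _))); apply: eq_bigr => k _.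
  rewrite [X in _ = X - _](big_fsetID _ (mem (inner Q A)))/=.
  have -> : [fset x in A | x \in inner Q A]%fset = inner Q A.
    by apply/fsetP => a; rewrite !inE; case: (a \in A).
  have -> : [fset x in A | x \notin inner Q A]%fset = (A `\` inner Q A)%fset.
    by apply/fsetP => a; rewrite !inE andbC.
  by rewrite addrK.
rewrite normrM ger0_norm; last by case/andP: r01.
rewrite (le_trans (ler_piMl _ _))//; first by case/andP: r01.
rewrite normrM ger0_norm// ler_wpM2l// (le_trans (ler_normB _ _))// lerD//.
rewrite normrM ger0_norm// mulrC ler_pdivrMr ?ltr0n// (le_trans (ler_norm_sum _ _ _))//.
apply: (@le_trans _ _ (\sum_(k < K) #|` (A `\` inner Q A)%fset|%:R)); last first.
  by rewrite sumr_const card_ord mulr_natr.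
apply: ler_sum => k _; rewrite (le_trans (ler_norm_sum _ _ _))//.
apply: (@le_trans _ _ (\sum_(a <- (A `\` inner Q A)%fset) 1)); first exact: ler_sum.
by rewrite big_const_seq count_predT iter_addr_0.
Qed.

Lemma sampled_depends g om om' :
  (forall a, a \in A -> om (idx (a^-1 * g)%g) = om' (idx (a^-1 * g)%g)) ->
  sampled g om = sampled g om'.
Proof.
move=> e; apply: eq_big_seq => a aA; rewrite /sole e//; congr ((_ && _)%:R * _).
by apply: eq_in_all => d; rewrite inE => /andP[_ /imfsetP[b bA ->]]; rewrite e.
Qed.

End Stage.
End SoleActiveSite.

Lemma average_cvg0_lt (R : realType) (G : groupType) (F : nat -> {fset G}) (z : G -> R[i]) :
  average_cvg F z 0 -> forall e : R, 0 < e ->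
  \forall N \near \oo, `|average (F N) z| < e%:C%C.
Proof.
move=> /average_cvgP[/= /cvgrPdist_lt h1 /cvgrPdist_lt h2] e e0.
have e2 : 0 < e / 2 by lra.
have := h2 _ e2; have := h1 _ e2; apply: filterS2 => N.
rewrite !sub0r !normrN => i1 i2.
by apply: normC_lt_parts; rewrite ?Re_average ?Im_average.
Qed.

Definition finitary_at (R : realType) (G : groupType) (H : set G) (eps : R) : Prop :=
  exists2 delta : R, 0 < delta &
  exists A H0 : {fset G},
    [/\ A != fset0,
        [set` H0] `<=` H &
        forall (K : nat) (z : 'I_K -> G -> R[i]), (0 < K)%N ->
          (forall k a, `|z k a| <= 1) ->
          (forall h, h \in H0 ->
             `|(K%:R * #|` A|%:R)^-1 *
               \sum_(k < K) \sum_(a <- A) z k (h * a)%g * (z k a)^*| < delta%:C%C) ->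
          `|(K%:R * #|` A|%:R)^-1 * \sum_(k < K) \sum_(a <- A) z k a| < eps%:C%C].

Section Finitary.
Variables (R : realType) (G : groupType) (F : nat -> {fset G}) (H : set G).
Hypothesis G_countable : countable [set: G].
Hypothesis G_infinite : infinite_set [set: G].
Hypothesis F_folner : folner R F.

(** A failure at tolerance [1 / s.+1], on a set [A] that is also almost invariant under [Q s].
    Patterns are numbered by [nat], and [K.+1] keeps their number positive. *)
Definition counterexample (eps : R) (Q : nat -> {fset G}) s
    (D : {fset G} * nat * (nat -> G -> R[i])) : Prop :=
  let: (A, K, z) := D in
  [/\ A != fset0, (s.+1 * #|` (A `\` inner (Q s) A)%fset| <= #|` A|)%N,
      forall k a, `|z k a| <= 1,
      forall h, H h -> h \in Q s ->
        `|(K.+1%:R * #|` A|%:R)^-1 *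
          \sum_(k < K.+1) \sum_(a <- A) z k (h * a)%g * (z k a)^*| < (s.+1%:R^-1)%:C%C &
      eps%:C%C <= `|(K.+1%:R * #|` A|%:R)^-1 * \sum_(k < K.+1) \sum_(a <- A) z k a|].

(** The negated condition fails for every candidate [A], in particular for a Følner set almost
    invariant under [Q s]. *)
Lemma not_finitary (eps : R) (Q : nat -> {fset G}) : 0 < eps ->
  ~ finitary_at H eps ->
  exists D, forall s, counterexample eps Q s (D s).
Proof.
move=> eps0 nex; suff /choice[D DP] : forall s, exists D, counterexample eps Q s D by exists D.
move=> s; apply: contrapT => nD; apply: nex.
exists (s.+1%:R^-1); first by rewrite invr_gt0.
have [N FN] := filter_ex (folner_inner F_folner (Q s) s.+1).
exists (F N), [fset h in Q s | `[< H h >]]%fset; split => [||K z K0 z1 zc].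
- by case: F_folner.
- by move=> h /=; rewrite !inE => /andP[_ /asboolP].
case: K K0 z z1 zc => [//|K _] z z1 zc.
have sumE (u : (G -> R[i]) -> G -> R[i]) :
    \sum_(k < K.+1) \sum_(a <- F N) u (z k) a = \sum_(k < K.+1) \sum_(a <- F N) u (z (inord k)) a.
  by apply: eq_bigr => k _; rewrite inord_val.
rewrite real_ltNge ?normr_real//; last by rewrite ger0_real// ler0c ltW.
apply/negP => eps_le; apply: nD; exists (F N, K, fun k => z (inord k)); split => //.
- by case: F_folner.
- move=> h Hh hQ; rewrite -(sumE (fun z a => z (h * a)%g * (z a)^*)) zc//.
  by rewrite !inE hQ; apply/asboolP.
- by rewrite -(sumE (fun z a => z a)).
Qed.

Lemma disk_finitary :
  (forall z : G -> R[i], (forall g, `|z g| <= 1) ->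
    (forall h, H h -> average_cvg F (fun g => z (h * g)%g * (z g)^*) 0) ->
    average_cvg F z 0) ->
  forall eps : R, 0 < eps -> finitary_at H eps.
Proof.
move=> diskH eps e0; apply: contrapT.
have [site [idx [siteK idxK]]] := countable_enum G_countable G_infinite.
pose dec i : G := if (choice.unpickle i : option (nat * bool * bool)%type) is Some (n, _, _)
  then site n else 1%g.
move=> /(@not_finitary eps (shifts site) e0)[D DP].
pose A s := (D s).1.1; pose K s := (D s).1.2.+1; pose zs s := (D s).2.
have A0 s : A s != fset0.
  by have := DP s; rewrite /A; case: (D s) => [[? ?] ?] [].
have Ainner s : (s.+1 * #|` (A s `\` inner (shifts site s) (A s))%fset| <= #|` A s|)%N.
  by have := DP s; rewrite /A; case: (D s) => [[? ?] ?] [].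
have zs1 s k a : `|zs s k a| <= 1.
  by have := DP s; rewrite /zs; case: (D s) => [[? ?] ?] [].
have zs_corr s h : H h -> h \in shifts site s ->
    `|((K s)%:R * #|` A s|%:R)^-1 *
       \sum_(k < K s) \sum_(a <- A s) zs s k (h * a)%g * (zs s k a)^*| < (s.+1%:R^-1)%:C%C.
  by have := DP s; rewrite /zs /K /A; case: (D s) => [[? ?] ?] [] _ _ _ h1 _; exact: h1.
have zs_mean s : eps%:C%C <= `|((K s)%:R * #|` A s|%:R)^-1 *
    \sum_(k < K s) \sum_(a <- A s) zs s k a|.
  by have := DP s; rewrite /zs /K /A; case: (D s) => [[? ?] ?] [].
(* A correlation test reads the values at [g] and [b * g], which depend on the sites [a^-1 * g] and
   [a^-1 * b * g]. *)
have [B [Bm XB]] := increasing_hull (fun j =>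
  (shifts dec j `|` fprod (finv (A (j %/ 3)%N)) (shifts dec j))%fset).
have shB j b : b \in shifts dec j -> b \in B j.
  by move=> bj; apply: (fsubsetP (XB j)); rewrite inE bj.
have ABs j a b : a \in A (j %/ 3)%N -> b \in shifts dec j -> (a^-1 * b)%g \in B j.
  move=> aA bj; apply: (fsubsetP (XB j)); rewrite inE mem_fprod ?orbT//.
  by rewrite mem_finv invgK.
have AB j a : a \in A (j %/ 3)%N -> (a^-1)%g \in B j.
  by move=> aA; rewrite -[(a^-1)%g]mulg1 ABs// shifts1.
have [lev [lev_fin slow conc der]] := derandomization F_folner G_countable G_infinite siteK idxK
  (fun j => shB j _ (shifts1 dec j)) Bm.
pose sg g := (lev g %/ 3)%N.
(* On average half a site of a window is active; by Bernoulli's inequality exactly one is active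
   with probability at least [1 / 4], the factor in [E_mean]. *)
pose q s : R := (2 * #|` A s|%:R)^-1.
have cardA s : (0 < #|` A s|)%N by rewrite cardfs_gt0.
have q01 s : 0 <= q s <= 1.
  have A1 : 1 <= #|` A s|%:R :> R by rewrite ler1n cardA.
  by rewrite /q invr_ge0 mulr_ge0//= invf_le1; lra.
pose s n := (K (sg (site n))).+1.
pose p n o : R := if o == 0%N then 1 - q (sg (site n)) else q (sg (site n)) / (K (sg (site n)))%:R.
(* Only middle levels of blocks carry values: all sites read then follow the law of the same stage,
   and two such points related by a tested shift have equal levels. *)
pose Z g om : R[i] := if (lev g %% 3 == 1)%N then sampled idx (A (sg g)) (zs (sg g)) g om else 0.
pose v (i : nat * bool) g om : R[i] :=
  if i.2 then Z (site i.1 * g)%g om * (Z g om)^* else Z g om.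
pose w i g om : R := if (choice.unpickle i : option (nat * bool * bool)%type) is Some (q, re) then
   if re then complex.Re (v q g om) else complex.Im (v q g om) else 0.
pose m g : nat := (\max_(b <- B (lev g)) (idx (b * g)%g).+1)%N.
have Z1 g om : `|Z g om| <= 1.
  by rewrite /Z; case: ifP => _; rewrite ?normr0// norm_sampled.
have v1 i g om : `|v i g om| <= 1.
  by rewrite /v; case: i.2 => //; rewrite normrM norm_conjC mulr_ile1.
have mB g b : b \in B (lev g) -> (idx (b * g)%g < m g)%N.
  by move=> bB; rewrite /m; apply: (@leq_bigmax_seq _ _ _ (fun b => (idx (b * g)%g).+1)).
have p0 n o : (o < s n)%N -> 0 <= p n o.
  move=> _; rewrite /p; have /andP[q0 q1] := q01 (sg (site n)).
  by case: ifP; rewrite ?subr_ge0 ?divr_ge0.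
have p1 n : \sum_(o < s n) p n o = 1.
  rewrite big_ord_recl/= /p/= sumr_const card_ord -[_ *+ _]mulr_natr divfK ?subrK//.
  by rewrite pnatr_eq0.
have Zdep g om om' : (forall a, a \in A (sg g) -> om (idx (a^-1 * g)%g) = om' (idx (a^-1 * g)%g)) ->
    Z g om = Z g om'.
  by move=> e; rewrite /Z; case: ifP => // _; exact: sampled_depends.
have lev_same h g : h \in B (lev g) -> (lev g %% 3 == 1)%N -> (lev (h * g)%g %% 3 == 1)%N ->
    lev (h * g)%g = lev g.
  by move=> /slow[]; lia.
have [||//|om [om_lt omP]] := der s p w m p0 p1.
- move=> i g om; rewrite /w; case: (choice.unpickle i) => [[i' []]|].
  + exact: normC1_Re. + exact: normC1_Im. + by rewrite normr0.
- move=> i g ig om om' e.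
  have eB b : b \in B (lev g) -> om (idx (b * g)%g) = om' (idx (b * g)%g).
    by move=> bB; apply: e; apply/hasP; exists b.
  have e1 : Z g om = Z g om' by apply: Zdep => a aA; rewrite eB ?AB.
  have e2 : Z (dec i * g)%g om * (Z g om)^* = Z (dec i * g)%g om' * (Z g om')^*.
    have [l1|l1] := boolP (lev g %% 3 == 1)%N; last by rewrite {2 4}/Z (negbTE l1) [0^*]rmorph0 !mulr0.
    have [l2|l2] := boolP (lev (dec i * g)%g %% 3 == 1)%N; last by rewrite {1 3}/Z (negbTE l2) !mul0r.
    have di : dec i \in shifts dec (lev g) by exact: mem_shifts.
    rewrite e1 (@Zdep (dec i * g)%g om om')// => a.
    by rewrite /sg (lev_same _ _ (shB _ _ di) l1 l2) => aA; rewrite mulgA eB// ABs.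
  rewrite /w /v; move: e2; rewrite /dec; case: (choice.unpickle i) => // -[[n []] re] /= e2.
    by rewrite e2.
  by rewrite e1.
pose E i g : R[i] := Er s (fun n o => (p n o)%:C%C) (m g) 0 (v i g) (fun=> 0%N).
have vE i : average_cvg F (fun g => v i g om) 0 <-> average_cvg F (E i) 0.
  apply: Re_mean_zero.
    have := omP (choice.pickle (i, true)); apply: eq_cvgn => N; apply: eq_ravg => g _.
    by rewrite /w choice.pickleK /E Re_Er.
  have := omP (choice.pickle (i, false)); apply: eq_cvgn => N; apply: eq_ravg => g _.
  by rewrite /w choice.pickleK /E Im_Er.
have pC : forall n, \sum_(o < s n) (p n o)%:C%C = 1 :> R[i] by exact: sum_complex_law.
have E1 i g : `|E i g| <= 1.
  apply: (@le_trans _ _ (Er s (fun n o => (p n o)%:C%C) (m g) 0 (fun=> 1) (fun=> 0%N))); last by rewrite Er_cst.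
  apply: ler_norm_Er => [n o on|om'].
    by rewrite ler0c p0.
  exact: v1.
have idx_inj := can_inj idxK.
have law g a : (lev g %% 3 == 1)%N -> a \in A (sg g) ->
    stage_law idx s p (K (sg g)) (q (sg g)) (a^-1 * g)%g.
  move=> l1 aA; have [b1 b2] := slow g _ (AB _ _ aA).
  have e : sg (a^-1 * g)%g = sg g by exact: divn3_middle l1 b1 b2.
  by rewrite /stage_law /s /p idxK e.
have qA st : q st * #|` A st|%:R = 2^-1.
  by rewrite /q invfM -mulrA mulVf ?mulr1// pnatr_eq0 -lt0n.
have idx_window g a : a \in A (sg g) -> (idx (a^-1 * g)%g < m g)%N.
  by move=> aA; rewrite mB ?AB.
have E_val n g : (lev g %% 3 == 1)%N -> E (n, false) g =
    (q (sg g) * #|` A (sg g)|%:R * (1 - q (sg g)) ^+ #|` A (sg g)|.-1)%:C%C *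
    (((K (sg g))%:R * #|` A (sg g)|%:R)^-1 *
      \sum_(k < K (sg g)) \sum_(a <- A (sg g)) zs (sg g) k a).
  move=> l1; rewrite /E /v /= (@eq_Er _ _ _ _ _ _ (sampled idx (A (sg g)) (zs (sg g)) g)) => [|om']; last first.
    by rewrite /Z l1.
  apply: Ex_sampled => //.
  - by move=> _ /imfsetP[a aA ->]; exact: idx_window.
  - by move=> _ /imfsetP[a aA ->]; exact: law.
have E_mean n g : (lev g %% 3 == 1)%N -> (eps / 4)%:C%C <= `|E (n, false) g|.
  move=> l1; rewrite E_val//.
  have -> : (eps / 4)%:C%C = eps%:C%C * (4^-1)%:C%C :> R[i] by exact: rmorphM.
  rewrite normrM qA [leRHS]mulrC; apply: ler_pM => //; rewrite ?ler0c ?(ltW e0) ?invr_ge0//.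
  have /andP[q0 q1] := q01 (sg g).
  rewrite ger0_norm ?ler0c ?mulr_ge0 ?exprn_ge0 ?subr_ge0// lecR.
  have := bernoulli_ge #|` A (sg g)|.-1 (q01 (sg g)).
  have : (#|` A (sg g)|.-1)%:R * q (sg g) <= 2^-1.
    by rewrite -(qA (sg g)) mulrC ler_wpM2l// ler_nat leq_pred.
  lra.
have E_corr h : H h -> average_cvg F (E (idx h, true)) 0.
  move=> Hh; apply: average_c0 => //; first by exists 1 => g; exact: E1.
  move=> e e1; have [M eM] : exists M : nat, 2 / e <= M%:R.
    by eexists; apply/ltW/archi_boundP; rewrite divr_ge0// ltW.
  (* Beyond the first bound [h] belongs to the windows. Beyond the second the stage is at least
     [idx h + M], so [h] is a shift controlled by the counterexample of that stage, with tolerance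
     at most [e / 2]. *)
  have [E' E'P] := lev_fin (maxn (choice.pickle (idx h, true, true)) (3 * (idx h + M))).
  exists E' => g gE'; have {gE' E'P} : ~~ (lev g <= maxn (choice.pickle (idx h, true, true)) (3 * (idx h + M)))%N.
    by apply: contra gE'; exact: E'P.
  rewrite -ltnNge gtn_max => /andP[l1 l2].
  have hd : h \in shifts dec (lev g).
    by have := mem_shifts dec (ltnW l1); rewrite /dec choice.pickleK idxK.
  have [g1|g1] := boolP ((lev g %% 3 == 1)%N && (lev (h * g)%g %% 3 == 1)%N); last first.
    rewrite /E (@eq_Er _ _ _ _ _ _ (fun=> 0)) ?Er_cst// ?normr0 ?ler0c ?ltW// => om'.
    rewrite /v /= idxK /Z; move: g1; case: (lev g %% 3 == 1)%N => /=; last by rewrite [0^*]rmorph0 mulr0.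
    by move/negbTE ->; rewrite mul0r.
  have /andP[{}g1 g2] := g1; have lh := lev_same _ _ (shB _ _ hd) g1 g2.
  have sgh : sg (h * g)%g = sg g by rewrite /sg lh.
  have sgM : (idx h + M <= sg g)%N by rewrite /sg leq_divRL// mulnC ltnW.
  have hs : h \in shifts site (sg g).
    by rewrite -[h]idxK mem_shifts// (leq_trans _ sgM)// leq_addr.
  rewrite /E (@eq_Er _ _ _ _ _ _ (fun om' => sampled idx (A (sg g)) (zs (sg g)) (h * g) om' *
     (sampled idx (A (sg g)) (zs (sg g)) g om')^*)) => [|om']; last first.
    by rewrite /v /= idxK /Z g1 g2 sgh.
  rewrite (le_trans (@Ex_sampled_corr _ _ _ _ _ _ idx_inj p0 p1 _ (K (sg g)) _ (q (sg g)) _ _ _ _ _ _ hs _ _))//.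
  - move=> d; rewrite inE => /orP[]/imfsetP[a aA ->]; last exact: idx_window.
    by rewrite mulgA mB// ABs.
  - move=> d; rewrite inE => /orP[]/imfsetP[a aA ->]; last exact: law.
    by rewrite -sgh; apply: law; rewrite ?sgh.
  have /(zs_corr _ _ Hh) := hs; set S := (\sum_(k < _) _) => Sh.
  set n := #|` A (sg g)|; set d : R := ((sg g).+1)%:R^-1.
  have n0 : n%:R != 0 :> R[i] by rewrite pnatr_eq0 -lt0n cardA.
  have -> : (K (sg g))%:R^-1 * S = n%:R * (((K (sg g))%:R * n%:R)^-1 * S).
    by rewrite invfM [RHS]mulrA [n%:R * (_ * _)]mulrCA divff// mulr1.
  have out : #|` (A (sg g) `\` inner (shifts site (sg g)) (A (sg g)))%fset|%:R <= n%:R * d.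
    by rewrite /d ler_pdivlMr ?ltr0n// mulrC -natrM ler_nat Ainner.
  apply: (@le_trans _ _ ((q (sg g))%:C%C * ((n%:R * d)%:C%C + (2 * (n%:R * d))%:C%C))).
    rewrite ler_wpM2l ?ler0c//; first by case/andP: (q01 (sg g)).
    apply: lerD.
      by rewrite normrM normr_nat rmorphM rmorph_nat; apply: ler_wpM2l => //; exact: ltW.
    by rewrite -natrM natC lecR natrM ler_wpM2l.
  rewrite -rmorphD -rmorphM lecR.
  have -> : q (sg g) * (n%:R * d + 2 * (n%:R * d)) = 3 / 2 * d.
    by rewrite -[RHS]mulrA -(qA (sg g)) -/n; ring.
  have d0 : 0 <= d by rewrite invr_ge0.
  have : 2 * d <= e; last by lra.
  rewrite /d ler_pdivrMr ?ltr0n//; move: eM; rewrite ler_pdivrMr// => eM.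
  rewrite (le_trans eM)// mulrC ler_pM2l// ler_nat.
  by apply: leqW; exact: leq_trans (leq_addl _ _) sgM.
have Zcvg : average_cvg F (Z^~ om) 0.
  apply: diskH => [g|h Hh]; first exact: Z1.
  have /vE := E_corr h Hh; congr (average_cvg F _ 0).
  by apply/funext => g; rewrite /v /= idxK.
have /vE/average_cvg0_lt Ecvg : average_cvg F (fun g => v (0%N, false) g om) 0 by [].
have e8 : 0 < eps / 8 by rewrite divr_gt0.
have [M eM] : exists M : nat, 16 / eps <= M%:R.
  by eexists; apply/ltW/archi_boundP; rewrite divr_ge0// ltW.
have [N0 _ N0P] := Ecvg _ e8.
(* The next level is the middle of a block and contains all but a small part of [F N]. There the
   expectation is constant of modulus at least [eps / 4], whereas its average is below [eps / 8] and
   the exceptional points, costing 2 each, change it by at most [eps / 8]. *)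
have [N jN bad] := conc (3 * (N0 + M).+1)%N.
have /N0P small : (N0 <= N)%N by apply: leq_trans jN; lia.
set l := (3 * (N0 + M).+1)%N in jN bad.
have FN0 : (0 < #|` F N|)%N by rewrite cardfs_gt0; case: F_folner.
have [g0 g0F /eqP g0l] : exists2 g0, g0 \in F N & lev g0 == l.+1.
  have [|none] := boolP (has (fun g => lev g == l.+1) (F N)).
    by case/hasP => g0; exists g0.
  move: bad; have -> : [fset g in F N | lev g != l.+1]%fset = F N; last by rewrite /l; nia.
  apply/fsetP => g; rewrite !inE; case gF : (g \in F N) => //=.
  by apply: contra none => gl; apply/hasP; exists g.
have l3 : (l.+1 %% 3 == 1)%N by rewrite /l; lia.
have E_level g : lev g = l.+1 -> E (0%N, false) g = E (0%N, false) g0.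
  by move=> gl; rewrite !E_val ?gl ?g0l// /sg gl g0l.
have := E_mean 0%N g0; rewrite g0l => /(_ l3) Eg0.
have close : `|average (F N) (E (0%N, false)) - E (0%N, false) g0| <= (eps / 8)%:C%C.
  have -> : average (F N) (E (0%N, false)) - E (0%N, false) g0 =
      #|` F N|%:R^-1 * \sum_(g <- F N) (E (0%N, false) g - E (0%N, false) g0).
    rewrite /average sumrB mulrBr; congr (_ - _).
    rewrite big_const_seq count_predT iter_addr_0 -[E _ _ *+ _]mulr_natl mulrA mulVf ?mul1r//.
    by rewrite pnatr_eq0 -lt0n.
  rewrite normrM ger0_norm ?invr_ge0// mulrC ler_pdivrMr ?ltr0n// (le_trans (ler_norm_sum _ _ _))//.
  apply: (@le_trans _ _ (\sum_(g <- F N) (2 * (lev g != l.+1))%:R)).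
    apply: ler_sum => g _; have [gl|_] := eqVneq (lev g) l.+1.
      by rewrite E_level// subrr normr0.
    by rewrite (le_trans (ler_normB _ _))// natrM mulr1 mulr2n; apply: lerD; exact: E1.
  rewrite -natr_sum -big_distrr -card_fset_filter natC [leRHS]mulrC natC -rmorphM lecR.
  move: bad; set b := #|` _|; set f := #|` F N| => bad.
  have Ml : (M%:R : R) <= l.+1%:R by rewrite ler_nat /l; lia.
  have {bad} : l.+1%:R * b%:R <= f%:R :> R by rewrite -natrM ler_nat.
  have : M%:R * b%:R <= l.+1%:R * b%:R :> R by rewrite ler_wpM2r.
  have : 16 * b%:R <= (M%:R * b%:R) * eps.
    by rewrite mulrAC ler_wpM2r//; rewrite ler_pdivrMr in eM.
  move=> h1 h2 h3; have := ler_wpM2r (ltW e0) (le_trans h2 h3).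
  by rewrite natrM; lra.
have := le_lt_trans (ler_normB _ _) (ler_ltD close small).
rewrite addrAC subrr sub0r normrN => /(le_lt_trans Eg0).
by rewrite -rmorphD ltcR; lra.
Qed.

End Finitary.

(** * Consequences of the finitary condition *)

Lemma near_all_seq (T : eqType) (r : seq T) (P : T -> nat -> Prop) :
  (forall x, x \in r -> \forall N \near \oo, P x N) ->
  \forall N \near \oo, forall x, x \in r -> P x N.
Proof.
elim: r => [_|x r ih rP]; first exact: nearW.
have := ih (fun y yr => rP y (mem_behead (s := x :: r) yr)).
have := rP x (mem_head x r); apply: filterS2 => N xN rN y.
by rewrite inE => /predU1P[->//|]; exact: rN.
Qed.

Section Averaging.
Variables (R : realType) (G : groupType) (F : nat -> {fset G}).
Hypothesis F_folner : folner R F.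

Lemma average_cvg0P (z : G -> R[i]) : average_cvg F z 0 <->
  forall e : R, 0 < e -> \forall N \near \oo, `|average (F N) z| < e%:C%C.
Proof.
split=> [|z0]; first exact: average_cvg0_lt.
apply/average_cvgP; split; apply/cvgrPdist_lt => e e0.
  have := z0 e e0; apply: filterS => N /parts_lt_normC[].
  by rewrite Re_average sub0r normrN.
have := z0 e e0; apply: filterS => N /parts_lt_normC[_].
by rewrite Im_average sub0r normrN.
Qed.

Lemma average_cvgD (u v : G -> R[i]) : average_cvg F u 0 -> average_cvg F v 0 ->
  average_cvg F (fun g => u g + v g) 0.
Proof.
rewrite !average_cvgP /= => -[u1 u2] [v1 v2]; split.
  apply: eq_cvgn (cvgn0D u1 v1) => N; rewrite -ravgD; apply: eq_ravg => g _.
  by case: (u g) (v g) => [? ?] [].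
apply: eq_cvgn (cvgn0D u2 v2) => N; rewrite -ravgD; apply: eq_ravg => g _.
by case: (u g) (v g) => [? ?] [].
Qed.

Lemma average_cvg_shift (u : G -> R[i]) a : (forall g, `|u g| <= 1) ->
  average_cvg F (fun g => u (a * g)%g - u g) 0.
Proof.
move=> u1; apply/average_cvgP; split.
  have := @ravg_shift _ _ _ F_folner a _ (fun g => normC1_Re (u1 g)).
  apply: eq_cvgn => N; rewrite -ravgB; apply: eq_ravg => g _.
  by case: (u (a * g)%g) (u g) => [? ?] [].
have := @ravg_shift _ _ _ F_folner a _ (fun g => normC1_Im (u1 g)).
apply: eq_cvgn => N; rewrite -ravgB; apply: eq_ravg => g _.
by case: (u (a * g)%g) (u g) => [? ?] [].
Qed.

Lemma average_cvg_smooth (A : {fset G}) (u : G -> R[i]) : A != fset0 ->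
  (forall g, `|u g| <= 1) ->
  average_cvg F (fun g => average A (fun a => u (a * g)%g) - u g) 0.
Proof.
move=> A0 u1; have sumA : average_cvg F (fun g => \sum_(a <- A) (u (a * g)%g - u g)) 0.
  elim: (A : seq G) => [|a r ih].
    apply/average_cvg0P => e e0; apply: nearW => N.
    have -> : average (F N) (fun g => \sum_(a <- [::]) (u (a * g)%g - u g)) = 0.
      by rewrite /average big1 ?mulr0// => g _; rewrite big_nil.
    by rewrite normr0 (ltcR 0).
  under eq_fun do rewrite big_cons.
  by apply: average_cvgD => //; exact: average_cvg_shift.
have := @average_cvgZ _ _ _ _ (#|` A|%:R^-1) sumA; congr (average_cvg F _ 0).
apply/funext => g; rewrite sumrB mulrBr /average natCV; congr (_ - _).
rewrite big_const_seq count_predT iter_addr_0 -[u g *+ _]mulr_natl mulrA natC -rmorphM.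
by rewrite mulVf ?mul1r// pnatr_eq0 cardfs_eq0.
Qed.

End Averaging.

Lemma finitary_disk (R : realType) (G : groupType) (F : nat -> {fset G}) (H : set G) :
  folner R F ->
  (forall eps : R, 0 < eps -> finitary_at H eps) ->
  forall z : G -> R[i], (forall g, `|z g| <= 1) ->
    (forall h, H h -> average_cvg F (fun g => z (h * g)%g * (z g)^*) 0) ->
    average_cvg F z 0.
Proof.
move=> FF fin z z1 zH; apply/average_cvg0P => e e0; have e2 : 0 < e / 2 by rewrite divr_gt0.
have [delta d0 [A [H0 [A0 H0H P]]]] := fin _ e2.
have avgE (f : G -> G -> R[i]) N : (#|` F N|%:R * #|` A|%:R)^-1 *
     \sum_(k < #|` F N|) \sum_(a <- A) f a (nth 1%g (F N) k) =
   average (F N) (fun g => average A (f^~ g)).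
  rewrite /average invfM -mulrA mulr_sumr [in RHS](big_nth 1%g) big_mkord; congr (_ * _).
have smooth u (u1 : forall g, `|u g| <= 1) := average_cvg_smooth FF A0 u1.
have corr1 h g : `|z (h * g)%g * (z g)^*| <= 1 by rewrite normrM norm_conjC mulr_ile1.
have corr : \forall N \near \oo, forall h, h \in (H0 : seq G) ->
    `|average (F N) (fun g => average A (fun a => z (h * (a * g))%g * (z (a * g)%g)^*))| < delta%:C%C.
  apply: near_all_seq => h hH.
  have := average_cvgD (zH h (H0H h hH)) (smooth _ (corr1 h)) => /average_cvg0P/(_ delta d0).
  apply: filterS => N; congr (`|_| < _); congr (average _ _).
  by apply/funext => g; rewrite addrC subrK.
have := (average_cvg0P _ _).1 (smooth z z1) _ e2; have := corr; apply: filterS2 => N cN sN.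
(* One sequence for each point of [F N]; smoothing over [A] changes averages along [F] by a null
   sequence. *)
have := P _ (fun k a => z (a * nth 1%g (F N) k)%g) (folner_card_gt0 FF N) (fun _ _ => z1 _).
rewrite (avgE (fun a g => z (a * g)%g)) => m1.
have {}m1 := m1 _.
have /m1{}m1 : forall h, h \in H0 -> `|(#|` F N|%:R * #|` A|%:R)^-1 *
    \sum_(k < #|` F N|) \sum_(a <- A) z (h * a * nth 1%g (F N) k)%g * (z (a * nth 1%g (F N) k)%g)^*| < delta%:C%C.
  move=> h /cN; rewrite -(avgE (fun a g => z (h * (a * g))%g * (z (a * g)%g)^*)).
  congr (`|_ * _| < _); apply: eq_bigr => k _; apply: eq_bigr => a _.
  by rewrite mulgA.
have := le_lt_trans (ler_normB _ _) (ltrD m1 sN).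
rewrite -rmorphD -splitr; congr (`|_| < _).
rewrite /average -mulrBr -sumrB; congr (_ * _); apply: eq_bigr => g _.
by rewrite opprB addrC subrK.
Qed.

(** * Empirical averages at finitely many points *)

Section Sampling.
Context d (X : measurableType d) (R : realType) (mu : probability X R).

Lemma ae_exists (P : X -> Prop) : (\forall x \ae mu, P x) -> exists x, P x.
Proof.
move=> [N [mN N0 PN]]; apply: contrapT => nP; have NT : N = setT.
  by apply/seteqP; split => // x _; apply: PN => Px; apply: nP; exists x.
have : mu setT = 1%E by exact: probability_setT.
by rewrite -NT N0 => /eqP; rewrite eq_sym onee_eq0.
Qed.

(** Otherwise [psi] minus its mean would be strictly positive with integral zero. *)
Lemma exists_le_mean (psi : X -> R) (C : R) : measurable_fun setT psi ->
  (forall x, `|psi x| <= C) -> exists x, psi x <= \int[mu]_x psi x.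
Proof.
move=> mpsi psiC; apply: contrapT => no.
have ipsi := integrable_bounded mu mpsi psiC.
pose c : R := \int[mu]_x psi x.
have gt x : 0 < psi x - c.
  by rewrite subr_gt0 ltNge; apply/negP => h; apply: no; exists x.
have icst : mu.-integrable setT (EFin \o cst c).
  exact: (integrable_bounded mu (measurable_cst c) (fun=> lexx `|c|)).
have : \forall x \ae mu, setT x -> (psi x - c)%:E = 0%E.
  apply/ae_eq_integral_abs => //.
    by apply/measurable_EFinP/measurable_funB.
  under eq_integral do rewrite /= ger0_norm ?(ltW (gt _))//.
  have := integrableB measurableT ipsi icst => ib.
  rewrite -[LHS]fineK ?integrable_fin_num//; congr (_%:E).
  rewrite -[LHS]/(\int[mu]_x (psi x - c)) RintegralB// /c -/c.
  by rewrite [X in _ - X](_ : _ = c) ?subrr// /Rintegral integral_cst_prob.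
move=> /ae_exists[x /(_ I)[e]].
by have := gt x; rewrite e ltxx.
Qed.

Lemma Rintegral_lincomb I (r : seq I) (phi : I -> X -> R) (c : I -> R) :
  (forall i, measurable_fun setT (phi i)) -> (forall i x, `|phi i x| <= 1) ->
  [/\ measurable_fun setT (fun x => \sum_(i <- r) c i * phi i x),
      forall x, `|\sum_(i <- r) c i * phi i x| <= \sum_(i <- r) `|c i| &
      \int[mu]_x (\sum_(i <- r) c i * phi i x) = \sum_(i <- r) c i * \int[mu]_x phi i x].
Proof.
move=> mphi phi1; elim: r => [|i r [m1 b1 i1]].
  split=> [|x|].
  - by under eq_fun do rewrite big_nil; exact: measurable_cst.
  - by rewrite !big_nil normr0.
  - by rewrite big_nil; under eq_Rintegral do rewrite big_nil; rewrite /Rintegral integral_cst_prob.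
have mi : measurable_fun setT (fun x => c i * phi i x) by apply: measurable_funM.
have bi x : `|c i * phi i x| <= `|c i| by rewrite normrM ler_piMr.
split=> [|x|].
- by under eq_fun do rewrite big_cons; apply: measurable_funD.
- by rewrite !big_cons (le_trans (ler_normD _ _))// lerD.
- rewrite big_cons -i1 -RintegralZl//; last exact: (integrable_bounded mu (mphi i) (phi1 i)).
  rewrite -RintegralD//.
  + by apply: eq_Rintegral => x _; rewrite big_cons.
  + exact: (integrable_bounded mu mi bi).
  + exact: (integrable_bounded mu m1 b1).
Qed.

Lemma norm_mean (phi : X -> R) : measurable_fun setT phi -> (forall x, `|phi x| <= 1) ->
  `|\int[mu]_x phi x| <= 1.
Proof.
move=> mphi phi1; have i := integrable_bounded mu mphi phi1.
rewrite (le_trans (le_normr_Rintegral _ i))//.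
have -> : 1 = \int[mu]_x (cst 1 x) :> R by rewrite /Rintegral integral_cst_prob.
have icst : mu.-integrable setT (EFin \o cst (1 : R)).
  exact: (integrable_bounded mu (measurable_cst (1 : R)) (fun=> lexx `|1|)).
apply: le_Rintegral => //.
apply: (integrable_bounded mu (C := 1)); first exact: measurableT_comp.
by move=> x; rewrite normr_id.
Qed.

(* Choosing the next point so that the cross term is nonpositive makes the squared
   discrepancy grow only linearly. *)
Lemma greedy_points I (r : seq I) (phi : I -> X -> R) (K : nat) :
  (forall i, measurable_fun setT (phi i)) -> (forall i x, `|phi i x| <= 1) ->
  exists x : nat -> X,
    \sum_(i <- r) (\sum_(k < K) (phi i (x k) - \int[mu]_x phi i x)) ^+ 2 <=
    (4 * size r * K)%:R.
Proof.
move=> mphi phi1; elim: K => [|K [x xP]].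
  have [x0 _] := ae_exists (aeW mu (P := fun=> True) (fun=> Logic.I)).
  by exists (fun=> x0); rewrite big1 ?muln0// => i _; rewrite big_ord0 expr0n.
pose c i := \sum_(k < K) (phi i (x k) - \int[mu]_x phi i x).
have [m1 b1 i1] := Rintegral_lincomb r c mphi phi1.
have [y] := exists_le_mean m1 b1; rewrite i1 => yP.
exists (fun k => if k == K then y else x k).
pose dv i := phi i y - \int[mu]_x phi i x.
have -> : \sum_(i <- r) (\sum_(k < K.+1) (phi i (if k == K :> nat then y else x k) -
     \int[mu]_x phi i x)) ^+ 2 =
   \sum_(i <- r) c i ^+ 2 + 2 * \sum_(i <- r) c i * dv i + \sum_(i <- r) dv i ^+ 2.
  rewrite mulr_sumr -!big_split; apply: eq_bigr => i _; rewrite big_ord_recr/= eqxx.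
  rewrite (eq_bigr (fun k : 'I_K => phi i (x k) - \int[mu]_x phi i x)) => [|k _].
    by rewrite -/(c i) -/(dv i) /=; ring.
  by rewrite ltn_eqF.
have c0 : \sum_(i <- r) c i * dv i <= 0.
  by under eq_bigr do rewrite mulrBr; rewrite sumrB subr_le0.
have d4 : \sum_(i <- r) dv i ^+ 2 <= (4 * size r)%:R.
  apply: (@le_trans _ _ (\sum_(i <- r) 4)); last first.
    by rewrite big_const_seq count_predT iter_addr_0 natrM mulr_natr.
  apply: ler_sum => i _; rewrite /dv; have := phi1 i y; have := norm_mean (mphi i) (phi1 i).
  by rewrite !ler_norml => /andP[h1 h2] /andP[h3 h4]; nra.
by rewrite mulnS addnC natrD; lra.
Qed.

(** Linear growth of the squared discrepancy means an error of order [K ^ (-1/2)] in each average;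
    neither product measures nor a law of large numbers are involved. *)
Lemma sample_points (J : eqType) (r : seq J) (phi : J -> X -> R) (eta : R) :
  (forall i, measurable_fun setT (phi i)) -> (forall i x, `|phi i x| <= 1) -> 0 < eta ->
  exists K (x : nat -> X), (0 < K)%N /\ forall i, i \in r ->
    `|K%:R^-1 * \sum_(k < K) phi i (x k) - \int[mu]_x phi i x| <= eta.
Proof.
move=> mphi phi1 eta0; have [K KP] : exists K : nat, (4 * size r)%:R / eta ^+ 2 <= K%:R.
  by eexists; apply/ltW/archi_boundP; rewrite divr_ge0// sqr_ge0.
have [x xP] := greedy_points r K.+1 mphi phi1.
exists K.+1, x; split => // i ir.
have K0 : 0 < K.+1%:R :> R by [].
pose S := \sum_(k < K.+1) (phi i (x k) - \int[mu]_x phi i x).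
have -> : K.+1%:R^-1 * \sum_(k < K.+1) phi i (x k) - \int[mu]_x phi i x = K.+1%:R^-1 * S.
  rewrite /S sumrB mulrBr sumr_const card_ord; congr (_ - _).
  by rewrite -[(\int[mu]_x phi i x) *+ _]mulr_natl mulrA mulVf ?mul1r// gt_eqF.
rewrite normrM gtr0_norm ?invr_gt0// mulrC ler_pdivrMr//.
rewrite -(@ler_pXn2r _ 2) ?nnegrE// ?mulr_ge0 ?(ltW eta0)// real_normK ?num_real//.
have S2 : S ^+ 2 <= (4 * size r * K.+1)%:R.
  apply: le_trans xP; rewrite (big_rem i)//= lerDl sumr_ge0// => j _.
  exact: sqr_ge0.
rewrite (le_trans S2)// natrM exprMn [X in _ <= _ * X]expr2 mulrA ler_wpM2r//.
move: KP; rewrite ler_pdivrMr ?exprn_gt0// => KP; rewrite (le_trans KP)// mulrC.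
by rewrite ler_wpM2l ?sqr_ge0// ler_nat.
Qed.

End Sampling.

(** * Complex observables under measure preserving maps *)

Section MeasurePreserving.
Context d (X : measurableType d) (R : realType) (mu : probability X R).
Implicit Types (f : X -> R[i]) (T : X -> X).

Definition cmeasurable f := measurable_fun setT (fun x => complex.Re (f x)) /\
  measurable_fun setT (fun x => complex.Im (f x)).

Lemma cmeasurable_comp f T : measurable_fun setT T -> cmeasurable f ->
  cmeasurable (fun x => f (T x)).
Proof. by move=> mT [m1 m2]; split; [exact: (measurableT_comp m1 mT)|exact: (measurableT_comp m2 mT)]. Qed.

Lemma cmeasurable_mul_conj f g : cmeasurable f -> cmeasurable g ->
  cmeasurable (fun x => f x * (g x)^*).
Proof.
move=> [m1 m2] [m3 m4]; split.
  by under eq_fun do rewrite Re_mul_conj; apply: measurable_funD; apply: measurable_funM.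
by under eq_fun do rewrite Im_mul_conj; apply: measurable_funB; apply: measurable_funM.
Qed.

Lemma cmeasurable_average (G : choiceType) (A : {fset G}) (f : G -> X -> R[i]) :
  (forall a, cmeasurable (f a)) -> cmeasurable (fun x => #|` A|%:R^-1 * \sum_(a <- A) f a x).
Proof.
move=> mf; rewrite natCV; split.
  under eq_fun do rewrite Re_real_mul Re_sum.
  by apply: measurable_funM => //; apply: measurable_sum => i; case: (mf i).
under eq_fun do rewrite Im_real_mul Im_sum.
by apply: measurable_funM => //; apply: measurable_sum => i; case: (mf i).
Qed.

Lemma cintegral_comp f T : measurable_fun setT T ->
  (forall A, measurable A -> mu (T @^-1` A) = mu A) ->
  cmeasurable f -> (forall x, `|f x| <= 1) ->
  cintegral mu (fun x => f (T x)) = cintegral mu f.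
Proof.
move=> mT muT [m1 m2] f1.
have inv (phi : X -> R) : measurable_fun setT phi -> (forall x, `|phi x| <= 1) ->
    \int[mu]_x phi (T x) = \int[mu]_x phi x.
  move=> mphi phi1; rewrite /Rintegral; congr fine.
  transitivity (\int[pushforward mu T]_x (phi x)%:E)%E.
    rewrite integral_pushforward//.
    - exact/measurable_EFinP.
    - apply: (integrable_bounded mu (C := 1)) => //.
      exact: (measurableT_comp mphi mT).
  by apply: eq_measure_integral => A mA _; exact: muT.
rewrite /cintegral; congr Complex; apply: inv => // x.
  exact: normC1_Re.
exact: normC1_Im.
Qed.

Lemma cintegral_average (G : choiceType) (A : {fset G}) (f : G -> X -> R[i]) :
  (forall a, cmeasurable (f a)) -> (forall a x, `|f a x| <= 1) ->
  cintegral mu (fun x => #|` A|%:R^-1 * \sum_(a <- A) f a x) =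
  #|` A|%:R^-1 * \sum_(a <- A) cintegral mu (f a).
Proof.
move=> mf f1; set c : R := #|` A|%:R^-1; rewrite !natCV -/c.
apply/eqP; rewrite eq_complex Re_real_mul Im_real_mul Re_sum Im_sum /=.
apply/andP; split; apply/eqP.
  under eq_Rintegral do rewrite Re_real_mul Re_sum mulr_sumr.
  have [_ _ ->] := @Rintegral_lincomb _ _ _ mu _ A (fun i x => complex.Re (f i x)) (fun=> c)
    (fun i => (mf i).1) (fun i x => normC1_Re (f1 i x)).
  by rewrite mulr_sumr.
under eq_Rintegral do rewrite Im_real_mul Im_sum mulr_sumr.
have [_ _ ->] := @Rintegral_lincomb _ _ _ mu _ A (fun i x => complex.Im (f i x)) (fun=> c)
  (fun i => (mf i).2) (fun i x => normC1_Im (f1 i x)).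
by rewrite mulr_sumr.
Qed.

Lemma cintegral_aeZ f g (c : R) : cmeasurable f -> cmeasurable g ->
  (forall x, `|f x| <= 1) -> (\forall x \ae mu, g x = c%:C%C * f x) ->
  cintegral mu g = c%:C%C * cintegral mu f.
Proof.
move=> [mf1 mf2] [mg1 mg2] f1 gf.
have ae_int (u v : X -> R) : measurable_fun setT u -> measurable_fun setT v ->
    (forall x, `|u x| <= 1) -> (\forall x \ae mu, v x = c * u x) ->
    \int[mu]_x v x = c * \int[mu]_x u x.
  move=> mu_ mv u1 vu; rewrite -RintegralZl//; last exact: (integrable_bounded mu mu_ u1).
  rewrite /Rintegral; congr fine; apply: ae_eq_integral => //.
  - exact/measurable_EFinP.
  - by apply/measurable_EFinP/measurable_funM.
  - by apply: filterS vu => x -> _.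
apply/eqP; rewrite eq_complex Re_real_mul Im_real_mul /=; apply/andP; split; apply/eqP.
  apply: ae_int => // [x|]; first exact: normC1_Re.
  by apply: filterS gf => x ->; rewrite Re_real_mul.
apply: ae_int => // [x|]; first exact: normC1_Im.
by apply: filterS gf => x ->; rewrite Im_real_mul.
Qed.

(** Values along orbits of individual points must lie in the disk, but [f] is only essentially
    bounded: it is set to 0 where its modulus exceeds [c], a null set, and then scaled. *)
Lemma cLinfty_truncate f : cLinfty mu f -> exists f' (c : R),
  [/\ cmeasurable f', forall x, `|f' x| <= 1, 0 < c & \forall x \ae mu, f x = c%:C%C * f' x].
Proof.
move=> [m1 m2]; rewrite /finite_norm unlock.
have -> : (0 < mu setT)%E by rewrite [mu setT](_ : _ = 1%E)//; exact: probability_setT.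
move=> /ess_sup_inf.ess_supr_bounded[M fM]; pose c := Num.max M 1.
have c0 : 0 < c by rewrite lt_max ltr01 orbT.
pose b x : bool := complex.Re (f x) ^+ 2 + complex.Im (f x) ^+ 2 <= c ^+ 2.
pose a x : R := if b x then c^-1 else 0.
have mb : measurable_fun setT b.
  by apply: measurable_fun_ler => //; apply: measurable_funD; exact: measurable_funX.
have ma : measurable_fun setT a by exact: measurable_fun_ifT.
exists (fun x => (a x)%:C%C * f x), c; split=> // [|x|].
- split; first by under eq_fun do rewrite Re_real_mul; exact: measurable_funM.
  by under eq_fun do rewrite Im_real_mul; exact: measurable_funM.
- rewrite normC1_sqr Re_real_mul Im_real_mul !exprMn -mulrDr /a.
  case bx : (b x); last by rewrite expr0n mul0r.
  by rewrite exprVn mulrC ler_pdivrMr ?exprn_gt0// mul1r.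
- apply: filterS fM => x /= fx; rewrite mulrA -rmorphM /a.
  suff -> : b x by rewrite divff ?gt_eqF// mul1r.
  have : Num.sqrt (complex.Re (f x) ^+ 2 + complex.Im (f x) ^+ 2) <= c.
    rewrite -normC_le -[ `|f x|]/((Normc.normc (f x))%:C%C) lecR.
    by rewrite (le_trans (ler_norm _))// (le_trans fx)// le_max lexx.
  move=> h; rewrite /b -[X in X <= _]sqr_sqrtr ?addr_ge0 ?sqr_ge0// ler_pXn2r// nnegrE ?sqrtr_ge0//.
  exact: ltW.
Qed.

End MeasurePreserving.

Lemma finitary_vdC (R : realType) (G : groupType) (H : set G) :
  (forall eps : R, 0 < eps -> finitary_at H eps) ->
  vdC R H.
Proof.
move=> fin d X mu T [T1 TM mT muT] f fL fH.
have mf : cmeasurable f by case: fL.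
have [f' [c [mf' f'1 c0 ff']]] := cLinfty_truncate fL.
have ae_shift g : \forall x \ae mu, f (T g x) = c%:C%C * f' (T g x).
  case: ff' => N [mN N0 NP]; exists (T g @^-1` N); split.
  - by rewrite -[_ @^-1` _]setTI; exact: mT.
  - by rewrite muT.
  - by move=> x /= hx; apply: NP.
have corr1 g h x : `|f' (T g x) * (f' (T h x))^*| <= 1.
  by rewrite normrM norm_conjC mulr_ile1.
have mcorr g h : cmeasurable (fun x => f' (T g x) * (f' (T h x))^*).
  by apply: cmeasurable_mul_conj; apply: cmeasurable_comp.
have corr0 h : H h -> cintegral mu (fun x => f' (T h x) * (f' (T 1%g x))^*) = 0.
  move=> Hh; have cC : (c ^+ 2)%:C%C != 0 :> R[i] by rewrite (fmorph_eq0 (@real_complex R)) expf_neq0 ?gt_eqF.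
  apply: (mulfI cC); rewrite mulr0 -(fH h Hh); symmetry; apply: cintegral_aeZ => //.
  - by apply: cmeasurable_mul_conj => //; apply: cmeasurable_comp.
  - apply: filterS2 (ae_shift h) (ae_shift 1%g) => x ->.
    rewrite T1 => ->; have -> : (c%:C%C * f' x)^* = c%:C%C * (f' x)^*.
      by rewrite [LHS]rmorphM; congr (_ * _); exact: conjc_real.
    have -> : (c ^+ 2)%:C%C = c%:C%C * c%:C%C :> R[i] by rewrite expr2 rmorphM.
    by rewrite mulrACA.
rewrite (cintegral_aeZ mf' mf f'1 ff'); suff -> : cintegral mu f' = 0 by rewrite mulr0.
apply/eqP; rewrite -normr_le0.
suff small : forall e : R, 0 < e -> `|cintegral mu f'| <= e%:C%C.
  rewrite -[0]/(0%:C%C) normC_le; apply/ler_addgt0Pr => e e0.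
  by rewrite add0r -normC_le small.
move=> e e0; have [delta d0 [A [H0 [A0 H0H P]]]] := fin (e / 2) (divr_gt0 e0 (ltr0Sn _ 1)).
(* [None] stands for the mean and [Some h] for the correlation at [h]. By invariance, averaging over
   [A] does not change the integrals. *)
pose F (i : option G) a x : R[i] :=
  if i is Some h then f' (T (h * a)%g x) * (f' (T a x))^* else f' (T a x).
pose Phi i x : R[i] := #|` A|%:R^-1 * \sum_(a <- A) F i a x.
pose phi (i : option G * bool) x : R := if i.2 then complex.Re (Phi i.1 x) else complex.Im (Phi i.1 x).
(* Errors up to [dl] in both parts give a modulus below [8 * dl], which is at most [delta] and at
   most [e / 2]. *)
pose dl := Num.min (delta / 8) (e / 16).
have dl0 : 0 < dl by rewrite lt_min !divr_gt0.
have A1 : #|` A|%:R != 0 :> R[i] by rewrite pnatr_eq0 cardfs_eq0.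
have mF i a : cmeasurable (F i a) by case: i => [h|]; [exact: mcorr|exact: cmeasurable_comp].
have F1 i a x : `|F i a x| <= 1 by case: i => [h|]; rewrite /F.
have mPhi i : cmeasurable (Phi i) by exact: cmeasurable_average.
have Phi1 i x : `|Phi i x| <= 1.
  rewrite normrM ger0_norm ?invr_ge0// mulrC ler_pdivrMr ?lt0r ?A1 ?ler0n// mul1r.
  rewrite (le_trans (ler_norm_sum _ _ _))//.
  apply: (@le_trans _ _ (\sum_(a <- A) 1)); first exact: ler_sum.
  by rewrite big_const_seq count_predT iter_addr_0.
have mphi i : measurable_fun setT (phi i).
  by case: i => i [] ; case: (mPhi i).
have phi1 i x : `|phi i x| <= 1.
  by case: i => i []; [exact: normC1_Re|exact: normC1_Im].
have int_Phi i (c' : R[i]) : (forall a, cintegral mu (F i a) = c') -> cintegral mu (Phi i) = c'.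
  move=> Fc; rewrite cintegral_average//; under eq_bigr do rewrite Fc.
  rewrite big_const_seq count_predT iter_addr_0 -[c' *+ _]mulr_natl mulrA mulVf// mul1r.
  by [].
have [K [x [K0 xP]]] := sample_points mu
  [seq (i, b) | i <- None :: map Some (H0 : seq G), b <- [:: true; false]] mphi phi1 dl0.
have dev i : i \in None :: map Some (H0 : seq G) ->
   `|K%:R^-1 * \sum_(k < K) Phi i (x k) - cintegral mu (Phi i)| < (8 * dl)%:C%C.
  have dl8 : dl < 8 * dl / 2 by lra.
  move=> ir; apply: normC_lt_parts; rewrite natCV; apply: le_lt_trans dl8.
    apply: le_trans (xP (i, true) _); last by apply/allpairsP; exists (i, true).
    rewrite /phi/= -(Re_sum (index_enum 'I_K) xpredT (fun k => Phi i (x k))).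
    by case: (\sum_(k < K) _) => p q /=; rewrite mul0r subr0.
  apply: le_trans (xP (i, false) _); last by apply/allpairsP; exists (i, false).
  rewrite /phi/= -(Im_sum (index_enum 'I_K) xpredT (fun k => Phi i (x k))).
  by case: (\sum_(k < K) _) => p q /=; rewrite mul0r addr0.
have PhiE i : K%:R^-1 * \sum_(k < K) Phi i (x k) =
    (K%:R * #|` A|%:R)^-1 * \sum_(k < K) \sum_(a <- A) F i a (x k).
  by rewrite /Phi -mulr_sumr invfM mulrA.
have := P K (fun k a => f' (T a (x k))) K0 (fun _ _ => f'1 _).
have /[swap]/[apply] : forall h, h \in H0 -> `|(K%:R * #|` A|%:R)^-1 *
    \sum_(k < K) \sum_(a <- A) f' (T (h * a)%g (x k)) * (f' (T a (x k)))^*| < delta%:C%C.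
  move=> h hH; have := dev (Some h) _; rewrite PhiE (int_Phi _ 0) ?subr0; last first.
    move=> a; rewrite -(corr0 h (H0H _ hH)) -(cintegral_comp (mT a) (muT a) (mcorr h 1%g))//.
    by congr (cintegral mu _); apply/funext => y; rewrite /F !TM mul1g.
  move=> /(_ _)/lt_le_trans; apply.
    by rewrite inE map_f.
  by rewrite lecR /dl; have := ge_min (delta / 8) (delta / 8) (e / 16); rewrite lexx; lra.
rewrite -(PhiE None) => m1.
have := dev None (mem_head _ _); rewrite (int_Phi _ (cintegral mu f')) => [d1|a]; last first.
  exact: cintegral_comp (mT a) (muT a) mf' f'1.
have := ler_normB (K%:R^-1 * \sum_(k < K) Phi None (x k)) (K%:R^-1 * \sum_(k < K) Phi None (x k) - cintegral mu f').
rewrite opprB addrC subrK => /le_trans; apply; rewrite (le_trans (ltW (ltrD m1 d1)))//.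
rewrite -rmorphD lecR /dl.
have := ge_min (e / 16) (delta / 8) (e / 16); rewrite lexx orbT; lra.
Qed.

(** * Measures on bit sequences *)

Section UltraLimit.
Variables (R : realType) (U : set_system nat).
Hypothesis U_ultra : UltraFilter U.

Lemma ultra_cvg (u : nat -> R) (C : R) : (forall N, `|u N| <= C) -> cvg (u N @[N --> U]).
Proof.
have pU : ProperFilter U by exact: ultra_proper.
move=> uC; have : (u N @[N --> U]) `[- C, C]%classic.
  by apply: nearW => N /=; rewrite in_itv/= -ler_norml.
move=> /(@segment_compact R (- C) C)[l [_ clu]].
apply/cvg_ex; exists l; apply/cvgrPdist_lt => e e0.
have [//|nU] := in_ultra_setVsetC [set N | `|l - u N| < e] U_ultra.
have [x [/=]] := clu [set r | ~ `|l - r| < e] _ nU (nbhsx_ballx l e e0).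
by rewrite /ball/=.
Qed.

Definition ulim (u : nat -> R) : R := lim (u N @[N --> U]).

Lemma ulimP (u : nat -> R) (C : R) : (forall N, `|u N| <= C) ->
  u N @[N --> U] --> ulim u.
Proof. exact: ultra_cvg. Qed.

End UltraLimit.

(** * Coding by nested intervals *)

Section IntervalCode.
Variables (R : realType) (q : seq bool -> R).
Hypothesis q_nil : q [::] = 1.
Hypothesis q_ge0 : forall r, 0 <= q r.
Hypothesis q_split : forall r, q r = q (false :: r) + q (true :: r).

(* Words are stored in reverse order: the head of [r] is the last bit. *)
Fixpoint left_end (r : seq bool) : R :=
  if r is b :: r' then left_end r' + (if b then q (false :: r') else 0) else 0.

(** The word [r] owns the half-open interval of length [q r] starting at [left_end r]; it is cut at
    [left_end r + q (false :: r)], and the next bit records the side on which [u] lies. *)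
Fixpoint code_prefix n (u : R) : seq bool :=
  if n is n'.+1 then
    let r := code_prefix n' u in (left_end r + q (false :: r) <= u) :: r
  else [::].

Definition code (u : R) n : bool := 
  left_end (code_prefix n u) + q (false :: code_prefix n u) <= u.

Fixpoint prefix_rev (x : nat -> bool) n : seq bool :=
  if n is n'.+1 then x n' :: prefix_rev x n' else [::].

Lemma prefix_rev_code u n : prefix_rev (code u) n = code_prefix n u.
Proof. by elim: n => //= n ->. Qed.

Lemma left_end_bounds r : 0 <= left_end r /\ left_end r + q r <= 1.
Proof.
elim: r => [|b r [h1 h2]] /=; first by rewrite q_nil add0r.
have := q_ge0 (false :: r); have := q_ge0 (true :: r); rewrite q_split in h2.
by case: b; split; lra.
Qed.

Lemma code_prefixP r u : 0 <= u < 1 ->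
  (code_prefix (size r) u == r) = (left_end r <= u < left_end r + q r).
Proof.
move=> u01; elim: r => [|b r ih] /=; first by rewrite q_nil add0r.
rewrite eqseq_cons; have := ih; case: eqP => [-> /esym/andP[h1 h2]|_ /esym h]; last first.
  rewrite andbF; symmetry; apply/negbTE; apply: contraFN h => /andP[h1 h2].
  have := q_ge0 (false :: r); have := q_ge0 (true :: r); rewrite (q_split r).
  by case: b h1 h2 => *; apply/andP; split; lra.
rewrite andbT; rewrite q_split in h2; case: b => /=.
  by rewrite -addrA h2 andbT; case: (_ <= u).
by rewrite addr0 h1/= ltNge; case: (_ <= u).
Qed.

End IntervalCode.

(** Intersection corresponds to concatenation of lists, so these sets form a pi-system and a
    probability is determined by its values on them. *)
Definition all_true (r : seq nat) : set (nat -> bool) := [set x : nat -> bool | all x r].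
Definition bit_generators : set (set (nat -> bool)) := range all_true.
Definition bit_space : Type := g_sigma_algebraType bit_generators.
HB.instance Definition _ := Measurable.on bit_space.

Section CodeMeasure.
Variables (R : realType) (q : seq bool -> R).
Hypothesis q_nil : q [::] = 1.
Hypothesis q_ge0 : forall r, 0 <= q r.
Hypothesis q_split : forall r, q r = q (false :: r) + q (true :: r).

Local Notation mR := [the measurableType _ of measurableTypeR R].

Lemma measurable_code_prefix n (F : seq bool -> R) :
  measurable_fun [set: mR] (fun u => F (code_prefix q n u)).
Proof.
elim: n F => [|n ih] F; first by rewrite /=; exact: measurable_cst.
rewrite (_ : (fun u => _) = fun u => if code q u n then F (true :: code_prefix q n u)
    else F (false :: code_prefix q n u)); last first.
  by apply/funext => u /=; rewrite -/(code q u n); case: (code q u n).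
apply: measurable_fun_ifT; [|exact: (ih (fun r => F (true :: r)))|exact: (ih (fun r => F (false :: r)))].
apply: measurable_fun_ler => //; exact: (ih (fun r => left_end q r + q (false :: r))).
Qed.

Lemma measurable_code_bit n : measurable_fun [set: mR] (fun u => code q u n).
Proof.
apply: measurable_fun_ler => //.
exact: (measurable_code_prefix n (fun r => left_end q r + q (false :: r))).
Qed.

Lemma measurable_code : measurable_fun [set: mR] (code q : mR -> bit_space).
Proof.
apply: (@measurability _ _ mR bit_space setT (code q) bit_generators) => // _ [_ [r _ <-] <-]; rewrite setTI.
elim: r => [|i r ih].
  by rewrite (_ : _ @^-1` _ = setT)//; apply/seteqP; split.
rewrite (_ : _ @^-1` _ = [set u | code q u i] `&` (code q @^-1` all_true r)); last first.
  by apply/seteqP; split => u /=; rewrite /all_true/= => /andP.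
apply: measurableI => //; rewrite -[X in measurable X]setTI.
exact: (measurable_code_bit i measurableT (Y := [set true])).
Qed.

Definition code_mfun : {mfun mR >-> bit_space} :=
  MeasurableFun.Pack (MeasurableFun.Class
    (@isMeasurableFun.Build _ _ mR bit_space (code q) measurable_code)).

Definition code_measure : probability bit_space R :=
  distribution (uniform_prob (@ltr01 R)) code_mfun.

Lemma measurable_bit i : measurable [set x : bit_space | x i].
Proof.
rewrite (_ : [set x | _] = all_true [:: i]); first by apply: sub_sigma_algebra; exists [:: i].
by apply/seteqP; split => x /=; rewrite /all_true/= andbT.
Qed.

Definition cylinder (r : seq bool) : set bit_space := [set x | prefix_rev x (size r) = r].

Lemma cylinder_cons b r : cylinder (b :: r) = [set x | x (size r) = b] `&` cylinder r.
Proof. by apply/seteqP; split => x; rewrite /cylinder /= => -[-> ->]. Qed.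

Lemma measurable_cylinder r : measurable (cylinder r).
Proof.
elim: r => [|b r ih]; first by rewrite (_ : cylinder _ = setT)//; apply/seteqP; split.
rewrite cylinder_cons; apply: measurableI => //; have := measurable_bit (size r); case: b => //.
move=> /measurableC; congr measurable; apply/seteqP; split => x /=; first by move/negP/negbTE.
by move=> ->.
Qed.

Lemma code_measure_cylinder r : code_measure (cylinder r) = (q r)%:E.
Proof.
set A := code q @^-1` cylinder r : set mR.
have mA : measurable A.
  by rewrite /A -[_ @^-1` _]setTI; exact: (measurable_code measurableT (measurable_cylinder r)).
have -> : code_measure (cylinder r) = uniform_prob (@ltr01 R) A by [].
have -> : uniform_prob (@ltr01 R) A = (\int[uniform_prob (@ltr01 R)]_x (\1_A x)%:E)%E.
  by rewrite integral_indic// setIT.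
rewrite integral_uniform//; last by apply/measurable_EFinP.
rewrite subr0 invr1 mul1e.
(* [code_prefixP] covers [0 <= u < 1]; dropping the end point 1 does not change the integral. *)
rewrite -integral_itv_bndo_bndc; last first.
  by apply/measurable_EFinP/measurable_funTS; exact: measurable_indic.
rewrite integral_indic//=.
have [l0 l1] := left_end_bounds q_nil q_ge0 q_split r.
have -> : A `&` `[0, 1[%classic = `[left_end q r, left_end q r + q r[%classic.
  have AE u : A u <-> code_prefix q (size r) u = r by rewrite /A /cylinder /= prefix_rev_code.
  apply/seteqP; split => u /=.
    by rewrite !in_itv/= => -[/AE/eqP + u01]; rewrite code_prefixP.
  rewrite !in_itv/= => ur; have u01 : 0 <= u < 1 by case/andP: ur => *; apply/andP; split; lra.
  by split => //; apply/AE/eqP; rewrite code_prefixP.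
rewrite lebesgue_measure_itv/= lte_fin ltrDl.
have [q0|q0] := ltP 0 (q r); first by rewrite -EFinB addrAC subrr add0r.
by congr EFin; apply/esym/eqP; rewrite eq_le q0 q_ge0.
Qed.

End CodeMeasure.

(* [mean] plays the role of a finitely additive average over base points, at which the
   bits are independent with success probabilities [bit]. *)
Section BernoulliMixture.
Variables (R : realType) (Omega : Type) (mean : (Omega -> R) -> R).
Variable bit : nat -> Omega -> R.
Hypothesis mean1 : mean (fun=> 1) = 1.
Hypothesis mean_ge0 : forall u, (forall g, 0 <= u g <= 1) -> 0 <= mean u.
Hypothesis meanD : forall u v, (forall g, 0 <= u g <= 1) -> (forall g, 0 <= v g <= 1) ->
  mean (fun g => u g + v g) = mean u + mean v.
Hypothesis bit01 : forall i g, 0 <= bit i g <= 1.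

Fixpoint word_weight (r : seq bool) g : R :=
  if r is b :: r' then (if b then bit (size r') g else 1 - bit (size r') g) * word_weight r' g
  else 1.

Lemma word_weight01 r g : 0 <= word_weight r g <= 1.
Proof.
elim: r => [|b r /andP[h1 h2]] /=; first by rewrite ler01 lexx.
by have /andP[h3 h4] := bit01 (size r) g; case: b; apply/andP; split; nra.
Qed.

Definition word_mass r := mean (word_weight r).

Lemma word_mass_split r : word_mass r = word_mass (false :: r) + word_mass (true :: r).
Proof.
rewrite /word_mass -meanD; try by move=> g; exact: word_weight01.
by congr mean; apply/funext => g /=; ring.
Qed.

Definition mixture : probability bit_space R := code_measure word_mass.

Lemma mixture_cylinder r : mixture (cylinder r) = (word_mass r)%:E.
Proof.
apply: code_measure_cylinder => [||r']; [exact: mean1| |exact: word_mass_split].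
by move=> r'; apply: mean_ge0 => g; exact: word_weight01.
Qed.

Lemma prod_bit01 r g : 0 <= \prod_(i <- r) bit i g <= 1.
Proof.
elim: r => [|i r /andP[h1 h2]]; first by rewrite big_nil ler01 lexx.
by rewrite big_cons; have /andP[h3 h4] := bit01 i g; apply/andP; split; nra.
Qed.

(** Interpolates between cylinders, at [k = 0], and the sets [all_true], at empty [r]. In the
    induction an unconstrained bit is summed over its two values. *)
Lemma mixture_cylinder_true (c : pred nat) k r :
  mixture (cylinder r `&` all_true (seq.filter c (iota (size r) k))) =
  (mean (fun g => word_weight r g * \prod_(i <- seq.filter c (iota (size r) k)) bit i g))%:E.
Proof.
elim: k r => [|k ih] r.
  rewrite (_ : _ `&` _ = cylinder r) ?mixture_cylinder.
    by congr (mean _)%:E; apply/funext => g; rewrite big_nil mulr1.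
  by apply/seteqP; split => x; [case|].
pose S := seq.filter c (iota (size r).+1 k).
have ihS b : mixture (cylinder (b :: r) `&` all_true S) =
    (mean (fun g => word_weight (b :: r) g * \prod_(i <- S) bit i g))%:E := ih (b :: r).
rewrite [seq.filter _ _]/= -/S; case: ifP => cr.
  rewrite (_ : _ `&` _ = cylinder (true :: r) `&` all_true S).
    rewrite ihS; congr (mean _)%:E; apply/funext => g /=.
    by rewrite big_cons; ring.
  rewrite cylinder_cons; apply/seteqP; split => x /=; rewrite /all_true/=.
    by move=> [xr /andP[x1 xS]].
  by move=> [[x1 xr] xS]; split => //; rewrite x1.
rewrite (_ : _ `&` _ = (cylinder (false :: r) `&` all_true S) `|`
    (cylinder (true :: r) `&` all_true S)).
  have mS : measurable (all_true S : set bit_space) by apply: sub_sigma_algebra; exists S.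
  rewrite measureU; try by apply: measurableI => //; exact: measurable_cylinder.
    rewrite [X in (X + _)%E](ihS false) [X in (_ + X)%E](ihS true) -EFinD -meanD.
    - by congr (mean _)%:E; apply/funext => g /=; ring.
    - by move=> g; apply/andP; have /andP[h1 h2] := word_weight01 (false :: r) g;
        have /andP[h3 h4] := prod_bit01 S g; split; [exact: mulr_ge0|exact: mulr_ile1].
    - by move=> g; apply/andP; have /andP[h1 h2] := word_weight01 (true :: r) g;
        have /andP[h3 h4] := prod_bit01 S g; split; [exact: mulr_ge0|exact: mulr_ile1].
  rewrite !cylinder_cons; apply/seteqP; split => // x /= [[[xf _] _] [[xt _] _]].
  by rewrite xf in xt.
rewrite -setIUl !cylinder_cons -setIUl (_ : _ `|` _ = setT) ?setTI//.
by apply/seteqP; split => // x _ /=; case: (x (size r)); [right|left].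
Qed.

(** A bit listed twice is one constraint, hence [undup]. *)
Lemma mixture_all_true r :
  mixture (all_true r) = (mean (fun g => \prod_(i <- undup r) bit i g))%:E.
Proof.
have [M rM] : exists M, forall i, i \in r -> (i < M)%N.
  by exists (\max_(i <- r) i).+1 => i ir; rewrite ltnS; exact: leq_bigmax_seq.
have := mixture_cylinder_true (fun i => i \in r) M [::].
rewrite (_ : _ `&` _ = all_true r) => [->|].
  congr (mean _)%:E; apply/funext => g; rewrite mul1r; apply: perm_big.
  apply: uniq_perm; rewrite ?filter_uniq ?iota_uniq ?undup_uniq// => i.
  rewrite mem_filter mem_iota mem_undup leq0n add0n /=; apply/andP/idP => [[]//|ir].
  by split => //; exact: rM.
apply/seteqP; split => x /=; rewrite /all_true /=.
  move=> [_ /allP xr]; apply/allP => i ir; apply: xr.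
  by rewrite mem_filter mem_iota leq0n add0n /=; apply/andP; split => //; exact: rM.
move=> /allP xr; split => //; apply/allP => i.
by rewrite mem_filter => /andP[ir _]; exact: xr.
Qed.

End BernoulliMixture.

(** * The correspondence principle *)

Section Spin.
Variable R : realType.

Definition spin i (x : bit_space) : R := 2 * (x i)%:R - 1.

Lemma indic_all_true r (x : bit_space) : \1_(all_true r) x = (all x r)%:R :> R.
Proof. by rewrite indicE; congr (nat_of_bool _)%:R; apply/idP/idP; rewrite inE. Qed.

Lemma measurable_all_true r : measurable (all_true r : set bit_space).
Proof. by apply: sub_sigma_algebra; exists r. Qed.

Lemma spinE i x : spin i x = 2 * \1_(all_true [:: i]) x - 1.
Proof. by rewrite indic_all_true /= andbT. Qed.

Lemma measurable_spin i : measurable_fun setT (spin i).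
Proof.
have -> : spin i = (fun x => 2 * \1_(all_true [:: i]) x - 1) by apply/funext => x; exact: spinE.
apply: measurable_funB => //; apply: measurable_funM => //.
by apply: measurable_indic; exact: measurable_all_true.
Qed.

Lemma spin_le1 i x : `|spin i x| <= 1.
Proof.
by rewrite /spin ler_norml; case: (x i); rewrite ?mulr1 ?mulr0; apply/andP; split; lra.
Qed.

Lemma Rintegral_all_true (mu : probability bit_space R) (rs : seq (seq nat)) (c : seq R) :
  \int[mu]_x (\sum_(k <- iota 0 (size rs)) c`_k * (all x (nth [::] rs k))%:R) =
  \sum_(k <- iota 0 (size rs)) c`_k * fine (mu (all_true (nth [::] rs k))).
Proof.
pose phi k (x : bit_space) : R := \1_(all_true (nth [::] rs k)) x.
have mphi k : measurable_fun setT (phi k) by apply: measurable_indic; exact: measurable_all_true.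
have phi1 k x : `|phi k x| <= 1 by rewrite /phi indicE normr_nat; case: (_ \in _).
have [_ _] := Rintegral_lincomb mu (iota 0 (size rs)) (nth 0 c) mphi phi1.
have -> : (fun x => \sum_(k <- iota 0 (size rs)) c`_k * phi k x) =
    fun x => \sum_(k <- iota 0 (size rs)) c`_k * (all x (nth [::] rs k))%:R.
  by apply/funext => x; apply: eq_bigr => k _; rewrite /phi indic_all_true.
move=> ->; apply: eq_bigr => k _; rewrite /Rintegral integral_indic ?setIT//.
exact: measurable_all_true.
Qed.

Lemma measure_all_true_nil (mu : probability bit_space R) : fine (mu (all_true [::])) = 1.
Proof.
rewrite (_ : all_true [::] = setT); last by apply/seteqP; split.
by rewrite [mu setT](_ : _ = 1%E)//; exact: probability_setT.
Qed.

Lemma Rintegral_spin (mu : probability bit_space R) i :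
  \int[mu]_x spin i x = 2 * fine (mu (all_true [:: i])) - 1.
Proof.
have := Rintegral_all_true mu [:: [:: i]; [::]] [:: 2; -1].
rewrite !big_cons big_nil /= measure_all_true_nil mulr1 addr0 => <-.
by apply: eq_Rintegral => x _; rewrite !big_cons big_nil /= andbT /spin; ring.
Qed.

Lemma Rintegral_spin2 (mu : probability bit_space R) i j :
  \int[mu]_x (spin i x * spin j x) = 4 * fine (mu (all_true [:: i; j])) -
    2 * fine (mu (all_true [:: i])) - 2 * fine (mu (all_true [:: j])) + 1.
Proof.
have := Rintegral_all_true mu [:: [:: i; j]; [:: i]; [:: j]; [::]] [:: 4; -2; -2; 1].
rewrite !big_cons big_nil /= measure_all_true_nil mulr1 addr0 !mulNr !addrA => <-.
apply: eq_Rintegral => x _; rewrite !big_cons big_nil /= !andbT /spin.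
by case: (x i); case: (x j); rewrite /=; ring.
Qed.

End Spin.

Section Correspondence.
Variables (R : realType) (G : groupType) (F : nat -> {fset G}) (H : set G).
Hypothesis G_countable : countable [set: G].
Hypothesis G_infinite : infinite_set [set: G].
Hypothesis F_folner : folner R F.
Hypothesis H_ne1 : H `<=` [set~ 1%g].

Lemma not_near_subsequence (P : nat -> Prop) : ~ (\forall N \near \oo, P N) ->
  exists phi : nat -> nat, (forall k, k <= phi k)%N /\ forall k, ~ P (phi k).
Proof.
move=> nP; have /choice[phi phiP] : forall k, exists N, (k <= N)%N /\ ~ P N.
  move=> k; apply: contrapT => none; apply: nP; exists k => // N /= kN.
  by apply: contrapT => nPN; apply: none; exists N.
by exists phi; split => k; case: (phiP k).
Qed.

Section Mean.
Variables (U : set_system nat) (phi : nat -> nat).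
Hypothesis U_ultra : UltraFilter U.
Hypothesis U_oo : nbhs \oo `<=` U.
Hypothesis phi_ge : forall k, (k <= phi k)%N.

Definition mean (u : G -> R) : R := ulim U (fun k => ravg (F (phi k)) u).

Lemma mean_cvg (u : G -> R) (C : R) : (forall g, `|u g| <= C) ->
  ravg (F (phi k)) u @[k --> U] --> mean u.
Proof.
move=> uC; apply: (ulimP U_ultra (C := C)) => k; have F0 := F_folner.1 (phi k).
by rewrite (le_trans (ler_norm_ravg _ _))// -[leRHS](ravg_cst C F0) ler_ravg.
Qed.

Lemma mean_unique (u : G -> R) l : ravg (F (phi k)) u @[k --> U] --> l -> mean u = l.
Proof. have pU : ProperFilter U by exact: ultra_proper. exact: cvg_lim. Qed.

Lemma cvg_subseq (u : nat -> R) (l : R) : u N @[N --> \oo] --> l -> u (phi k) @[k --> U] --> l.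
Proof.
move=> ul; apply: cvg_trans ul => A [N _ NA]; apply: U_oo; exists N => // k /= Nk.
by apply: NA; exact: leq_trans (phi_ge k).
Qed.

Lemma mean_lim (u : G -> R) l : ravg (F N) u @[N --> \oo] --> l -> mean u = l.
Proof. by move=> /cvg_subseq/mean_unique. Qed.

Lemma meanD (u v : G -> R) (C : R) : (forall g, `|u g| <= C) -> (forall g, `|v g| <= C) ->
  mean (fun g => u g + v g) = mean u + mean v.
Proof.
have pU : ProperFilter U by exact: ultra_proper.
move=> uC vC; apply: mean_unique; under eq_fun do rewrite ravgD.
by apply: cvgD; exact: mean_cvg.
Qed.

Lemma meanZ (a : R) (u : G -> R) (C : R) : (forall g, `|u g| <= C) ->
  mean (fun g => a * u g) = a * mean u.
Proof.
have pU : ProperFilter U by exact: ultra_proper.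
move=> uC; apply: mean_unique; under eq_fun do rewrite ravgZ.
by apply: cvgM; [exact: cvg_cst|exact: mean_cvg].
Qed.

Lemma mean_cst (a : R) : mean (fun=> a) = a.
Proof.
apply: mean_lim; apply: (@eq_cvgn _ (fun=> a)) => [N|]; last exact: cvg_cst.
by rewrite ravg_cst//; case: F_folner.
Qed.

Lemma mean_ge0 (u : G -> R) : (forall g, 0 <= u g <= 1) -> 0 <= mean u.
Proof.
have pU : ProperFilter U by exact: ultra_proper.
move=> u01; have u1 g : `|u g| <= 1 by case/andP: (u01 g) => ? ?; rewrite ger0_norm.
rewrite -(cvg_lim _ (mean_cvg u1))//; apply: limr_ge; first exact: mean_cvg u1.
apply: nearW => k; rewrite /ravg mulr_ge0 ?invr_ge0// sumr_ge0// => g _.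
by case/andP: (u01 g).
Qed.

Lemma mean_shift (u : G -> R) b : (forall g, `|u g| <= 1) ->
  mean (fun g => u (b * g)%g) = mean u.
Proof.
have pU : ProperFilter U by exact: ultra_proper.
move=> u1; apply/eqP; rewrite -subr_eq0; apply/eqP; symmetry.
have h1 := mean_cvg u1; have h2 := mean_cvg (fun g => u1 (b * g)%g).
have := cvg_subseq (ravg_shift F_folner b u1) => h3.
rewrite -(cvg_lim _ h3)//; apply: cvg_lim => //.
exact: (cvgB h2 h1).
Qed.

End Mean.

Lemma vdC_disk : vdC R H -> forall z : G -> R[i], (forall g, `|z g| <= 1) ->
  (forall h, H h -> average_cvg F (fun g => z (h * g)%g * (z g)^*) 0) ->
  average_cvg F z 0.
Proof.
move=> vH z z1 zH; apply/average_cvg0P => e e0; apply: contrapT.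
(* The bad subsequence is fixed before the ultrafilter, so that an ultralimit 0 of the averages
   along it is a contradiction. *)
move=> /not_near_subsequence[sub [sub_ge sub_bad]].
have [U [U_ultra U_oo]] := ultraFilterLemma (eventually_filter : ProperFilter (nbhs \oo)).
have pU : ProperFilter U by exact: ultra_proper.
pose E := mean U sub.
have [site [idx [siteK idxK]]] := countable_enum G_countable G_infinite.
(* Two bits per group element: odd positions carry the real part, even ones the imaginary part. *)
pose pos (b : G) (t : bool) : nat := (t + (idx b).*2)%N.
have pos_odd b t : odd (pos b t) = t by rewrite /pos oddD odd_double addbF oddb.
have pos_half b t : site (pos b t)./2 = b by rewrite /pos half_bit_double idxK.
have posK n : pos (site n./2) (odd n) = n by rewrite /pos siteK odd_double_half.
pose v (t : bool) g : R := if t then complex.Re (z g) else complex.Im (z g).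
have v1 t g : `|v t g| <= 1 by case: t; [exact: normC1_Re|exact: normC1_Im].
pose V n g : R := v (odd n) (site n./2 * g)%g.
(* With this success probability the spin of bit [n] at base point [g] has mean [V n g]. *)
pose bit n g : R := (1 + V n g) / 2.
have bit01 n g : 0 <= bit n g <= 1.
  have := v1 (odd n) (site n./2 * g)%g; rewrite /bit /V ler_norml => /andP[h1 h2].
  by apply/andP; split; lra.
have norm01 (u : G -> R) : (forall g, 0 <= u g <= 1) -> forall g, `|u g| <= 1.
  by move=> u01 g; case/andP: (u01 g) => ? ?; rewrite ger0_norm.
have E1 : E (fun=> 1) = 1 by exact: mean_cst.
have E_ge0 u : (forall g, 0 <= u g <= 1) -> 0 <= E u by exact: mean_ge0.
have E_D u w : (forall g, 0 <= u g <= 1) -> (forall g, 0 <= w g <= 1) ->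
    E (fun g => u g + w g) = E u + E w.
  by move=> /norm01 u01 /norm01 w01; exact: meanD u01 w01.
pose mu := mixture E bit.
have muE r : mu (all_true r) = (E (fun g => \prod_(i <- undup r) bit i g))%:E.
  exact: mixture_all_true.
(* Right multiplication on sites yields the composition law [T g (T h x) = T (g * h) x]. At base
   point [g] it amounts to passing to [h * g], so invariance of [mu] is left invariance of the
   mean. *)
pose tau h n := pos (site n./2 * h)%g (odd n).
pose T h (x : bit_space) : bit_space := fun n => x (tau h n).
have Tall h r : T h @^-1` all_true r = all_true (map (tau h) r).
  by apply/seteqP; split => x; rewrite /all_true /= all_map.
have tau_inj h : injective (tau h).
  move=> i j tij; rewrite -(posK i) -(posK j); congr pos.
    by have := congr1 (fun k => site k./2) tij; rewrite /tau !pos_half => /mulIg.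
  by have := congr1 odd tij; rewrite /tau !pos_odd.
have mT h : measurable_fun setT (T h).
  apply: (@measurability _ _ bit_space bit_space setT (T h) bit_generators) => //.
  by move=> _ [_ [r _ <-] <-]; rewrite setTI Tall; exact: measurable_all_true.
have muT h A : measurable A -> mu (T h @^-1` A) = mu A.
  pose Tm : {mfun bit_space >-> bit_space} :=
    MeasurableFun.Pack (MeasurableFun.Class (@isMeasurableFun.Build _ _ _ _ (T h) (mT h))).
  have := @measure_unique _ R bit_space bit_generators (fun=> setT) erefl _ _ _ (distribution mu Tm) mu.
  move=> /(_ _ _ _ _ _ A); apply.
  - move=> _ _ [r _ <-] [r' _ <-]; exists (r ++ r') => //.
    by apply/seteqP; split => x; rewrite /all_true /= all_cat => /andP.
  - by move=> _; exists [::] => //; apply/seteqP; split.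
  - by apply/seteqP; split => // x _; exists 0%N.
  - move=> _ [r _ <-]; rewrite -[LHS]/(mu (T h @^-1` all_true r)) Tall muE [RHS]muE.
    rewrite undup_map_inj//; congr (_%:E).
    transitivity (E (fun g => \prod_(i <- undup r) bit i (h * g)%g)).
      congr E; apply/funext => g; rewrite big_map; apply: eq_bigr => i _.
      by rewrite /bit /V /tau pos_half pos_odd mulgA.
    apply: (mean_shift U_ultra U_oo sub_ge (u := fun g => \prod_(i <- undup r) bit i g)).
    by apply: norm01 => g; exact: prod_bit01.
  - by move=> _; apply: le_lt_trans (probability_le1 (distribution mu Tm) measurableT) _; rewrite ltry.
have mpT : mp_action mu T.
  split => // [x|g h x].
  - by apply/funext => n; rewrite /T /tau mulg1 posK.
  - by apply/funext => n; rewrite /T /tau pos_half pos_odd mulgA.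
have bit1 n g : `|bit n g| <= 1 by exact: norm01.
have V1 n g : `|V n g| <= 1 by exact: v1.
have fine_mu r : fine (mu (all_true r)) = E (fun g => \prod_(i <- undup r) bit i g) by rewrite muE.
have meanZ_ (a : R) u : (forall g, `|u g| <= 1) -> E (fun g => a * u g) = a * E u.
  by move=> u1; exact: meanZ u1.
have EV n : \int[mu]_x spin R n x = E (V n).
  rewrite Rintegral_spin fine_mu /= -meanZ_ => [|g]; last by rewrite big_seq1.
  apply/eqP; rewrite subr_eq -[X in _ + X]E1; apply/eqP.
  rewrite -(meanD sub U_ultra (C := 1))//; last by move=> g; rewrite normr1.
  by congr E; apply/funext => g; rewrite big_seq1 /bit; field.
have EV2 m n : m != n -> \int[mu]_x (spin R m x * spin R n x) = E (fun g => V m g * V n g).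
  move=> mn; rewrite Rintegral_spin2 !fine_mu /= inE (negbTE mn).
  have bb g : `|bit m g * bit n g| <= 1 by rewrite normrM mulr_ile1.
  have VV g : `|V m g * V n g| <= 1 by rewrite normrM mulr_ile1.
  (* This is [V = 2 * bit - 1] multiplied out and arranged without subtraction, to use additivity of
     the mean. *)
  have e1 : E (fun g => 4 * (bit m g * bit n g)) + E (fun=> 1) =
      E (fun g => V m g * V n g) + E (fun g => 2 * bit m g + 2 * bit n g).
    have b5 (u : G -> R) : (forall g, `|u g| <= 1) -> forall g, `|4 * u g| <= 5.
      by move=> u1 g; have := u1 g; rewrite !ler_norml => /andP[? ?]; apply/andP; split; lra.
    have le5 (u : G -> R) : (forall g, `|u g| <= 1) -> forall g, `|u g| <= 5.
      by move=> u1 g; rewrite (le_trans (u1 g))// ler1n.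
    rewrite -(meanD sub U_ultra (b5 _ bb))//; last by move=> g; rewrite normr1 ler1n.
    rewrite -(meanD sub U_ultra (le5 _ VV)); last first.
      by move=> g; have /andP[? ?] := bit01 m g; have /andP[? ?] := bit01 n g;
        rewrite ler_norml; apply/andP; split; lra.
    by congr E; apply/funext => g; rewrite /bit; field.
  have e2 : E (fun g => 2 * bit m g + 2 * bit n g) = 2 * E (bit m) + 2 * E (bit n).
    rewrite -!meanZ_//; apply: (meanD sub U_ultra (C := 2)) => g.
      by have /andP[? ?] := bit01 m g; rewrite ler_norml; apply/andP; split; lra.
    by have /andP[? ?] := bit01 n g; rewrite ler_norml; apply/andP; split; lra.
  move: e1; rewrite e2 E1 meanZ_//.
  have -> : (fun g => \prod_(i <- [:: m; n]) bit i g) = (fun g => bit m g * bit n g).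
    by apply/funext => g; rewrite !big_cons big_nil mulr1.
  have b1E k : (fun g => \prod_(i <- [:: k]) bit i g) = bit k.
    by apply/funext => g; rewrite big_seq1.
  by rewrite !b1E; lra.
pose f (x : bit_space) : R[i] := Complex (spin R (pos 1%g true) x) (spin R (pos 1%g false) x).
have fT h x : f (T h x) = Complex (spin R (pos h true) x) (spin R (pos h false) x).
  by rewrite /f /spin /T /tau !pos_half !pos_odd mul1g.
have fL : cLinfty mu f.
  split; [exact: measurable_spin|exact: measurable_spin|].
  rewrite /finite_norm unlock.
  have -> : (0 < mu setT)%E by rewrite [mu setT](_ : _ = 1%E)//; exact: probability_setT.
  apply: (@le_lt_trans _ _ 2%:E); last exact: ltry.
  apply/ess_sup_inf.ess_supP; apply: aeW => x; rewrite /= lee_fin ger0_norm ?sqrtr_ge0//.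
  have := spin_le1 R (pos 1%g true) x; have := spin_le1 R (pos 1%g false) x.
  rewrite !ler_norml => /andP[? ?] /andP[? ?].
  by rewrite -[leRHS]ger0_norm// -[leRHS]sqrtr_sqr ler_sqrt ?sqr_ge0//; nra.
have V_pos b t g : V (pos b t) g = v t (b * g)%g by rewrite /V pos_half pos_odd.
have corr0 h : H h -> cintegral mu (fun x => f (T h x) * (f x)^*) = 0.
  move=> Hh; have h1 : h != 1%g by apply/eqP; exact: H_ne1.
  (* The two bits in each product are distinct, hence independent at each base point, and [EV2]
     applies. *)
  have pos_ne t t' : pos h t != pos 1%g t'.
    by apply: contra h1 => /eqP/(congr1 (fun k => site k./2)); rewrite !pos_half => ->.
  have int_spin m n : mu.-integrable setT (EFin \o (fun x => spin R m x * spin R n x)).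
    apply: (integrable_bounded mu (C := 1)); first by apply: measurable_funM; exact: measurable_spin.
    by move=> x; rewrite normrM mulr_ile1 ?spin_le1.
  have VV m n g : `|V m g * V n g| <= 1 by rewrite normrM mulr_ile1.
  have /average_cvgP[/= zre zim] := zH h Hh.
  have reE : (fun x => complex.Re (f (T h x) * (f x)^*)) = fun x =>
      spin R (pos h true) x * spin R (pos 1%g true) x + spin R (pos h false) x * spin R (pos 1%g false) x.
    by apply/funext => x; rewrite Re_mul_conj fT.
  have imE : (fun x => complex.Im (f (T h x) * (f x)^*)) = fun x =>
      spin R (pos h false) x * spin R (pos 1%g true) x - spin R (pos h true) x * spin R (pos 1%g false) x.
    by apply/funext => x; rewrite Im_mul_conj fT.
  rewrite /cintegral reE imE; apply/eqP; rewrite eq_complex; apply/andP; split; apply/eqP.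
    transitivity (\int[mu]_x (spin R (pos h true) x * spin R (pos 1%g true) x +
      spin R (pos h false) x * spin R (pos 1%g false) x)); first by [].
    rewrite RintegralD// !EV2// -(meanD sub U_ultra (VV _ _) (VV _ _)).
    apply: (mean_lim U_ultra U_oo sub_ge); apply: eq_cvgn zre => N; apply: eq_ravg => g _.
    by rewrite !V_pos Re_mul_conj mul1g.
  transitivity (\int[mu]_x (spin R (pos h false) x * spin R (pos 1%g true) x -
    spin R (pos h true) x * spin R (pos 1%g false) x)); first by [].
  have VVN m n g : `|- 1 * (V m g * V n g)| <= 1 by rewrite mulN1r normrN.
  rewrite RintegralB// !EV2// -[X in _ - X]mul1r -mulNr -(meanZ_ _ _ (VV _ _)).
  rewrite -(meanD sub U_ultra (VV _ _) (VVN _ _)).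
  apply: (mean_lim U_ultra U_oo sub_ge); apply: eq_cvgn zim => N; apply: eq_ravg => g _.
  by rewrite !V_pos Im_mul_conj mul1g mulN1r.
have := vH _ _ mu T mpT f fL corr0; rewrite /cintegral => -[].
rewrite !EV => Etrue Efalse.
have sub_cvg (t : bool) : ravg (F (sub k)) (v t) @[k --> U] --> (0 : R).
  have : mean U sub (v t) = 0.
    rewrite (_ : v t = V (pos 1%g t)); first by case: t.
    by apply/funext => g; rewrite V_pos mul1g.
  by move <-; exact: (mean_cvg U_ultra (v1 t)).
have e2 : 0 < e / 2 by rewrite divr_gt0.
have /cvgrPdist_lt/(_ _ e2) h1 := sub_cvg true.
have /cvgrPdist_lt/(_ _ e2) h2 := sub_cvg false.
have [k [k1 k2]] := filter_ex (filterI h1 h2).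
apply: (sub_bad k); apply: normC_lt_parts.
  by move: k1; rewrite sub0r normrN Re_average.
by move: k2; rewrite sub0r normrN Im_average.
Qed.

End Correspondence.

Theorem theorem4p1 (R : realType) (G : groupType)
    (G_countable : countable [set: G]) (G_infinite : infinite_set [set: G])
    (F : nat -> {fset G}) (F_folner : folner R F)
    (H : set G) (H_ne1 : H `<=` [set~ 1%g]) :
  [<-> F_vdC R F H;
       (forall z : G -> R[i], (forall g, `|z g| <= 1) ->
          (forall h, H h -> average_cvg F (fun g => z (h * g)%g * (z g)^*) 0) ->
          average_cvg F z 0);
       (forall z : G -> R[i], (forall g, `|z g| = 1) ->
          (forall h, H h -> average_cvg F (fun g => z (h * g)%g * (z g)^*) 0) ->
          average_cvg F z 0);
       vdC R H;
       (forall eps : R, 0 < eps ->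
          exists2 delta : R, 0 < delta &
          exists A H0 : {fset G},
            [/\ A != fset0,
                [set` H0] `<=` H &
                forall (K : nat) (z : 'I_K -> G -> R[i]), (0 < K)%N ->
                  (forall k a, `|z k a| <= 1) ->
                  (forall h, h \in H0 ->
                     `|(K%:R * #|` A|%:R)^-1 *
                       \sum_(k < K) \sum_(a <- A) z k (h * a)%g * (z k a)^*|
                       < delta%:C%C) ->
                  `|(K%:R * #|` A|%:R)^-1 *
                    \sum_(k < K) \sum_(a <- A) z k a| < eps%:C%C])].
Proof.
have disk := F_vdC_disk G_countable G_infinite F_folner H_ne1.
have finitary := disk_finitary G_countable G_infinite F_folner.
have correspondence := vdC_disk G_countable G_infinite F_folner H_ne1.
(* Here (3) yields (4) through (1), (2) and (5); (4) yields (5) through (2); and (5) yields (1)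
   through (2) and (3). *)
tfae => [|diskH z z1|circleH|/correspondence/finitary//|finH].
- exact: disk.
- by apply: diskH => g; rewrite z1.
- by apply/finitary_vdC/finitary/disk; exact: circle_vdC.
- apply: circle_vdC => // z z1; apply: (finitary_disk F_folner finH) => g.
  by rewrite z1.
Qed.
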